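(* Let $N\ge3$, let $\Omega\subset\mathbb{R}^N$ be a bounded domain, let $\lambda,\mu$ be real constants with $\mu>0$, $\lambda+2\mu>0$, and let $p\ge2$ be such that $$\left(1-\frac2p\right)^2<\begin{cases}\mu/(\lambda+2\mu),&\text{if }\lambda+\mu>0,\\(\lambda+2\mu)/\mu,&\text{if }\lambda+\mu\le0.\end{cases}$$ Let $F=\{F_{ij}\}\in[L^{\frac{Np}{N+p-2}}(\Omega)]^{N^2}$ and let $u\in[\mathring{H}^1(\Omega)]^N$ be the solution of the Dirichlet problem $$Eu=\operatorname{Div}F\ \text{ in }\Omega,\qquad u=0\ \text{ on }\partial\Omega,$$ where $Eu=\mu\Delta u+(\lambda+\mu)\nabla\operatorname{div}u$ and $\operatorname{Div}F$ is the vector whose $j$-th component is $\partial_iF_{ij}$. Then $$\int_\Omega|\nabla u|^2\,(|u|^{p-2}+1)\,dx<+\infty .$$ In particular, $$\int_\Omega|\nabla u|^2|u|^{p-2}\,dx\le C\left(\int_\Omega|F|^{\frac{Np}{N+p-2}}dx\right)^{\frac{N+p-2}{N}},$$ where the constant $C$ does not depend on $u$ (nor on $F$). Moreover $u\in[L^{\frac{Np}{N-2}}(\Omega)]^N$.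
   Context: $\mathring{H}^1(\Omega)$ is the closure of $C_c^\infty(\Omega)$ in the $H^1$ norm. Summation over repeated indices is understood and $|F|=(\sum_{i,j}|F_{ij}|^2)^{1/2}$. That $u\in[\mathring{H}^1(\Omega)]^N$ solves the Dirichlet problem means $$\int_\Omega\big[\mu\,\partial_iu_j\,\partial_iv_j+(\lambda+\mu)(\operatorname{div}u)(\operatorname{div}v)\big]dx=\int_\Omega F_{ij}\,\partial_iv_j\,dx\qquad\text{for all }v\in[\mathring{H}^1(\Omega)]^N ;$$ such a $u$ exists and is unique (note $Np/(N+p-2)\ge2$). *)

(* Defs.v *)
From HB Require Import structures.
From mathcomp Require Import all_boot all_order all_algebra.
From mathcomp Require Import all_classical all_reals all_analysis.
Import Order.TTheory GRing.Theory Num.Theory.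
Import numFieldNormedType.Exports.

Set Implicit Arguments.
Unset Strict Implicit.
Unset Printing Implicit Defensive.

Local Open Scope classical_set_scope.
Local Open Scope ring_scope.

Definition rV_display : measure_display. Proof. exact. Qed.

(* 'rV[R]_n carries the sigma-algebra generated by the coordinates, as n-tuples
   do in the library; it is the Borel one, see measurable_rVE. *)
Section rV_measurable.
Variables (R : realType) (n : nat).

Let coor (i : 'I_n) (x : 'rV[R]_n) : R := x ord0 i.

HB.instance Definition _ := @isMeasurable.Build rV_display 'rV[R]_n
  (g_sigma_preimage coor) (@sigma_algebra0 _ _ _) (@sigma_algebraC _ _)
  (@sigma_algebra_bigcup _ _ _).

Lemma measurable_coord (i : 'I_n) :
  measurable_fun [set: 'rV[R]_n] (fun x : 'rV[R]_n => x ord0 i).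
Proof.
move=> _ Y mY; rewrite setTI; apply: sub_sigma_algebra => /=.
rewrite -bigcup_seq/=; exists i => /=; first by rewrite mem_index_enum.
by exists Y => //; rewrite setTI.
Qed.

Lemma measurable_fun_rVP d (T : measurableType d) (f : T -> 'rV[R]_n) :
  (forall i, measurable_fun [set: T] (fun x => f x ord0 i)) ->
  measurable_fun [set: T] f.
Proof.
move=> mf _ A mA; rewrite setTI.
have : g_sigma_preimage (fun i x => f x ord0 i) `<=` measurable.
  apply: smallest_sub; first exact: sigma_algebra_measurable.
  by rewrite -bigcup_seq => B [i _ [C mC <-]]; exact: mf.
apply; have -> : (fun i x => f x ord0 i) = (fun i => coor i \o f) by [].
by rewrite g_sigma_preimage_comp; exists A => //; rewrite setTI.
Qed.

End rV_measurable.

Section rV_cons.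
Variables (R : realType) (n : nat).

Definition rV_cons (z : R * 'rV[R]_n) : 'rV[R]_n.+1 :=
  \row_i (if unlift ord0 i is Some j then z.2 ord0 j else z.1).

Definition rV_uncons (x : 'rV[R]_n.+1) : R * 'rV[R]_n :=
  (x ord0 ord0, \row_i x ord0 (lift ord0 i)).

Lemma rV_consK : cancel rV_cons rV_uncons.
Proof.
move=> [a v]; rewrite /rV_uncons/=; congr pair; first by rewrite mxE unlift_none.
by apply/rowP => i; rewrite !mxE liftK.
Qed.

Lemma rV_unconsK : cancel rV_uncons rV_cons.
Proof.
move=> x; apply/rowP => i; rewrite mxE.
by case: (unliftP ord0 i) => [j|] ->; rewrite /= ?mxE.
Qed.

Lemma measurable_rV_cons : measurable_fun [set: R * 'rV[R]_n] rV_cons.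
Proof.
apply: measurable_fun_rVP => i; rewrite /rV_cons; under eq_fun do rewrite mxE.
case: (unlift ord0 i) => [j|]; last exact: measurable_fst.
exact: measurableT_comp (measurable_coord j) measurable_snd.
Qed.

Lemma measurable_rV_uncons : measurable_fun [set: 'rV[R]_n.+1] rV_uncons.
Proof.
apply/measurable_fun_pairP; split; first exact: measurable_coord.
apply: measurable_fun_rVP => i.
rewrite (_ : (fun x => _) = fun x : 'rV[R]_n.+1 => x ord0 (lift ord0 i)).
  exact: measurable_coord.
by apply/funext => x /=; rewrite mxE.
Qed.

End rV_cons.

Section lebesgue_step.
Local Open Scope ereal_scope.
Variables (R : realType) (n : nat).
Variable m : {sigma_finite_measure set 'rV[R]_n -> \bar R}.

Definition lebesgue_step : set 'rV[R]_n.+1 -> \bar R :=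
  pushforward (@lebesgue_measure R \x m) (@rV_cons R n).

Let lebesgue_step0 : lebesgue_step set0 = 0.
Proof. by rewrite /lebesgue_step /pushforward preimage_set0 measure0. Qed.

Let lebesgue_step_ge0 A : 0 <= lebesgue_step A.
Proof. by apply: integral_ge0 => x _; exact: measure_ge0. Qed.

Let lebesgue_step_sigma_additive : semi_sigma_additive lebesgue_step.
Proof.
move=> F mF tF mUF; rewrite /lebesgue_step /pushforward preimage_bigcup.
apply: measure_semi_sigma_additive.
- by move=> k; rewrite -[X in measurable X]setTI; exact: measurable_rV_cons.
- apply/trivIsetP => /= i j _ _ ij; rewrite -preimage_setI.
  by move/trivIsetP : tF => /(_ _ _ _ _ ij) ->//; rewrite preimage_set0.
- rewrite -preimage_bigcup -[X in measurable X]setTI.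
  exact: measurable_rV_cons.
Qed.

HB.instance Definition _ := isMeasure.Build _ _ _ lebesgue_step
  lebesgue_step0 lebesgue_step_ge0 lebesgue_step_sigma_additive.

Let lebesgue_step_sigma_finite : sigma_finite setT lebesgue_step.
Proof.
have /sigma_finiteP[F [FT ndF Foo]] := sigma_finiteT (@lebesgue_measure R).
have /sigma_finiteP[G [GT ndG Goo]] := sigma_finiteT m.
exists (fun k => @rV_uncons R n @^-1` (F k `*` G k)).
  rewrite -preimage_bigcup -[LHS](preimage_setT (@rV_uncons R n)).
  congr (_ @^-1` _); rewrite -setXTT FT GT predeqE => -[x y]; split.
    move=> [/= [i _ Fx] [j _ Gy]]; exists (maxn i j) => //; split.
    - by move: x Fx; exact/subsetPset/ndF/leq_maxl.
    - by move: y Gy; exact/subsetPset/ndG/leq_maxr.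
  by move=> [i _ []/= ? ?]; split; exists i.
move=> k; have [mF Fk] := Foo k; have [mG Gk] := Goo k; split.
  rewrite -[X in measurable X]setTI; apply: measurable_rV_uncons => //.
  exact: measurableX.
rewrite /lebesgue_step /pushforward -comp_preimage.
rewrite (_ : _ \o _ = id) ?preimage_id; last exact/funext/rV_consK.
by rewrite product_measure1E// lte_mul_pinfty// ge0_fin_numE.
Qed.

HB.instance Definition _ := Measure_isSigmaFinite.Build _ _ _ lebesgue_step
  lebesgue_step_sigma_finite.

End lebesgue_step.

(* Lebesgue measure on R^N, as an iterated product; see leb_box. *)
Fixpoint leb (R : realType) (N : nat) :
    {sigma_finite_measure set 'rV[R]_N -> \bar R} :=
  if N is n.+1 then lebesgue_step (leb R n) else \d_(0 : 'rV[R]_0).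

Lemma leb_box (R : realType) (N : nat) (A : 'I_N -> set R) :
  (forall i, measurable (A i)) ->
  leb R N [set x | forall i, A i (x ord0 i)] =
  (\prod_(i < N) lebesgue_measure (A i))%E.
Proof.
elim: N A => [|n IHn] A mA.
  by rewrite big_ord0 /= diracE mem_set// => -[].
pose B := [set x : 'rV[R]_n | forall i, A (lift ord0 i) (x ord0 i)].
have mB : measurable B.
  rewrite (_ : B = \bigcap_(i in [set: 'I_n])
      ((fun x : 'rV[R]_n => x ord0 i) @^-1` A (lift ord0 i))).
    apply: fin_bigcap_measurable => // i _; rewrite -[X in measurable X]setTI.
    exact: measurable_coord.
  by apply/seteqP; split=> x /= xB i; [move=> _; exact: xB|exact: xB].
rewrite big_ord_recl -(IHn (fun i => A (lift ord0 i)))//.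
rewrite -[RHS]product_measure1E//=; last exact: mA.
rewrite /lebesgue_step /pushforward.
congr product_measure1; apply/seteqP; split => -[a v] /= => [xA|[Aa Bv] i].
- split; first by have := xA ord0; rewrite mxE unlift_none.
  by move=> i; have := xA (lift ord0 i); rewrite mxE liftK.
- by rewrite mxE; case: (unliftP ord0 i) => [j|] ->; [exact: Bv|exact: Aa].
Qed.

Lemma open_measurable_rV (R : realType) (n : nat) (U : set 'rV[R]_n) :
  open U -> measurable U.
Proof.
move=> oU; pose r (qk : 'rV[rat]_n * nat) : set 'rV[R]_n :=
  ball (map_mx (@ratr R) qk.1) qk.2.+1%:R^-1.
have mr qk : measurable (r qk).
  rewrite (_ : r qk = \bigcap_(i in [set: 'I_n])
      ((fun x : 'rV[R]_n => x ord0 i) @^-1`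
        (ball (@ratr R (qk.1 ord0 i)) qk.2.+1%:R^-1))).
    apply: fin_bigcap_measurable => // i _; rewrite -[X in measurable X]setTI.
    by apply: measurable_coord => //; by rewrite ball_itv.
  apply/seteqP; split=> [x [_ xr] i _|x xr]; first by have := xr ord0 i; rewrite mxE.
  by split=> // i j; rewrite ord1 mxE; exact: xr.
rewrite (_ : U = \bigcup_qk if `[< r qk `<=` U >] then r qk else set0).
  by apply: countable_bigcupT_measurable => // qk; case: ifP.
apply/seteqP; split=> [x Ux|x [qk _]]; last by case: ifPn => // /asboolP; exact.
have /nbhs_ballP[e /= e0 eU] : nbhs x U by exact: open_nbhs_nbhs.
have [k _ /(_ _ (leqnn _)) ke] : \forall k \near \oo, k.+1%:R^-1 < e / 2 :> R.
  by apply: near_infty_natSinv_lt (PosNum _); rewrite divr_gt0.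
have /choice[q qx] (i : 'I_n) :
    exists q : rat, ball (x ord0 i) (k.+1%:R^-1 : R) (@ratr R q).
  have [|q] := @rat_in_itvoo R (x ord0 i - k.+1%:R^-1) (x ord0 i + k.+1%:R^-1).
    by rewrite ltrBlDr -addrA ltrDl addr_gt0 ?invr_gt0.
  by exists q; rewrite ball_itv.
have xq : ball x (k.+1%:R^-1 : R) (map_mx (@ratr R) (\row_i q i)).
  by split; rewrite ?invr_gt0// => i j; rewrite ord1 !mxE; exact: qx.
exists (\row_i q i, k) => //; rewrite ifT; first exact: ball_sym.
apply/asboolP => y qy; apply: eU; apply: le_ball (ball_triangle xq qy).
by rewrite (splitr e) lerD// ltW.
Qed.

Lemma measurable_rVE (R : realType) (n : nat) :
  @measurable _ 'rV[R]_n = <<s @open 'rV[R]_n >>.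
Proof.
apply/seteqP; split; last first.
  apply: smallest_sub; first exact: sigma_algebra_measurable.
  exact: open_measurable_rV.
apply: smallest_sub; first exact: smallest_sigma_algebra.
rewrite -bigcup_seq => _ [i _ [C mC <-]].
have mcoord : measurable_fun setT
    ((fun x => x ord0 i) : g_sigma_algebraType (@open 'rV[R]_n) -> R).
  apply: (measurability _ (measurable_realfun.RGenOpens.measurableE R)).
  move=> _ [_ [a [b ->]] <-]; rewrite setTI; apply: sub_sigma_algebra => /=.
  apply: open_comp; last exact: itv_open.
  by move=> x _; exact: coord_continuous.
exact: (mcoord measurableT C mC).
Qed.

(* f \_ Omega is the extension of f by 0 outside Omega, so only the values of f
   on Omega matter. *)
Definition in_Lp (R : realType) (N : nat) (Omega : set 'rV[R]_N) (q : R)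
    (f : 'rV[R]_N -> R) : Prop :=
  f \_ Omega \in Lfun (leb R N) q%:E.

Definition partial (R : realType) (N : nat) (i : 'I_N) (f : 'rV[R]_N -> R) :
    'rV[R]_N -> R :=
  'D_(delta_mx ord0 i) f.

(* C^oo: all iterated partial derivatives exist and are continuous. *)
Definition smooth (R : realType) (N : nat) (f : 'rV[R]_N -> R) : Prop :=
  forall s : seq 'I_N,
    continuous (foldr (@partial R N) f s) /\
    forall (i : 'I_N) (x : 'rV[R]_N),
      derivable (foldr (@partial R N) f s) x (delta_mx ord0 i).

Definition test_function (R : realType) (N : nat) (Omega : set 'rV[R]_N)
    (phi : 'rV[R]_N -> R) : Prop :=
  let supp := closure [set x | phi x != 0] in
  [/\ smooth phi, compact supp & supp `<=` Omega].

Definition weak_partial (R : realType) (N : nat) (Omega : set 'rV[R]_N)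
    (i : 'I_N) (f g : 'rV[R]_N -> R) : Prop :=
  forall phi, test_function Omega phi ->
    \int[leb R N]_(x in Omega) (f x * partial i phi x) =
    - \int[leb R N]_(x in Omega) (g x * phi x).

(* Df i is the i-th weak partial derivative of f, which is determined by f only
   up to a null set; hence Sobolev membership is a relation between f and Df. *)
Definition in_H1 (R : realType) (N : nat) (Omega : set 'rV[R]_N)
    (f : 'rV[R]_N -> R) (Df : 'I_N -> 'rV[R]_N -> R) : Prop :=
  in_Lp Omega 2 f /\
  forall i, in_Lp Omega 2 (Df i) /\ weak_partial Omega i f (Df i).

Definition H1_norm (R : realType) (N : nat) (Omega : set 'rV[R]_N)
    (f : 'rV[R]_N -> R) (Df : 'I_N -> 'rV[R]_N -> R) : \bar R :=
  ((\int[leb R N]_(x in Omega) (f x ^+ 2 + \sum_(i < N) Df i x ^+ 2)%:E)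
     `^ 2^-1)%E.

Definition in_H10 (R : realType) (N : nat) (Omega : set 'rV[R]_N)
    (f : 'rV[R]_N -> R) (Df : 'I_N -> 'rV[R]_N -> R) : Prop :=
  in_H1 Omega f Df /\
  forall e : R, 0 < e -> exists2 phi, test_function Omega phi &
    (H1_norm Omega (fun x => phi x - f x)%R
       (fun i x => partial i phi x - Df i x)%R < e%:E)%E.

(* Indexing: Du x i j is the weak derivative of u_j in the i-th direction, so
   div u is the trace of Du. *)
Definition in_H10_vec (R : realType) (N : nat) (Omega : set 'rV[R]_N)
    (u : 'rV[R]_N -> 'rV[R]_N) (Du : 'rV[R]_N -> 'M[R]_N) : Prop :=
  forall j, in_H10 Omega (fun x => u x ord0 j) (fun i x => Du x i j).

(* The library norm of a matrix is the sup norm; this is the Euclidean norm of a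
   vector and the Frobenius norm of a matrix. *)
Definition enorm (R : realType) (m n : nat) (A : 'M[R]_(m, n)) : R :=
  Num.sqrt (\sum_(i < m) \sum_(j < n) `|A i j| ^+ 2).

Definition dirichlet_solution (R : realType) (N : nat) (Omega : set 'rV[R]_N)
    (lam mu : R) (F : 'rV[R]_N -> 'M[R]_N)
    (u : 'rV[R]_N -> 'rV[R]_N) (Du : 'rV[R]_N -> 'M[R]_N) : Prop :=
  in_H10_vec Omega u Du /\
  forall v Dv, in_H10_vec Omega v Dv ->
    \int[leb R N]_(x in Omega)
      (mu * (\sum_(i < N) \sum_(j < N) Du x i j * Dv x i j) +
       (lam + mu) * \tr (Du x) * \tr (Dv x)) =
    \int[leb R N]_(x in Omega)
      \sum_(i < N) \sum_(j < N) F x i j * Dv x i j.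

Definition domain (R : realType) (N : nat) (Omega : set 'rV[R]_N) : Prop :=
  [/\ open Omega, connected Omega & Omega !=set0].

(* Main.v *)
(** For nu >= 1 let X_nu(s) = (1 + nu s) / (nu + s), a bounded regularization of s,
    and put beta = (p - 2) / 2. The solution is tested with W = X_nu(|u|^2)^beta u
    and the resulting form is expressed through V = X_nu(|u|^2)^(beta/2) u: with
    h = X_nu(|u|^2)^(beta/2) and grad V = h grad u + E, it equals
      mu (|grad V|^2 - |E|^2) + (lam + mu) ((div V)^2 - (tr E)^2),
    where |E| <= (1 - 2/p) |grad V| and (tr E)^2 <= |E|^2 because E is a rank one
    matrix. When lam + mu <= 0 the divergence term is controlled by
    \int (div V)^2 <= \int |grad V|^2, valid since V vanishes on the boundary. The
    hypothesis on p then makes the form coercive in grad V, whence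
      \int |grad V|^2 <= C \int X_nu(|u|^2)^beta |F|^2.
    Up to an error vanishing with nu, X_nu(|u|^2)^beta is at most 2 |V|^(2 (1 - 2/p)),
    and Hoelder's and Sobolev's inequalities bound the right-hand side by
    C ||F||_q^2 (\int |grad V|^2)^(1 - 2/p), which is absorbed by the left-hand
    side. Fatou's lemma gives the result as nu tends to infinity. The Sobolev
    inequality comes from the Gagliardo-Nirenberg argument, by induction on the
    dimension. *)
Require Import Defs.
From HB Require Import structures.
From mathcomp Require Import all_boot all_order all_algebra.
From mathcomp Require Import all_classical all_reals all_analysis.
From mathcomp Require Import measurable_realfun ring lra.
Import Order.TTheory GRing.Theory Num.Theory.
Import numFieldNormedType.Exports.

Local Open Scope classical_set_scope.
Local Open Scope ring_scope.

Set Implicit Arguments.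
Unset Strict Implicit.
Unset Printing Implicit Defensive.

(** * The Gagliardo-Nirenberg-Sobolev inequality *)

(** Without an a priori bound on [u] the natural test function |u|^(p-2) u is not known to lie in
    H10. The cutoff X is positive, bounded, smooth on s >= 0, and satisfies s X'(s) <= X(s), as the
    identity does, so truncating costs nothing in the constants: for h = X^(beta/2) this inequality
    yields |E| <= beta/(beta+1) |grad V|, and beta/(beta+1) is 1 - 2/p. The exponent is halved in V
    because then h grad u = grad V - E while grad W = h (grad V + E), which turns the form into a
    difference of squares. No chain rule for weak derivatives is invoked: truncated test functions
    are test functions, and their gradients are the old ones multiplied by bounded coefficients that
    converge almost everywhere, hence converge in L2. For each nu the energy of V is finite, which
    makes the absorption legitimate, and the resulting constant is free of nu. The error term stems
    from X(0) = 1/nu being positive: near the zeros of [u] the weight X^beta is not controlled by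
    |V|. *)

Lemma hoelder_interpolation d (T : measurableType d) (R : realType)
    (m : {measure set T -> \bar R}) (D : set T) (f g : T -> R) (a : R) :
  measurable D -> measurable_fun D f -> measurable_fun D g ->
  (forall x, D x -> 0 <= f x) -> (forall x, D x -> 0 <= g x) -> 0 < a <= 1 ->
  (\int[m]_(x in D) (f x `^ a * g x `^ (1 - a))%:E <=
   (\int[m]_(x in D) (f x)%:E) `^ a * (\int[m]_(x in D) (g x)%:E) `^ (1 - a))%E.
Proof.
(* The endpoint a = 1 is treated apart because 1/(1-a) is then no exponent. It does occur: for p = 2
   the exponent q of the theorem is 2, and a = 2/q. *)
move=> mD mf mg f0 g0 /andP[a0]; rewrite le_eqVlt => /predU1P[->|a1].
  rewrite subrr poweRe0 mule1 poweRe1; last by apply: integral_ge0 => x Dx; rewrite lee_fin f0.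
  rewrite le_eqVlt; apply/orP; left; apply/eqP; apply: eq_integral => x /[!inE] Dx.
  by rewrite powRr0 mulr1 powRr1// f0.
have b0 : 0 < 1 - a by rewrite subr_gt0.
pose F := (fun x => f x `^ a) \_ D; pose G := (fun x => g x `^ (1 - a)) \_ D.
have mF : measurable_fun setT F.
  by apply/(measurable_restrictT _ mD); apply: measurableT_comp (measurable_realfun.measurable_powR a) mf.
have mG : measurable_fun setT G.
  by apply/(measurable_restrictT _ mD); apply: measurableT_comp (measurable_realfun.measurable_powR (1 - a)) mg.
have := @hoelder _ _ _ m F G a^-1 (1 - a)^-1 mF mG.
rewrite !invr_gt0 a0 b0 !invrK => /(_ isT isT); rewrite addrC subrK => /(_ erefl).
rewrite Lnorm1 unlock /= !invrK => H.
have -> : (\int[m]_(x in D) (f x `^ a * g x `^ (1 - a))%:E = \int[m]_x `|(F x * G x)%:E|)%E.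
  rewrite integral_mkcond; apply: eq_integral => x _; rewrite /F /G !patchE; case: ifPn => [|_].
    by move=> _; rewrite abse_EFin ger0_norm// mulr_ge0// powR_ge0.
  by rewrite mulr0 abse0.
apply: le_trans H _.
have E (h : T -> R) (b : R) : 0 < b -> (forall x, D x -> 0 <= h x) ->
   (\int[m]_x (`|((fun x => h x `^ b) \_ D) x| `^ b^-1)%:E = \int[m]_(x in D) (h x)%:E)%E.
  move=> b_gt0 h0; rewrite [RHS]integral_mkcond; apply: eq_integral => x _.
  rewrite !patchE; case: ifPn => [/[!inE] Dx|_].
    by rewrite ger0_norm ?powR_ge0// -powRrM divff ?gt_eqF// powRr1// h0.
  by rewrite normr0 powR0// invr_eq0 gt_eqF.
by rewrite !E.
Qed.

Section tonelli.
Variables (R : realType) (n : nat).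
Implicit Types f : 'rV[R]_n.+1 -> \bar R.

Lemma ge0_integral_leb f : measurable_fun setT f -> (forall x, 0 <= f x)%E ->
  (\int[leb R n.+1]_x f x =
   \int[lebesgue_measure]_t \int[leb R n]_y f (rV_cons (t, y)))%E.
Proof.
move=> mf f0.
rewrite [LHS](@ge0_integral_pushforward _ _ (measurableTypeR R * 'rV[R]_n)%type _ _ _ (@measurable_rV_cons R n)
  (lebesgue_measure \x leb R n)%E)//.
rewrite preimage_setT fubini_tonelli1//; last by move=> x; exact: f0.
exact: measurableT_comp mf (@measurable_rV_cons R n).
Qed.

Lemma ge0_integral_leb_swap f : measurable_fun setT f -> (forall x, 0 <= f x)%E ->
  (\int[leb R n.+1]_x f x =
   \int[leb R n]_y \int[lebesgue_measure]_t f (rV_cons (t, y)))%E.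
Proof.
move=> mf f0.
rewrite [LHS](@ge0_integral_pushforward _ _ (measurableTypeR R * 'rV[R]_n)%type _ _ _ (@measurable_rV_cons R n)
  (lebesgue_measure \x leb R n)%E)//.
rewrite preimage_setT fubini_tonelli2//; last by move=> x; exact: f0.
exact: measurableT_comp mf (@measurable_rV_cons R n).
Qed.

Lemma measurable_slice d (T : measurableType d) (f : 'rV[R]_n.+1 -> T) (t : R) :
  measurable_fun setT f -> measurable_fun setT (fun y : 'rV[R]_n => f (rV_cons (t, y))).
Proof.
by move=> mf; apply: measurableT_comp mf (measurableT_comp (@measurable_rV_cons R n) _).
Qed.

Lemma measurable_slice_integral f : measurable_fun setT f -> (forall x, 0 <= f x)%E ->
  measurable_fun setT (fun t => \int[leb R n]_y f (rV_cons (t, y)))%E.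
Proof.
move=> mf f0; apply: (measurable_fun_fubini_tonelli_F (m2 := leb R n) (f \o @rV_cons R n)).
  exact: measurableT_comp mf (@measurable_rV_cons R n).
by move=> x; exact: f0.
Qed.

End tonelli.

Definition setcoord (R : realType) n (x : 'rV[R]_n) (i : 'I_n) (s : R) : 'rV[R]_n :=
  \row_j (if j == i then s else x ord0 j).

Lemma setcoord_cons0 (R : realType) n (t s : R) (y : 'rV[R]_n) :
  setcoord (rV_cons (t, y)) ord0 s = rV_cons (s, y).
Proof.
apply/rowP => j; rewrite !mxE; case: (unliftP ord0 j) => [k|] -> //=.
Qed.

Lemma setcoord_consS (R : realType) n (t s : R) (y : 'rV[R]_n) i :
  setcoord (rV_cons (t, y)) (lift ord0 i) s = rV_cons (t, setcoord y i s).
Proof.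
apply/rowP => j; rewrite !mxE; case: (unliftP ord0 j) => [k|] ->.
  by rewrite (inj_eq lift_inj) /= mxE.
by rewrite eq_liftF.
Qed.

Section gagliardo.
Variable R : realType.
Local Notation mu := (@lebesgue_measure R).

(** Slicing along the first coordinate. Integrating the bound by [G ord0] over a slice removes t, so
    the integral of f over every slice is at most the total T; the remaining sum integrates in t to
    at most T as well. Together they give the power 1/(n+1) + 1 = (n+2)/(n+1) of T. *)
Lemma gagliardo_step n (f : 'rV[R]_n.+2 -> R) (G : 'I_n.+2 -> 'rV[R]_n.+2 -> R) :
  measurable_fun setT f -> (forall i, measurable_fun setT (G i)) ->
  (forall x, 0 <= f x) -> (forall i x, 0 <= G i x) ->
  (forall i x, (f x)%:E <= \int[mu]_s (G i (setcoord x i s))%:E)%E ->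
  (forall t, \int[leb R n.+1]_y (f (rV_cons (t, y)) `^ (n.+2%:R / n.+1%:R))%:E <=
     (\int[leb R n.+1]_y (f (rV_cons (t, y)))%:E) `^ n.+1%:R^-1 *
     \sum_(i < n.+1) \int[leb R n.+1]_y (G (lift ord0 i) (rV_cons (t, y)))%:E)%E ->
  (\int[leb R n.+2]_x (f x `^ (n.+2%:R / n.+1%:R))%:E <=
   (\sum_i \int[leb R n.+2]_x (G i x)%:E) `^ (n.+2%:R / n.+1%:R))%E.
Proof.
move=> mf mG f0 G0 fG H.
have mfr : measurable_fun setT (fun x => (f x `^ (n.+2%:R / n.+1%:R))%:E).
  by apply/measurable_EFinP; exact: measurableT_comp (measurable_powR _) mf.
rewrite ge0_integral_leb//; last by move=> x; rewrite lee_fin powR_ge0.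
set T := (\sum_i _)%E.
have I0 i : (0 <= \int[leb R n.+2]_x (G i x)%:E)%E by apply: integral_ge0 => x _; rewrite lee_fin.
have S0 (t : R) : (0 <= \sum_(i < n.+1) \int[leb R n.+1]_y (G (lift ord0 i) (rV_cons (t, y)))%:E)%E.
  by apply: sume_ge0 => i _; apply: integral_ge0 => x _; rewrite lee_fin.
have T0 : (0 <= T)%E by exact: sume_ge0.
have mEG i : measurable_fun setT (fun x => (G i x)%:E) by exact/measurable_EFinP.
have mS : measurable_fun setT (fun t =>
   \sum_(i < n.+1) \int[leb R n.+1]_y (G (lift ord0 i) (rV_cons (t, y)))%:E)%E.
  apply: emeasurable_sum => i _; apply: (@measurable_slice_integral R n.+1 (fun x => (G (lift ord0 i) x)%:E)) => //.
  by move=> x; rewrite lee_fin.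
have fT t : (\int[leb R n.+1]_y (f (rV_cons (t, y)))%:E <= T)%E.
  apply: (@le_trans _ _ (\int[leb R n.+2]_x (G ord0 x)%:E)%E); last first.
    by rewrite /T (bigD1 ord0)//= leeDl// sume_ge0.
  rewrite [leRHS]ge0_integral_leb_swap//; last by move=> x; rewrite lee_fin.
  apply: (@ge0_le_integral _ _ _ (leb R n.+1)) => //.
  - by move=> x _; rewrite lee_fin.
  - by apply/measurable_EFinP; exact: measurable_slice.
  - apply: (measurable_fun_fubini_tonelli_G (m1 := mu) (fun z => (G ord0 (rV_cons z))%:E)).
      exact: measurableT_comp (mEG _) (@measurable_rV_cons R n.+1).
    by move=> x; rewrite lee_fin.
  - move=> y _; apply: le_trans (fG ord0 _) _.
    by under eq_integral do rewrite setcoord_cons0.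
apply: (@le_trans _ _ (\int[mu]_t (T `^ n.+1%:R^-1 *
     \sum_(i < n.+1) \int[leb R n.+1]_y (G (lift ord0 i) (rV_cons (t, y)))%:E))%E).
  apply: ge0_le_integral => //.
  - by move=> t _; apply: integral_ge0 => y _; rewrite lee_fin powR_ge0.
  - by apply: (measurable_slice_integral mfr) => x; rewrite lee_fin powR_ge0.
  - exact: emeasurable_funM.
  - move=> t _; apply: le_trans (H t) _; apply: lee_wpmul2r => //.
    apply: gt0_ler_poweR => //; rewrite ?in_itv/= ?leey ?andbT//.
    by apply: integral_ge0 => y _; rewrite lee_fin.
rewrite ge0_integralZl ?poweR_ge0//.
rewrite ge0_integral_sum//; last 2 first.
- move=> i; apply: (@measurable_slice_integral R n.+1 (fun x => (G (lift ord0 i) x)%:E)) => //.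
  by move=> x; rewrite lee_fin.
- by move=> i t _; apply: integral_ge0 => x _; rewrite lee_fin.
have -> : (n.+2%:R / n.+1%:R = n.+1%:R^-1 + 1 :> R)%R.
  by apply: (@mulIf _ n.+1%:R); rewrite ?pnatr_eq0// [RHS]mulrDl mulVf ?pnatr_eq0// mul1r mulfVK ?pnatr_eq0// -natr1 addrC.
rewrite poweRD; last first.
  by apply: add_neq0_poweRD_def; rewrite gt_eqF// addr_gt0// invr_gt0.
rewrite [in leRHS]poweRe1//; apply: lee_wpmul2l; first exact: poweR_ge0.
rewrite /T [leRHS]big_ord_recl -[leLHS]add0e; apply: leeD => //.
apply: lee_sum => i _; rewrite [leRHS]ge0_integral_leb// => x.
by rewrite lee_fin.
Qed.

(** The classical bound has a product of powers of the integrals of the [G i] on the right; a power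
    of their sum is cruder but enough. In dimension two the slice bound is f f <= f times a line
    integral. Above it, the exponent (n+3)/(n+2) on a slice is interpolated between 1 and the
    exponent (n+2)/(n+1) of the induction hypothesis. *)
Lemma gagliardo n (f : 'rV[R]_n.+2 -> R) (G : 'I_n.+2 -> 'rV[R]_n.+2 -> R) :
  measurable_fun setT f -> (forall i, measurable_fun setT (G i)) ->
  (forall x, 0 <= f x) -> (forall i x, 0 <= G i x) ->
  (forall i x, (f x)%:E <= \int[mu]_s (G i (setcoord x i s))%:E)%E ->
  (\int[leb R n.+2]_x (f x `^ (n.+2%:R / n.+1%:R))%:E <=
   (\sum_i \int[leb R n.+2]_x (G i x)%:E) `^ (n.+2%:R / n.+1%:R))%E.
Proof.
elim: n f G => [|n IHn] f G mf mG f0 G0 fG; apply: gagliardo_step => // t.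
  have E x : f x `^ (2 / 1) = f x * f x by rewrite divr1 powR_mulrn// expr2.
  under eq_integral do rewrite E EFinM.
  rewrite invr1 poweRe1; last by apply: integral_ge0 => y _; rewrite lee_fin.
  rewrite big_ord1 -ge0_integralZr//; last 3 first.
  - by apply/measurable_EFinP; exact: measurable_slice.
  - by move=> y _; rewrite lee_fin.
  - by apply: integral_ge0 => y _; rewrite lee_fin.
  apply: (@ge0_le_integral _ _ _ (leb R 1)) => //.
  - by move=> y _; rewrite mule_ge0// lee_fin.
  - by apply: emeasurable_funM; apply/measurable_EFinP; exact: measurable_slice.
  - by apply: emeasurable_funM => //; apply/measurable_EFinP; exact: measurable_slice.
  - move=> y _; apply: lee_wpmul2l; first by rewrite lee_fin.
    apply: le_trans (fG (lift ord0 ord0) _) _.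
    have mg : measurable_fun setT (fun y0 => (G (lift ord0 ord0) (rV_cons (t, y0)))%:E).
      by apply/measurable_EFinP; exact: measurable_slice.
    (* In dimension one [leb] is Lebesgue measure times the Dirac mass at the only vector of length
       0, so this integral is the line integral supplied by [fG]. *)
    rewrite ge0_integral_leb_swap//; last by move=> z; rewrite lee_fin.
    rewrite /= integral_dirac//; last first.
      apply: (measurable_fun_fubini_tonelli_G (m1 := mu)
        (fun z => (G (lift ord0 ord0) (rV_cons (t, rV_cons z)))%:E)).
        exact: measurableT_comp mg (@measurable_rV_cons R 0).
      by move=> x; rewrite lee_fin.
    rewrite diracE in_setT mul1e le_eqVlt; apply/orP; left; apply/eqP.
    apply: eq_integral => s _; rewrite setcoord_consS; congr (G _ (rV_cons (_, _)))%:E.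
    apply/rowP => j; rewrite !mxE ord1 eqxx.
    by case: (unliftP ord0 (ord0 : 'I_1)) => [[]|].
(* With this weight the (1-a)-th power of h is g itself, so the exponents of g add up to a + 1 =
   (n+3)/(n+2). *)
pose a : R := n.+2%:R^-1; pose g y := f (rV_cons (t, y)).
have mg : measurable_fun setT g by exact: measurable_slice.
have a01 : 0 < a <= 1 by rewrite invr_gt0 ltr0n/= invf_le1 ?ltr0n// ler1n.
have N2 : (n.+2%:R : R) != 0 by rewrite pnatr_eq0.
have N1 : (n.+1%:R : R) != 0 by rewrite pnatr_eq0.
have a1 : 1 - a = n.+1%:R / n.+2%:R.
  by apply: (mulIf N2); rewrite mulfVK// [LHS]mulrBl mulVf// mul1r -natr1 addrK.
have a1' : n.+2%:R / n.+1%:R * (1 - a) = 1 :> R by rewrite a1 mulrA mulfVK// divff.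
pose h y := g y `^ (n.+2%:R / n.+1%:R).
have mh : measurable_fun setT h by exact: measurableT_comp (measurable_powR _) mg.
have gh y : g y `^ (n.+3%:R / n.+2%:R) = g y `^ a * h y `^ (1 - a).
  rewrite /h -powRrM a1' -powRD; last by rewrite gt_eqF// addr_gt0// invr_gt0 ltr0n.
  by congr powR; apply: (mulIf N2); rewrite mulfVK// [RHS]mulrDl mulVf// mul1r -natr1 addrC.
under eq_integral do rewrite -/(g _) gh.
have [g0 h0] : (forall y, 0 <= g y) /\ (forall y, 0 <= h y) by split => y; rewrite /h ?powR_ge0 ?/g.
apply: le_trans (hoelder_interpolation _ measurableT mg mh _ _ a01) _ => //.
apply: lee_wpmul2l; first exact: poweR_ge0.
have := IHn g (fun i y => G (lift ord0 i) (rV_cons (t, y))) mg.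
move=> /(_ _ _ _ _)/wrap[].
- by move=> i; exact: measurable_slice.
- by [].
- by [].
- by move=> i y; apply: le_trans (fG (lift ord0 i) _) _; under eq_integral do rewrite setcoord_consS.
move=> /(gt0_ler_poweR (r := 1 - a)) => /(_ _ _ _)/wrap[].
- by rewrite a1 divr_ge0.
- by rewrite in_itv/= leey andbT; apply: integral_ge0 => y _; rewrite lee_fin h0.
- by rewrite in_itv/= leey andbT poweR_ge0.
rewrite -poweRrM a1' poweRe1//.
by apply: sume_ge0 => i _; apply: integral_ge0 => y _; rewrite lee_fin.
Qed.

End gagliardo.

(** * Integrals of derivatives on the real line *)

Section real_line.
Variable R : realType.
Local Notation mu := (@lebesgue_measure R).
Variables (h dh : R -> R) (M : R).
Hypothesis hd : forall x : R, is_derive x 1 h (dh x).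
Hypothesis cdh : continuous dh.
Hypothesis h0 : forall x, M <= `|x| -> h x = 0.

Let FTC a b : a < b -> (\int[mu]_(x in `[a, b]) (dh x)%:E = (h b)%:E - (h a)%:E)%E.
Proof.
move=> ab; have ch : continuous h.
  by move=> x; apply/differentiable_continuous/derivable1_diffP; exact: (@ex_derive _ _ _ _ _ _ _ (hd x)).
apply: continuous_FTC2 => //.
- exact: continuous_subspaceT.
- split.
  + by move=> x _; exact: (@ex_derive _ _ _ _ _ _ _ (hd x)).
  + by apply: cvg_at_right_filter; exact: ch.
  + by apply: cvg_at_left_filter; exact: ch.
- by move=> x _; rewrite derive1E; exact: (@derive_val _ _ _ _ _ _ _ (hd x)).
Qed.

Lemma integral_derive_eq0 : (forall x, M <= `|x| -> dh x = 0) ->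
  (\int[mu]_x (dh x)%:E = 0)%E.
Proof.
move=> dh0; pose a := `|M| + 1.
have Ma : M <= a by rewrite /a (le_trans (ler_norm _))// lerDl.
have a0 : 0 < a by rewrite /a ltr_wpDl.
have -> : (\int[mu]_x (dh x)%:E = \int[mu]_(x in `[(- a)%R, a]) (dh x)%:E)%E.
  rewrite [RHS]integral_mkcond; apply: eq_integral => x _; rewrite patchE.
  case: ifPn => //; rewrite mem_setE in_itv/= -ler_norml -ltNge => /ltW ax.
  by rewrite dh0// (le_trans Ma).
rewrite FTC ?gtrN// !h0 ?subee// ?normrN gtr0_norm//.
Qed.

Lemma le_integral_derive x : (`|h x|%:E <= \int[mu]_s `|dh s|%:E)%E.
Proof.
have [x0 M0] : 0 <= `|x| /\ 0 <= `|M| by split; exact: normr_ge0.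
have xN : - `|x| <= x by rewrite lerNl -normrN ler_norm.
pose a := - (`|x| + `|M| + 1).
have ax : a < x by rewrite /a; lra.
have Ma : M <= `|a|.
  by rewrite (le_trans (ler_norm M))// /a normrN [leRHS]ger0_norm; lra.
have := FTC ax; rewrite (h0 Ma) sube0 -abse_EFin => <-.
have mdh : measurable_fun setT dh by exact: continuous_measurable_fun.
apply: le_trans (le_abse_integral _ _ _) _ => //.
  by apply/measurable_EFinP; exact: measurable_funTS.
apply: ge0_subset_integral => //.
by apply/measurable_EFinP; exact: measurableT_comp.
Qed.

End real_line.

(** * Fubini for bounded functions supported in a cube *)

Section boxed.
Variables (R : realType).

(** Bounded with support in a cube. This passes to slices without any topological argument and, for
    measurable functions, already gives integrability. *)
Definition boxed n (g : 'rV[R]_n -> R) :=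
  exists K L, forall x, `|g x| <= K /\ (g x != 0 -> forall i, `|x ord0 i| <= L).

Definition box n (L : R) := [set x : 'rV[R]_n | forall i, x ord0 i \in `[- L, L]].

Lemma measurable_box n (L : R) : measurable (@box n L).
Proof.
rewrite (_ : @box n L = \bigcap_(i in [set: 'I_n])
    ((fun x : 'rV[R]_n => x ord0 i) @^-1` `[- L, L])).
  apply: fin_bigcap_measurable => // i _; rewrite -[X in measurable X]setTI.
  exact: measurable_coord.
by apply/seteqP; split=> x /= xB i; [move=> _; exact: xB|exact: xB].
Qed.

Lemma leb_box_lty n (L : R) : (leb R n (@box n L) < +oo)%E.
Proof.
have -> : leb R n (@box n L) = (\prod_(i < n) lebesgue_measure (`[- L, L]%classic : set R)%R)%E.
  by rewrite -(@leb_box R n (fun=> `[- L, L]%classic)).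
rewrite -ge0_fin_numE; last exact: prode_ge0.
by apply: prode_fin_num => i _; rewrite /= lebesgue_measure_itv/=; case: ifPn.
Qed.

Lemma integrable_boxed n (g : 'rV[R]_n -> R) : measurable_fun setT g -> boxed g ->
  (leb R n).-integrable setT (EFin \o g).
Proof.
move=> mg [K [L gb]].
have -> : EFin \o g = (EFin \o g) \_ (@box n L).
  apply/funext => x; rewrite patchE; case: ifPn => // /negP xL.
  apply/eqP/negPn/negP => gx; apply: xL; rewrite inE => i.
  rewrite in_itv/= -ler_norml; apply: (gb x).2.
  by apply: contraNneq gx => /= ->.
apply/(integrable_mkcond _ (measurable_box L)).
apply: measurable_bounded_integrable.
- exact: measurable_box.
- exact: leb_box_lty.
- exact: measurable_funTS.
- exists K; split; first exact: num_real.
  by move=> y Ky x _ /=; apply: le_trans (gb x).1 (ltW Ky).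
Qed.

(** Fubini is used in the order suited to i: if i is the first coordinate, the line integral is
    taken innermost; otherwise the first coordinate is frozen and the induction hypothesis applies
    to the slice. [boxed] provides the integrability that a signed integrand requires. *)
Lemma integral_lines_eq0 n (i : 'I_n) (g : 'rV[R]_n -> R) :
  measurable_fun setT g -> boxed g ->
  (forall x, \int[lebesgue_measure]_s (g (setcoord x i s))%:E = 0)%E ->
  (\int[leb R n]_x (g x)%:E = 0)%E.
Proof.
elim: n i g => [[]//|n IHn] i g mg bg g0.
have /integrableP[mEg ig] := integrable_boxed mg bg.
have mgc : measurable_fun setT (fun z : measurableTypeR R * 'rV[R]_n => (g (rV_cons z))%:E).
  by apply/measurable_EFinP; exact: measurableT_comp mg (@measurable_rV_cons R n).
have igc : (lebesgue_measure \x leb R n)%E.-integrable setT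
    (fun z : measurableTypeR R * 'rV[R]_n => (g (rV_cons z))%:E).
  apply/integrableP; split => //; apply: le_lt_trans ig.
  rewrite [leRHS](@ge0_integral_pushforward _ _ (measurableTypeR R * 'rV[R]_n)%type _ _ _ (@measurable_rV_cons R n)
  (lebesgue_measure \x leb R n)%E)//.
  exact: measurableT_comp.
rewrite [LHS](@integral_pushforward _ _ (measurableTypeR R * 'rV[R]_n)%type _ _ _ (@measurable_rV_cons R n)
  (lebesgue_measure \x leb R n)%E)//.
rewrite preimage_setT /=.
case: (unliftP ord0 i) g0 => [j|] -> g0.
  rewrite -integral12_prod_meas1//; apply: integral0_eq => t _.
  apply: IHn (j) _ _ _ _.
  - exact: measurable_slice mg.
  - have [K [L gb]] := bg; exists K, L => x; split; first exact: (gb _).1.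
    move=> gx k; have := (gb _).2 gx (lift ord0 k).
    by rewrite mxE liftK.
  - by move=> y; rewrite -(g0 (rV_cons (t, y))); apply: eq_integral => s _; rewrite setcoord_consS.
rewrite -integral21_prod_meas1//; apply: integral0_eq => y _.
by rewrite -(g0 (rV_cons (0, y))); apply: eq_integral => s _; rewrite setcoord_cons0.
Qed.

End boxed.

Lemma continuous_compose (T U V : topologicalType) (f : T -> U) (g : U -> V) :
  continuous f -> continuous g -> continuous (fun x => g (f x)).
Proof. by move=> cf cg x; apply: continuous_comp; [exact: cf|exact: cg]. Qed.

Lemma continuous_mul (R : realType) (T : topologicalType) (f g : T -> R) :
  continuous f -> continuous g -> continuous (fun x => f x * g x).
Proof. by move=> cf cg x; exact: (continuousM (cf x) (cg x)). Qed.

Lemma continuous_add (R : realType) (T : topologicalType) (f g : T -> R) :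
  continuous f -> continuous g -> continuous (fun x => f x + g x).
Proof. by move=> cf cg x; exact: (continuousD (cf x) (cg x)). Qed.

Lemma continuous_bigsum (R : realType) (T : topologicalType) (I : Type) (r : seq I)
    (F : I -> T -> R) :
  (forall i, continuous (F i)) -> continuous (fun x => \sum_(i <- r) F i x).
Proof.
move=> cF; elim: r => [|i r IH].
  by under eq_fun do rewrite big_nil; exact: cst_continuous.
by under eq_fun do rewrite big_cons; exact: continuous_add.
Qed.

(** * Integration by parts on R^N *)

Section calculus.
Variables (R : realType) (n : nat).
Implicit Types (f g : 'rV[R]_n -> R) (S : set 'rV[R]_n) (i j : 'I_n).

Definition C1 f := [/\ continuous f,
  forall i x, derivable f x (delta_mx ord0 i) & forall i, continuous (partial i f)].

Lemma continuous_measurable_rV f : continuous f -> measurable_fun setT f.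
Proof.
move=> /continuousP cf; apply: (measurability _ (RGenOpens.measurableE R)).
move=> _ [_ [a [b ->] <-]]; rewrite setTI; apply: open_measurable_rV.
by apply: cf; exact: interval_open.
Qed.

Lemma setcoordD (x : 'rV[R]_n) i (h s : R) :
  setcoord x i (h + s) = h *: delta_mx ord0 i + setcoord x i s.
Proof.
apply/rowP => j; rewrite !mxE eqxx /=; case: (j == i); first by rewrite mulr1.
by rewrite mulr0 add0r.
Qed.

Lemma setcoord_id (x : 'rV[R]_n) i : setcoord x i (x ord0 i) = x.
Proof. by apply/rowP => j; rewrite mxE; case: eqP => // ->. Qed.

Lemma continuous_setcoord (x : 'rV[R]_n) i : continuous (fun s : R => setcoord x i s).
Proof.
rewrite (_ : (fun s => _) = (fun s => s *: delta_mx ord0 i + setcoord x i 0)); last first.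
  by apply/funext => s; rewrite -setcoordD addr0.
by move=> s; apply: cvgD; [apply: cvgZl; exact: cvg_id|exact: cvg_cst].
Qed.

Lemma is_derive_line f (x : 'rV[R]_n) i (s : R) :
  derivable f (setcoord x i s) (delta_mx ord0 i) ->
  is_derive s 1 (fun s => f (setcoord x i s)) (partial i f (setcoord x i s)).
Proof.
move=> df.
have E : (fun h : R => h^-1 *: (f (h *: delta_mx ord0 i + setcoord x i s) - f (setcoord x i s))) =
  (fun h : R => h^-1 *: ((fun s => f (setcoord x i s)) (h *: 1 + s) -
     (fun s => f (setcoord x i s)) s)).
  by apply/funext => h; rewrite /= -setcoordD /GRing.scale/= mulr1.
apply: DeriveDef.
  by rewrite /derivable /= -E; exact: df.
by rewrite /partial /derive /= -E.
Qed.

Lemma partial_off S f i x : closed S -> (forall x, ~ S x -> f x = 0) ->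
  ~ S x -> partial i f x = 0.
Proof.
move=> cS f0 Sx; rewrite /partial (@near_eq_derive _ _ _ f (cst 0)) ?derive_cst//.
have : nbhs x (~` S) by apply: open_nbhs_nbhs; split => //; exact: closed_openC.
by apply: filterS => y Sy; exact: f0.
Qed.

Lemma coord_le_norm (x : 'rV[R]_n) i : `|x ord0 i| <= `|x|.
Proof.
rewrite [leRHS]mx_normrE.
exact: (le_bigmax _ (fun ij : 'I_1 * 'I_n => `|x ij.1 ij.2|) (ord0, i)).
Qed.

Lemma boxed_continuous S g : compact S -> (forall x, ~ S x -> g x = 0) ->
  continuous g -> boxed g.
Proof.
move=> cS g0 cg.
have [L [_ LS]] := compact_bounded cS.
have [K [_ KS]] : bounded_set (g @` S).
  by apply: compact_bounded; apply: continuous_compact => //; exact: continuous_subspaceT.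
exists (`|K| + 1), (`|L| + 1) => x.
have [Sx|/g0 ->] := pselect (S x); last first.
  by rewrite normr0 eqxx; split => //; rewrite addr_ge0.
split.
  by apply: KS; [rewrite (le_lt_trans (ler_norm _))// ltrDl|exists x].
move=> _ i; have : `|x| <= `|L| + 1.
  by apply: LS => //; rewrite (le_lt_trans (ler_norm _))// ltrDl.
by apply: le_trans; exact: coord_le_norm.
Qed.

Lemma integral_partial_eq0 S f i : compact S -> (forall x, ~ S x -> f x = 0) ->
  C1 f -> (\int[leb R n]_x (partial i f x)%:E = 0)%E.
Proof.
move=> cS f0 [cf df cdf].
have cS' : closed S by apply: compact_closed => //; exact: norm_hausdorff.
have df0 x : ~ S x -> partial i f x = 0 by exact: partial_off.
apply: (integral_lines_eq0 (i := i)).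
- exact: continuous_measurable_rV.
- exact: boxed_continuous cS _ _.
- move=> x; have [L [_ LS]] := compact_bounded cS.
  (* The i-th coordinate of [setcoord x i s] is s, so the line leaves the bounded set S once |s|
     exceeds |L| + 1. *)
  have LS' s : `|L| + 2 <= `|s| -> ~ S (setcoord x i s).
    move=> Ls Sx; have := LS (`|L| + 1) _ _ Sx.
    rewrite (le_lt_trans (ler_norm _)) ?ltrDl// => /(_ isT) /=.
    have := coord_le_norm (setcoord x i s) i; rewrite mxE eqxx.
    by lra.
  apply: (@integral_derive_eq0 _ (fun s => f (setcoord x i s)) (fun s => partial i f (setcoord x i s)) (`|L| + 2)).
  + by move=> s; exact: is_derive_line.
  + apply: continuous_compose => //; exact: continuous_setcoord.
  + by move=> s /LS' /f0.
  + by move=> s /LS' /df0.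
Qed.

Lemma partialM f g i x : derivable f x (delta_mx ord0 i) -> derivable g x (delta_mx ord0 i) ->
  partial i (fun x => f x * g x) x = f x * partial i g x + g x * partial i f x.
Proof. by move=> df dg; rewrite /partial [LHS]deriveM. Qed.

Lemma C1M f g : C1 f -> C1 g -> C1 (fun x => f x * g x).
Proof.
move=> [cf df cdf] [cg dg cdg]; split.
- exact: continuous_mul.
- by move=> i x; exact: derivableM.
- move=> i; rewrite (_ : partial i _ = fun x => f x * partial i g x + g x * partial i f x).
    by apply: continuous_add; exact: continuous_mul.
  by apply/funext => x; exact: partialM.
Qed.

Lemma integration_by_parts_leb S f g i : compact S -> (forall x, ~ S x -> f x = 0) ->
  C1 f -> C1 g ->
  \int[leb R n]_x (f x * partial i g x) = - \int[leb R n]_x (partial i f x * g x).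
Proof.
move=> cS f0 Cf Cg; have [[cf df cdf] [cg dg cdg]] := (Cf, Cg).
have cS' : closed S by apply: compact_closed => //; exact: norm_hausdorff.
have I h : continuous h -> (forall x, ~ S x -> h x = 0) -> (leb R n).-integrable setT (EFin \o h).
  move=> ch h0; apply: integrable_boxed; first exact: continuous_measurable_rV.
  exact: boxed_continuous cS _ _.
have := @integral_partial_eq0 S (fun x => f x * g x) i cS _ (C1M Cf Cg).
move=> /(_ _)/wrap[x Sx|]; first by rewrite f0// mul0r.
move=> /(congr1 fine) /= H; apply/eqP; rewrite -addr_eq0 -RintegralD//=.
- rewrite -[X in _ == X]H; apply/eqP; congr fine; apply: eq_integral => x _; congr EFin.
  by rewrite partialM//; congr (_ + _); rewrite mulrC.
- by apply: I => [|x Sx]; [exact: continuous_mul|rewrite f0// mul0r].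
- apply: I => [|x Sx]; first exact: continuous_mul.
  by rewrite (partial_off _ cS' f0 Sx) mul0r.
Qed.

End calculus.

(** * Even powers of the absolute value *)

Section sqr_power.
Variable R : realType.
Implicit Types (a b t : R).

Lemma is_derive_powR a t : 0 < t -> is_derive t 1 (fun x : R => x `^ a) (a * t `^ (a - 1)).
Proof.
move=> t0; have t0' : t \in `]0, +oo[ by rewrite in_itv/= t0.
apply: DeriveDef; first exact: derivable_powR.
by rewrite -derive1E powR_derive1.
Qed.

Lemma continuous_powR a t : 0 < t -> {for t, continuous (fun x : R => x `^ a)}.
Proof.
move=> t0; apply/differentiable_continuous/derivable1_diffP.
exact: (@ex_derive _ _ _ _ _ _ _ (is_derive_powR a t0)).
Qed.

Lemma continuous_sqr : continuous (fun t => t ^+ 2).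
Proof. by move=> t; exact: (@exprn_continuous R 2). Qed.

(** Writing |t|^(2b) as a power of the square keeps the absolute value out of differentiation. The
    point 0 is handled by hand because [continuous_powR] only covers positive arguments. *)
Lemma continuous_sqr_powR b : 0 < b -> continuous (fun t => (t ^+ 2) `^ b).
Proof.
move=> b0 t; have [->|t0] := eqVneq t 0; last first.
  apply: (@continuous_comp _ _ _ (fun t => t ^+ 2) (fun x : R => x `^ b)).
    exact: continuous_sqr.
  by apply: continuous_powR; rewrite exprn_even_gt0.
apply/cvgrPdist_lt => e e0.
rewrite expr0n/= powR0 ?gt_eqF//.
have e0' : 0 < e `^ b^-1 by exact: powR_gt0.
have /cvgrPdist_lt/(_ _ e0') := @continuous_sqr 0.
apply: filterS => s; rewrite expr0n/= !sub0r !normrN.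
rewrite !ger0_norm ?powR_ge0 ?sqr_ge0// => /(gt0_ltr_powR b0).
rewrite -powRrM mulVf ?gt_eqF// powRr1 ?ltW//; apply; rewrite nnegrE ?sqr_ge0//.
exact: powR_ge0.
Qed.

Lemma is_derive_sqr_powR a t : 1 < a ->
  is_derive t 1 (fun t => (t ^+ 2) `^ a) (2 * a * (t ^+ 2) `^ (a - 1) * t).
Proof.
move=> a1; have [->|t0] := eqVneq t 0; last first.
  have t2 : 0 < t ^+ 2 by rewrite exprn_even_gt0.
  have D2 : is_derive t 1 (fun t : R => t ^+ 2) (2 * t).
    apply: DeriveDef; first exact: exprn_derivable.
    by rewrite exp_derive /GRing.scale/= expr1 mulr1.
  have := @is_derive1_comp R (fun x : R => x `^ a) (fun t : R => t ^+ 2) t _ _ (is_derive_powR a t2) D2.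
  by move/is_derive_eq; apply; ring.
rewrite mulr0.
have H : h^-1 *: (((h *: 1 + 0) ^+ 2) `^ a - (0 ^+ 2) `^ a) @[h --> (0:R)^'] --> (0:R).
  apply/cvgrPdist_lt => e e0; near=> h.
  have h0 : h != 0 by near: h; exact: nbhs_dnbhs_neq.
  rewrite addr0 expr0n/= powR0 ?subr0; last by rewrite gt_eqF// (lt_trans ltr01).
  rewrite sub0r normrN /GRing.scale/= mulr1 normrM normfV.
  rewrite [X in _ * X]ger0_norm ?powR_ge0//.
  have -> : (h ^+ 2) `^ a = `|h| * `|h| * (h ^+ 2) `^ (a - 1).
    rewrite -normrM -expr2 ger0_norm ?sqr_ge0// mulr_powRB1 ?sqr_ge0//.
    exact: lt_trans a1.
  rewrite -mulrA mulKf ?normr_eq0//.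
  have h1 : `|h| < Num.min 1 e.
    near: h; apply: dnbhs0_lt; by rewrite lt_min ltr01.
  move: h1; rewrite lt_min => /andP[h1 he].
  apply: le_lt_trans he; rewrite ler_piMr//.
  apply: (@le_trans _ _ (1 `^ (a - 1))); last by rewrite powR1.
  apply: ge0_ler_powR; rewrite ?nnegrE ?sqr_ge0 ?subr_ge0 ?(ltW a1)//.
  by rewrite -(real_normK (num_real h)) expr_le1// ltW.
apply: DeriveDef.
  by apply/cvg_ex; exists 0.
exact/cvg_lim.
Unshelve. all: by end_near. Qed.

End sqr_power.

(** * The Sobolev inequality for C1 functions of compact support *)

Section sobolev.
Variable R : realType.

Lemma powR_half_sqr (x : R) : (x ^+ 2) `^ 2^-1 = `|x|.
Proof. by rewrite powR12_sqrt ?sqr_ge0// sqrtr_sqr. Qed.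

(** Raise to the power 1/b and divide by y; the case y = 0, where division is impossible, is
    trivial. That y is a real number, hence finite, is what allows the cancellation. *)
Lemma powR_absorb (y z c b : R) : 0 <= y -> 0 <= z -> 0 <= c -> 0 < b < 1 ->
  y <= (c * (y * z)) `^ b -> y `^ (b^-1 - 1) <= c * z.
Proof.
move=> + z0 c0 /andP[b0 b1]; rewrite le_eqVlt => /predU1P[<- _|y0 H].
  by rewrite powR0 ?mulr_ge0// subr_eq0 invr_eq1 lt_eqF.
have cyz : 0 <= c * (y * z) by rewrite !mulr_ge0// ltW.
have := ge0_ler_powR (r := b^-1) _ _ _ H.
rewrite invr_ge0 (ltW b0) !nnegrE powR_ge0 (ltW y0) => /(_ isT isT isT).
rewrite -powRrM divff ?gt_eqF// powRr1// -(@mulr_powRB1 _ y b^-1) ?(ltW y0) ?invr_gt0//.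
by rewrite mulrCA ler_pM2l.
Qed.

Lemma ge0_integral_boxed n (g : 'rV[R]_n -> R) : measurable_fun setT g -> boxed g ->
  (forall x, 0 <= g x) -> ((fine (\int[leb R n]_x (g x)%:E))%:E = \int[leb R n]_x (g x)%:E)%E.
Proof.
move=> mg bg g0; rewrite fineK//.
by apply: integrable_fin_num => //; exact: integrable_boxed.
Qed.

(** [gagliardo] is applied to |f|^(2a) with N = n+3 and a = (N-1)/(N-2). Its i-th derivative has
    size 2a |f|^k |d_i f| with k = N/(N-2), while the left-hand side produces |f|^(2k). After
    Cauchy-Schwarz the integral y of |f|^(2k) therefore occurs on both sides and is absorbed by
    [powR_absorb]. *)
Lemma sobolev_C1 n : exists2 S : R, 0 <= S & forall (K : set 'rV[R]_n.+3) f,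
  compact K -> (forall x, ~ K x -> f x = 0) -> C1 f ->
  ((\int[leb R n.+3]_x ((f x ^+ 2) `^ (n.+3%:R / n.+1%:R))%:E) `^ (n.+1%:R / n.+3%:R) <=
   S%:E * \int[leb R n.+3]_x (\sum_i partial i f x ^+ 2)%:E)%E.
Proof.
pose a : R := n.+2%:R / n.+1%:R; pose k : R := n.+3%:R / n.+1%:R.
have [n1 n3 n2] : [/\ (n.+1%:R : R) != 0, (n.+3%:R : R) != 0 & (n.+2%:R : R) != 0] by split; rewrite pnatr_eq0.
have E2 : (n.+2%:R : R) = n.+1%:R + 1 by rewrite natr1.
have E3 : (n.+3%:R : R) = n.+1%:R + 2 by rewrite -natrD addn2.
have n10 : 0 < (n.+1%:R : R) by rewrite ltr0n.
have a1 : 1 < a by rewrite ltr_pdivlMr// mul1r E2 ltrDl.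
have k0 : 0 < k by rewrite divr_gt0// ltr0n.
have ka : k / 2 = a - 1 + 2^-1 by rewrite /k /a E2 E3; field.
(* The factor 2a from the derivative times the number of directions, squared because Cauchy-Schwarz
   bounds the sum of the integrals by a square root. *)
pose c : R := (2 * a * n.+3%:R) ^+ 2.
have c0 : 0 <= c by exact: sqr_ge0.
exists c => // K f cK f0 Cf; have [cf df cdf] := Cf.
have cK' : closed K by apply: compact_closed => //; exact: norm_hausdorff.
have df0 i x : ~ K x -> partial i f x = 0 by exact: partial_off.
pose Y x := (f x ^+ 2) `^ k.
have cY : continuous Y.
  exact: continuous_compose cf (continuous_sqr_powR k0).
have Y0 x : 0 <= Y x by exact: powR_ge0.
have mY : measurable_fun setT Y by exact: continuous_measurable_rV.
have bY : boxed Y.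
  apply: boxed_continuous cK _ cY => x Kx.
  by rewrite /Y f0// expr0n powR0// gt_eqF.
pose Z x := \sum_i partial i f x ^+ 2.
have csq i : continuous (fun x => partial i f x ^+ 2).
  exact: continuous_compose (cdf i) (@continuous_sqr R).
have cZ : continuous Z.
  exact: continuous_bigsum.
have Z0 x : 0 <= Z x by apply: sumr_ge0 => i _; exact: sqr_ge0.
have mZ : measurable_fun setT Z by exact: continuous_measurable_rV.
have bZ : boxed Z.
  by apply: boxed_continuous cK _ cZ => x Kx; rewrite /Z big1// => i _; rewrite df0// expr0n.
have := ge0_integral_boxed mY bY Y0; set y := fine _ => yE.
have := ge0_integral_boxed mZ bZ Z0; set z := fine _ => zE.
have y0 : 0 <= y by rewrite -lee_fin yE; apply: integral_ge0 => x _; rewrite lee_fin.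
have z0 : 0 <= z by rewrite -lee_fin zE; apply: integral_ge0 => x _; rewrite lee_fin.
pose G i x := `|2 * a * (f x ^+ 2) `^ (a - 1) * f x * partial i f x|.
have cdP : continuous (fun x => 2 * a * (f x ^+ 2) `^ (a - 1) * f x).
  apply: continuous_mul => //; apply: continuous_mul; first exact: cst_continuous.
  by apply: continuous_compose cf (continuous_sqr_powR _); rewrite subr_gt0.
have mG i : measurable_fun setT (G i).
  apply: measurableT_comp => //; apply: continuous_measurable_rV.
  exact: continuous_mul.
pose h x := (f x ^+ 2) `^ a.
have mh : measurable_fun setT h.
  apply: continuous_measurable_rV.
  by apply: continuous_compose cf (continuous_sqr_powR _); rewrite (lt_trans ltr01).
have hG i x : ((h x)%:E <= \int[lebesgue_measure]_s (G i (setcoord x i s))%:E)%E.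
  have [L [_ LK]] := compact_bounded cK.
  have := @le_integral_derive R (fun s => h (setcoord x i s))
    (fun s => 2 * a * (f (setcoord x i s) ^+ 2) `^ (a - 1) * f (setcoord x i s) *
       partial i f (setcoord x i s)) (`|L| + 2) _ _ _ (x ord0 i).
  rewrite setcoord_id [`|h x|]ger0_norm ?powR_ge0//; apply.
  - move=> s; exact: (@is_derive1_comp R (fun t : R => (t ^+ 2) `^ a) (fun s => f (setcoord x i s)) s _ _
      (is_derive_sqr_powR _ a1) (is_derive_line (df i _))).
  - apply: (@continuous_compose _ _ _ (fun s => setcoord x i s)
      (fun x => 2 * a * (f x ^+ 2) `^ (a - 1) * f x * partial i f x)).
      exact: continuous_setcoord.
    exact: continuous_mul.
  - move=> s Ls; rewrite /h f0 ?expr0n ?powR0 ?gt_eqF// ?(lt_trans ltr01)//.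
    move=> Sx; have := LK (`|L| + 1) _ _ Sx.
    rewrite (le_lt_trans (ler_norm _)) ?ltrDl// => /(_ isT) /=.
    by have := coord_le_norm (setcoord x i s) i; rewrite mxE eqxx; lra.
have := gagliardo mh mG _ _ hG => /(_ _ _)/wrap[||H].
- by move=> x; exact: powR_ge0.
- by move=> i x; exact: normr_ge0.
have Gi i : (\int[leb R n.+3]_x (G i x)%:E <= (2 * a * (y * z) `^ 2^-1)%:E)%E.
  have E x : (G i x)%:E = ((2 * a)%:E * (Y x `^ 2^-1 * (partial i f x ^+ 2) `^ (1 - 2^-1))%:E)%E.
    have a0 : 0 <= 2 * a by rewrite mulr_ge0// (ltW (lt_trans ltr01 a1)).
    rewrite -EFinM; congr EFin; rewrite /G /Y 3!normrM [`|2 * a|]ger0_norm//.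
    rewrite -2![in LHS]mulrA; congr (_ * _); rewrite mulrA.
    have -> : 1 - 2^-1 = 2^-1 :> R by field.
    rewrite powR_half_sqr -powRrM ka (@powRD _ _ (a - 1)); last by rewrite gt_eqF// addr_gt0 ?subr_gt0 ?invr_gt0.
    by rewrite powR_half_sqr ger0_norm ?powR_ge0.
  have mp : measurable_fun setT (fun x => partial i f x ^+ 2) by exact: continuous_measurable_rV.
  under eq_integral do rewrite E.
  rewrite ge0_integralZl//; last 3 first.
  - apply/measurable_EFinP; apply: measurable_funM.
      exact: measurableT_comp (measurable_powR _) _.
    exact: measurableT_comp (measurable_powR _) _.
  - by move=> x _; rewrite lee_fin mulr_ge0// powR_ge0.
  - by rewrite lee_fin mulr_ge0// ltW// (lt_trans ltr01).
  rewrite [leRHS]EFinM; apply: lee_wpmul2l.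
    by rewrite lee_fin mulr_ge0// ltW// (lt_trans ltr01).
  apply: le_trans (hoelder_interpolation _ measurableT mY mp _ _ _) _ => //.
  - by move=> x _; exact: sqr_ge0.
  - by apply/andP; split; lra.
  have -> : 1 - 2^-1 = 2^-1 :> R by field.
  rewrite -yE powRM// [leRHS]EFinM; apply: lee_wpmul2l; first by rewrite poweR_ge0.
  rewrite -poweR_EFin; apply: gt0_ler_poweR => //.
  - by rewrite in_itv/= leey andbT; apply: integral_ge0 => x _; rewrite lee_fin sqr_ge0.
  - by rewrite in_itv/= leey lee_fin z0.
  rewrite zE; apply: ge0_le_integral => //.
  - by move=> x _; rewrite lee_fin sqr_ge0.
  - exact/measurable_EFinP.
  - exact/measurable_EFinP.
  - by move=> x _; rewrite lee_fin /Z (bigD1 i)//= lerDl sumr_ge0// => j _; exact: sqr_ge0.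
have {Gi}GS : (\sum_i \int[leb R n.+3]_x (G i x)%:E <= ((c * (y * z)) `^ 2^-1)%:E)%E.
  apply: le_trans (lee_sum _ (fun i _ => Gi i)) _.
  rewrite sumEFin lee_fin sumr_const card_ord /c powRM ?mulr_ge0 ?sqr_ge0// powR_half_sqr.
  have a0 : 0 <= a by exact: ltW (lt_trans ltr01 a1).
  by rewrite -[leLHS]mulr_natr [`|2 * a * _|]ger0_norm ?mulr_ge0// mulrAC.
(* Half of N/(N-1). It is below 1 exactly because N > 2, and 1/b - 1 = (N-2)/N is the power in the
   claim. *)
pose b : R := n.+3%:R / n.+2%:R / 2.
have hY : (\int[leb R n.+3]_x (h x `^ (n.+3%:R / n.+2%:R))%:E = y%:E)%E.
  rewrite yE; apply: eq_integral => x _; rewrite /h -powRrM; congr ((_ `^ _)%:E).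
  by rewrite /a /k [LHS]mulrC mulrA mulfVK.
have := gt0_ler_poweR (r := n.+3%:R / n.+2%:R) _ _ _ GS => /(_ _ _ _)/wrap[].
- by rewrite divr_ge0.
- by rewrite in_itv/= leey andbT sume_ge0// => i _; apply: integral_ge0 => x _; rewrite lee_fin normr_ge0.
- by rewrite in_itv/= leey lee_fin powR_ge0.
move/(le_trans H); rewrite hY poweR_EFin -powRrM lee_fin.
have -> : 2^-1 * (n.+3%:R / n.+2%:R) = b by rewrite /b mulrC.
move/powR_absorb => /(_ y0 z0 c0) => /(_ _)/wrap[|HH].
  rewrite /b E2 E3; move: n10; move: (n.+1%:R) => x x0.
  apply/andP; split; first by rewrite !divr_gt0//; lra.
  by rewrite ltr_pdivrMr// ltr_pdivrMr; lra.
rewrite -yE -zE poweR_EFin -EFinM lee_fin; congr (_ <= _): HH.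
congr (_ `^ _); rewrite /b E2 E3; move: n10; move: (n.+1%:R) => x x0.
by field; apply/andP; split; lra.
Qed.

End sobolev.

(** * Mean square convergence *)

Lemma cvgn_cst (R : realType) (a : R) : (fun=> a) n @[n --> \oo] --> a.
Proof. exact: cvg_cst. Qed.

Lemma cvgn_mul (R : realType) (a b : R) (u v : nat -> R) :
  u n @[n --> \oo] --> a -> v n @[n --> \oo] --> b -> u n * v n @[n --> \oo] --> a * b.
Proof. by move=> ua vb; exact: (cvgM ua vb). Qed.

Lemma cvgn_sub (R : realType) (a b : R) (u v : nat -> R) :
  u n @[n --> \oo] --> a -> v n @[n --> \oo] --> b -> u n - v n @[n --> \oo] --> a - b.
Proof. by move=> ua vb; exact: (cvgB ua vb). Qed.

Lemma cvgn_mull (R : realType) (k l : R) (u : nat -> R) :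
  u n @[n --> \oo] --> l -> k * u n @[n --> \oo] --> k * l.
Proof. by move=> ul; exact: (cvgM (cvg_cst _) ul). Qed.

Section L2.
Context d (T : measurableType d) (R : realType) (m : {measure set T -> \bar R}).
Context (D : set T) (mD : measurable D).
Implicit Types (f g h : T -> R).

Definition L2 f := measurable_fun D f /\ m.-integrable D (fun x => (f x ^+ 2)%:E).

Definition nrm2 f := \int[m]_(x in D) (f x ^+ 2).

Definition cvg2 (f_ : nat -> T -> R) f :=
  nrm2 (fun x => f_ n x - f x) @[n --> \oo] --> 0.

Lemma L2_le f g : measurable_fun D f -> (forall x, D x -> f x ^+ 2 <= g x ^+ 2) ->
  L2 g -> L2 f.
Proof.
move=> mf fg [mg ig]; split => //; apply: le_integrable ig => //.
  by apply/measurable_EFinP; exact: measurable_funX.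
by move=> x Dx; rewrite !abse_EFin lee_fin !ger0_norm ?sqr_ge0// fg.
Qed.

Lemma L2M f g : L2 f -> L2 g -> m.-integrable D (fun x => (f x * g x)%:E).
Proof.
move=> [mf If] [mg ig]; apply: le_integrable (integrableD mD If ig) => //.
  by apply/measurable_EFinP; exact: measurable_funM.
move=> x Dx; rewrite /= lee_fin normrM -(real_normK (num_real (f x))) -(real_normK (num_real (g x))).
rewrite [leRHS]ger0_norm ?addr_ge0 ?sqr_ge0//.
have := sqr_ge0 (`|f x| - `|g x|); have := mulr_ge0 (normr_ge0 (f x)) (normr_ge0 (g x)).
by nra.
Qed.

Lemma L2Z k f : L2 f -> L2 (fun x => k * f x).
Proof.
move=> [mf If]; split; first exact: measurable_funM.
have := integrableZl mD (k ^+ 2) If; apply: eq_integrable => // x _.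
by rewrite -EFinM exprMn.
Qed.

Lemma L2N f : L2 f -> L2 (fun x => - f x).
Proof. by move=> /(L2Z (-1)); under eq_fun do rewrite mulN1r. Qed.

Lemma L2D f g : L2 f -> L2 g -> L2 (fun x => f x + g x).
Proof.
move=> Lf Lg; have [[mf If] [mg ig]] := (Lf, Lg); split; first exact: measurable_funD.
have := integrableD mD (integrableD mD If ig) (integrableZl mD 2 (L2M Lf Lg)).
apply: eq_integrable => // x _; rewrite /= -EFinM -!EFinD; congr EFin; ring.
Qed.

Lemma L2B f g : L2 f -> L2 g -> L2 (fun x => f x - g x).
Proof. by move=> Lf Lg; apply: L2D => //; exact: L2N. Qed.

Lemma L2_0 : L2 (fun=> 0).
Proof.
split; first exact: measurable_cst.
by under eq_fun do rewrite expr0n; exact: integrable0.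
Qed.

Lemma L2_sum (I : Type) (r : seq I) (F : I -> T -> R) :
  (forall i, L2 (F i)) -> L2 (fun x => \sum_(i <- r) F i x).
Proof.
move=> LF; elim: r => [|i r IH].
  by under eq_fun do rewrite big_nil; exact: L2_0.
by under eq_fun do rewrite big_cons; exact: L2D.
Qed.

Lemma L2_bounded_mul (K : R) (c f : T -> R) : measurable_fun D c -> (forall x, D x -> `|c x| <= K) ->
  L2 f -> L2 (fun x => c x * f x).
Proof.
move=> mc cK Lf; apply: L2_le (L2Z K Lf).
  by apply: measurable_funM => //; exact: Lf.1.
move=> x Dx; rewrite !exprMn ler_wpM2r ?sqr_ge0//.
by rewrite -(real_normK (num_real (c x))) lerXn2r ?nnegrE ?cK// (le_trans (normr_ge0 (c x)))// cK.
Qed.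

Lemma nrm2_ge0 f : 0 <= nrm2 f.
Proof. by apply: Rintegral_ge0 => x _; exact: sqr_ge0. Qed.

Lemma nrm2E f : L2 f -> (nrm2 f)%:E = (\int[m]_(x in D) (f x ^+ 2)%:E)%E.
Proof. by move=> [_ If]; rewrite fineK//; exact: integrable_fin_num. Qed.

Lemma nrm2D f g : L2 f -> L2 g -> nrm2 (fun x => f x + g x) <= 2 * nrm2 f + 2 * nrm2 g.
Proof.
move=> Lf Lg; rewrite /nrm2 -!RintegralZl//; try by case: Lf; case: Lg.
rewrite -RintegralD//; last 2 first.
- by have := integrableZl mD 2 Lf.2; apply: eq_integrable.
- by have := integrableZl mD 2 Lg.2; apply: eq_integrable.
apply: le_Rintegral => //; first exact: (L2D Lf Lg).2.
  have := integrableD mD (integrableZl mD 2 Lf.2) (integrableZl mD 2 Lg.2).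
  by apply: eq_integrable.
by move=> x _; have := sqr_ge0 (f x - g x); nra.
Qed.

Lemma cauchy_schwarz f g : L2 f -> L2 g ->
  `|\int[m]_(x in D) (f x * g x)| <= Num.sqrt (nrm2 f) * Num.sqrt (nrm2 g).
Proof.
move=> Lf Lg; apply: le_trans (le_normr_Rintegral _ _) _ => //; first exact: L2M.
have ifg : m.-integrable D (fun x => (`|f x * g x|)%:E).
  by have := integrable_abse (L2M Lf Lg); apply: eq_integrable.
rewrite -lee_fin fineK; last exact: integrable_fin_num.
have half : 1 - 2^-1 = 2^-1 :> R by field.
have := @hoelder_interpolation _ T R m D (fun x => f x ^+ 2) (fun x => g x ^+ 2) 2^-1 mD
  (measurable_funX 2 Lf.1) (measurable_funX 2 Lg.1).
rewrite half -!nrm2E// !poweR_EFin !powR12_sqrt ?nrm2_ge0// => /(_ _ _ _)/wrap[].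
- by move=> x _; exact: sqr_ge0.
- by move=> x _; exact: sqr_ge0.
- by apply/andP; split; lra.
apply: le_trans; rewrite le_eqVlt; apply/orP; left; apply/eqP.
by apply: eq_integral => x _; rewrite !powR_half_sqr normrM.
Qed.

Lemma cvg2_mulr (f_ : nat -> T -> R) f g : (forall n, L2 (f_ n)) -> L2 f -> L2 g -> cvg2 f_ f ->
  \int[m]_(x in D) (f_ n x * g x) @[n --> \oo] --> \int[m]_(x in D) (f x * g x).
Proof.
move=> Lf_ Lf Lg ff; apply/cvgrPdist_le => e e0.
have e1 : 0 < e / (Num.sqrt (nrm2 g) + 1) by rewrite divr_gt0// ltr_wpDl.
have e2 : 0 < (e / (Num.sqrt (nrm2 g) + 1)) ^+ 2 by rewrite exprn_gt0.
have /cvgrPdist_le/(_ _ e2) := ff; apply: filterS => n.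
rewrite sub0r normrN ger0_norm ?nrm2_ge0// => H.
rewrite distrC -RintegralB//; try exact: L2M.
rewrite (_ : (fun x => _) = (fun x => (f_ n x - f x) * g x)); last by apply/funext => x; rewrite mulrBl.
apply: le_trans (cauchy_schwarz (L2B (Lf_ n) Lf) Lg) _.
have /ler_wsqrtr := H; rewrite sqrtr_sqr ger0_norm ?(ltW e1)// => H1.
apply: le_trans (ler_wpM2r (sqrtr_ge0 _) H1) _.
by rewrite mulrAC ler_pdivrMr ?ler_wpM2l ?(ltW e0)// ?lerDl// ltr_wpDl.
Qed.

(** Expanding the square of f_n - f leaves only a cross term, whose limit is given by
    [cvg2_mulr]. *)
Lemma cvg2_nrm2 (f_ : nat -> T -> R) f : (forall n, L2 (f_ n)) -> L2 f -> cvg2 f_ f ->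
  nrm2 (f_ n) @[n --> \oo] --> nrm2 f.
Proof.
move=> Lf_ Lf ff.
have E n : nrm2 (f_ n) = nrm2 (fun x => f_ n x - f x) + (2 * \int[m]_(x in D) (f_ n x * f x) - nrm2 f).
  rewrite /nrm2 -RintegralZl//; last exact: L2M.
  have I2 : m.-integrable D (fun x => (2 * (f_ n x * f x))%:E).
    by have := integrableZl mD 2 (L2M (Lf_ n) Lf); apply: eq_integrable.
  rewrite -RintegralB//; last by case: Lf.
  rewrite -RintegralD//; last 2 first.
  - exact: (L2B (Lf_ n) Lf).2.
  - by have := integrableB mD I2 Lf.2; apply: eq_integrable.
  by apply: eq_Rintegral => x _; ring.
under eq_fun do rewrite E.
have E0 : nrm2 f = 0 + (2 * \int[m]_(x in D) (f x * f x) - nrm2 f).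
  by rewrite (_ : \int[m]_(x in D) (f x * f x) = nrm2 f)//; ring.
have := cvgD ff (cvgB (cvgn_mull (k := 2) (cvg2_mulr Lf_ Lf Lf ff)) (cvg_cst (nrm2 f))).
by rewrite -E0; exact.
Qed.

Lemma cvg2D (f_ : nat -> T -> R) f (g_ : nat -> T -> R) g : (forall n, L2 (f_ n)) -> L2 f -> (forall n, L2 (g_ n)) -> L2 g ->
  cvg2 f_ f -> cvg2 g_ g -> cvg2 (fun n x => f_ n x + g_ n x) (fun x => f x + g x).
Proof.
move=> Lf_ Lf Lg_ Lg ff gg.
apply: (@squeeze_cvgr _ _ _ _ (fun=> 0) (fun n =>
  2 * nrm2 (fun x => f_ n x - f x) + 2 * nrm2 (fun x => g_ n x - g x))).
- near=> n; rewrite nrm2_ge0/=.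
  apply: le_trans (nrm2D (L2B (Lf_ n) Lf) (L2B (Lg_ n) Lg)).
  by rewrite le_eqVlt; apply/orP; left; apply/eqP; apply: eq_Rintegral => x _; ring.
- exact: cvg_cst.
- rewrite (_ : 0 = 2 * 0 + 2 * 0); last by ring.
  exact: (cvgD (cvgn_mull ff) (cvgn_mull gg)).
Unshelve. all: by end_near. Qed.

Lemma cvg2_sum (I : Type) (r : seq I) (F_ : I -> nat -> T -> R) (F : I -> T -> R) :
  (forall i n, L2 (F_ i n)) -> (forall i, L2 (F i)) -> (forall i, cvg2 (F_ i) (F i)) ->
  cvg2 (fun n x => \sum_(i <- r) F_ i n x) (fun x => \sum_(i <- r) F i x).
Proof.
move=> LF_ LF FF; elim: r => [|i r IH].
  rewrite /cvg2 (_ : (fun n => _) = (fun=> 0)); first exact: cvg_cst.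
  apply/funext => n; rewrite /nrm2 /Rintegral integral0_eq// => x _.
  by rewrite !big_nil subrr expr0n.
rewrite /cvg2 (_ : (fun n => _) = (fun n => nrm2 (fun x => F_ i n x + \sum_(i <- r) F_ i n x
  - (F i x + \sum_(i <- r) F i x)))).
  by apply: cvg2D => //; [move=> n|]; exact: L2_sum.
by apply/funext => n; apply: eq_Rintegral => x _; rewrite !big_cons.
Qed.

(** Split c_n f_n - c f = c_n (f_n - f) + (c_n - c) f. The first part is bounded by K times a null
    sequence; the second tends to 0 by dominated convergence with majorant (2K)^2 f^2, so almost
    everywhere convergence of the coefficients suffices. *)
Lemma cvg2_bounded_mul (K : R) (c_ : nat -> T -> R) (c : T -> R) (f_ : nat -> T -> R) f : (forall n, measurable_fun D (c_ n)) -> measurable_fun D c ->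
  (forall n x, D x -> `|c_ n x| <= K) -> (forall x, D x -> `|c x| <= K) ->
  {ae m, forall x, D x -> c_ n x @[n --> \oo] --> c x} ->
  (forall n, L2 (f_ n)) -> L2 f -> cvg2 f_ f ->
  cvg2 (fun n x => c_ n x * f_ n x) (fun x => c x * f x).
Proof.
move=> mc_ mc c_K cK cc Lf_ Lf ff.
pose G n x := (c_ n x - c x) * f x.
have cK2 n x : D x -> `|c_ n x - c x| <= 2 * K.
  by move=> Dx; rewrite mulr_natl mulr2n (le_trans (ler_normB _ _))// lerD// ?c_K ?cK.
have LG n : L2 (G n).
  by apply: L2_bounded_mul (cK2 n) Lf; exact: measurable_funB.
have LH n : L2 (fun x => c_ n x * (f_ n x - f x)).
  by apply: L2_bounded_mul (c_K n) _ => //; exact: L2B.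
have G0 : nrm2 (G n) @[n --> \oo] --> 0.
  have [||||_ _] := @dominated_convergence _ _ _ m D mD (fun n x => (G n x ^+ 2)%:E) (cst 0%E)
      (fun x => ((2 * K) ^+ 2)%:E * (f x ^+ 2)%:E)%E _ _ _ (integrableZl mD ((2 * K) ^+ 2) Lf.2).
  - by move=> n; apply/measurable_EFinP/measurable_funX; exact: (LG n).1.
  - exact: measurable_cst.
  - apply: filterS cc => x cx Dx; apply: cvg_EFin; first exact: nearW.
    have H1 := cvgn_mul (cvgn_sub (cx Dx) (@cvgn_cst R (c x))) (@cvgn_cst R (f x)).
    have := cvgn_mul H1 H1; rewrite subrr !mul0r; apply: cvg_trans.
    by apply: near_eq_cvg; apply: nearW => n; rewrite /= /G expr2.
  - apply: nearW => x n Dx; rewrite abse_EFin -EFinM lee_fin ger0_norm ?sqr_ge0//.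
    rewrite /G exprMn ler_wpM2r ?sqr_ge0//.
    rewrite -(real_normK (num_real (c_ n x - c x))) lerXn2r ?nnegrE ?cK2//.
    by rewrite (le_trans (normr_ge0 (c_ n x - c x)))// cK2.
  by rewrite integral0; exact: (@fine_cvg R nat \oo _ _ 0).
apply: (@squeeze_cvgr _ _ _ _ (fun=> 0) (fun n =>
  2 * (K ^+ 2 * nrm2 (fun x => f_ n x - f x)) + 2 * nrm2 (G n))).
- near=> n; rewrite nrm2_ge0/=.
  apply: (@le_trans _ _ (2 * nrm2 (fun x => c_ n x * (f_ n x - f x)) + 2 * nrm2 (G n))).
    apply: le_trans (nrm2D (LH n) (LG n)).
    by rewrite le_eqVlt; apply/orP; left; apply/eqP; apply: eq_Rintegral => x _; rewrite /G; ring.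
  rewrite lerD2r ler_pM2l// /nrm2 -RintegralZl//; last exact: (L2B (Lf_ n) Lf).2.
  apply: le_Rintegral => //; first exact: (LH n).2.
    by have := integrableZl mD (K ^+ 2) (L2B (Lf_ n) Lf).2; apply: eq_integrable.
  move=> x Dx; rewrite exprMn ler_wpM2r ?sqr_ge0//.
  rewrite -(real_normK (num_real (c_ n x))) lerXn2r ?nnegrE ?c_K//.
  by rewrite (le_trans (normr_ge0 (c_ n x)))// c_K.
- exact: cvg_cst.
- rewrite (_ : 0 = 2 * (K ^+ 2 * 0) + 2 * 0); last by ring.
  exact: (cvgD (cvgn_mull (cvgn_mull ff)) (cvgn_mull G0)).
Unshelve. all: by end_near. Qed.

(** The squared differences have summable integrals, so their series is finite almost everywhere and
    its terms tend to 0. The explicit rate makes a subsequence unnecessary. *)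
Lemma cvg2_ae (f_ : nat -> T -> R) f : (forall n, L2 (fun x => f_ n x - f x)) ->
  (forall n, nrm2 (fun x => f_ n x - f x) <= 2^-1 ^+ n) ->
  {ae m, forall x, D x -> f_ n x @[n --> \oo] --> f x}.
Proof.
move=> LB H; pose u n x := ((f_ n x - f x) ^+ 2)%:E.
have mu n : measurable_fun D (u n) by apply/measurable_EFinP/measurable_funX; exact: (LB n).1.
have u0 n x : D x -> (0 <= u n x)%E by rewrite lee_fin sqr_ge0.
have I : m.-integrable D (fun x => \sum_(n <oo) u n x)%E.
  apply/integrableP; split.
    by apply: ge0_emeasurable_sum => // k x Dx _; exact: u0.
  rewrite (eq_integral (fun x => \sum_(n <oo) u n x)%E); last first.
    by move=> x /[!inE] Dx; rewrite gee0_abs// nneseries_ge0// => n _ _; exact: u0.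
  rewrite integral_nneseries//.
  apply: (@le_lt_trans _ _ (\sum_(n <oo) (geometric 1 2^-1 n)%:E)%E).
    apply: lee_nneseries => [n _ _|n _]; first by apply: integral_ge0 => x /u0.
    by rewrite -nrm2E// lee_fin /geometric/= mul1r.
  have h1 : `|2^-1 : R| < 1 by rewrite ger0_norm ?invf_lt1 ?ltr1n.
  have : (\sum_(0 <= k < n) (geometric 1 2^-1 k)%:E)%E @[n --> \oo] --> (1 / (1 - 2^-1) : R)%:E.
    rewrite (_ : (fun n => _) = EFin \o series (geometric 1 2^-1)); last first.
      by apply/funext => n; rewrite /= /series/= sumEFin.
    by apply: cvg_EFin; [exact: nearW|exact: cvg_geometric_series].
  by move=> /cvg_lim ->//; rewrite ltry.
apply: filterS (integrable_ae mD I) => x Hx Dx.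
have {}Hx := Hx Dx.
have sq : (f_ n x - f x) ^+ 2 @[n --> \oo] --> 0.
  apply: cvg_series_cvg_0; apply: nondecreasing_is_cvgn.
    by apply: nondecreasing_series => n _ _; exact: sqr_ge0.
  exists (fine (\sum_(n <oo) u n x)%E) => _ [n _ <-].
  rewrite -lee_fin fineK// /series/= -sumEFin.
  by apply: nneseries_lim_ge => k _ _; exact: u0.
apply/cvgrPdist_lt => e e0.
have e2 : 0 < e ^+ 2 by rewrite exprn_gt0.
have /cvgrPdist_lt/(_ _ e2) := sq; apply: filterS => n.
rewrite sub0r normrN ger0_norm ?sqr_ge0// -(real_normK (num_real (_ - _))) distrC.
by rewrite ltr_pXn2r// nnegrE (ltW e0).
Qed.

(** The bound is assumed only eventually, hence the shift by N. The lower limit agrees with f only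
    almost everywhere, so its measurability is proved separately in [mlim]. *)
Lemma fatou_le (f_ : nat -> T -> R) f (B : \bar R) :
  (forall n, measurable_fun D (f_ n)) -> measurable_fun D f ->
  (forall n x, D x -> 0 <= f_ n x) -> (forall x, D x -> 0 <= f x) ->
  {ae m, forall x, D x -> f_ n x @[n --> \oo] --> f x} ->
  (\forall n \near \oo, \int[m]_(x in D) (f_ n x)%:E <= B)%E ->
  (\int[m]_(x in D) (f x)%:E <= B)%E.
Proof.
move=> mf_ mf f_0 f0 ff [N _ HB].
have mef n : measurable_fun D (fun x => (f_ (n + N)%N x)%:E) by exact/measurable_EFinP.
have mlim : measurable_fun D (fun x => limn_einf (fun n => (f_ (n + N)%N x)%:E)).
  rewrite (_ : (fun x => _) = fun x => (- limn_esup (fun n => - (f_ (n + N)%N x)%:E))%E).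
    apply: measurableT_comp => //; apply: measurable_fun_limn_esup => n.
    exact: measurableT_comp.
  by apply/funext => x; rewrite -limn_einfN; congr limn_einf; apply/funext => n /=; rewrite opprK.
have ge0 : forall x, D x -> (0 <= limn_einf (fun n => (f_ (n + N)%N x)%:E))%E.
  move=> x Dx; rewrite limn_einf_lim; apply: lime_ge; first exact: is_cvg_einfs.
  apply: nearW => n; apply: le_ereal_inf_tmp => _ [k _ <-].
  by rewrite lee_fin f_0.
rewrite (ge0_ae_eq_integral mD _ mlim _ ge0); last first.
- apply: filterS ff => x fx Dx; have {}fx := fx Dx.
  have : (f_ (n + N)%N x)%:E @[n --> \oo] --> (f x)%:E.
    apply: cvg_EFin; first exact: nearW.
    by rewrite (_ : _ \o _ = fun n => f_ (n + N)%N x)// (cvg_shiftn N (fun n => f_ n x)).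
  by move=> /cvg_limn_einf_sup[->].
- by move=> x Dx; rewrite lee_fin f0.
- exact/measurable_EFinP.
apply: le_trans (fatou _ _ _ _) _ => //.
  by move=> n x Dx; rewrite lee_fin f_0.
rewrite limn_einf_lim; apply: lime_le; first exact: is_cvg_einfs.
apply: nearW => n; apply: le_trans (HB (n + N)%N (leq_addl _ _)).
by apply: ereal_inf_lbound; exists n => //=.
Qed.

End L2.

(** * Smooth functions and H10 *)

Section chain_rule.
Variables (R : realType) (n : nat).
Implicit Types (f : 'rV[R]_n -> R) (x v : 'rV[R]_n).

Lemma is_derive_ray f x v (t : R) : derivable f (t *: v + x) v ->
  is_derive t 1 (fun s => f (s *: v + x)) ('D_v f (t *: v + x)).
Proof.
move=> df.
have E : (fun h : R => h^-1 *: (f (h *: v + (t *: v + x)) - f (t *: v + x))) =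
  (fun h : R => h^-1 *: ((fun s => f (s *: v + x)) (h *: 1 + t) -
     (fun s => f (s *: v + x)) t)).
  by apply/funext => h /=; rewrite [h *: (1 : R)]mulr1 scalerDl addrA.
apply: DeriveDef.
  by rewrite /derivable /= -E; exact: df.
by rewrite /derive /= -E.
Qed.

(** Here f is only derivable along v, not differentiable, so the composition is restricted to the
    ray through x, where the one-variable chain rule applies. *)
Lemma is_derive_compose f (g : R -> R) x v (df dg : R) :
  is_derive (f x) 1 g dg -> is_derive x v f df ->
  is_derive x v (fun x => g (f x)) (dg * df).
Proof.
move=> Hg Hf; have fd : derivable f x v by exact: (@ex_derive _ _ _ _ _ _ _ Hf).
have fE : 'D_v f x = df by exact: (@derive_val _ _ _ _ _ _ _ Hf).
have x0 : 0 *: v + x = x by rewrite scale0r add0r.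
have := @is_derive_ray f x v 0; rewrite x0 => /(_ fd) Hr.
have Hg' : is_derive ((fun s : R => f (s *: v + x)) 0) 1 g dg by rewrite x0.
have H := is_derive1_comp Hg' Hr; rewrite fE in H.
have E : (fun h : R => h^-1 *: (g (f (h *: v + x)) - g (f x))) =
  (fun h : R => h^-1 *: ((g \o (fun s : R => f (s *: v + x))) (h *: 1 + 0) -
     (g \o (fun s : R => f (s *: v + x))) 0)).
  by apply/funext => h /=; rewrite x0 addr0 [h *: (1 : R)]mulr1.
apply: DeriveDef.
  by rewrite /derivable /= E; exact: (@ex_derive _ _ _ _ _ _ _ H).
by rewrite /derive /= E; exact: (@derive_val _ _ _ _ _ _ _ H).
Qed.

End chain_rule.

(** * Symmetry of second derivatives *)

Section schwarz.
Variables (R : realType) (n : nat).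
Implicit Types (f : 'rV[R]_n -> R) (x v : 'rV[R]_n) (i j : 'I_n).

(** The mean value theorem, once in direction i for the difference of f across the step in direction
    j, and once in direction j for its derivative. *)
Lemma second_difference f i j x (h : R) : 0 < h -> C1 f -> C1 (partial i f) ->
  exists s t, [/\ 0 <= s <= h, 0 <= t <= h &
   f (h *: delta_mx ord0 i + (h *: delta_mx ord0 j + x)) - f (h *: delta_mx ord0 i + x)
   - (f (h *: delta_mx ord0 j + x) - f x) =
   partial j (partial i f) (t *: delta_mx ord0 j + (s *: delta_mx ord0 i + x)) * h * h].
Proof.
move=> h0 [cf df cdf] [cdf' ddf cddf].
set ei := delta_mx ord0 i; set ej := delta_mx ord0 j.
pose g (s : R) := f (s *: ei + (h *: ej + x)) - f (s *: ei + x).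
pose dg (s : R) := partial i f (s *: ei + (h *: ej + x)) - partial i f (s *: ei + x).
have gd (s : R) : is_derive s 1 g (dg s).
  by apply: is_deriveB; apply: is_derive_ray; exact: df.
have cg : continuous g.
  by move=> s; apply/differentiable_continuous/derivable1_diffP; exact: (@ex_derive _ _ _ _ _ _ _ (gd s)).
have [|s] := @MVT_segment R g dg 0 h (ltW h0) (fun s _ => gd s).
  exact: continuous_subspaceT.
rewrite in_itv/= => s0; rewrite /g scale0r !add0r subr0 => H.
pose k (t : R) := partial i f (t *: ej + (s *: ei + x)).
pose dk (t : R) := partial j (partial i f) (t *: ej + (s *: ei + x)).
have kd (t : R) : is_derive t 1 k (dk t) by apply: is_derive_ray; exact: ddf.
have ck : continuous k.
  by move=> t; apply/differentiable_continuous/derivable1_diffP; exact: (@ex_derive _ _ _ _ _ _ _ (kd t)).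
have [|t] := @MVT_segment R k dk 0 h (ltW h0) (fun s _ => kd s).
  exact: continuous_subspaceT.
rewrite in_itv/= => t0; rewrite /k scale0r add0r subr0 => H'.
exists s, t; split => //; rewrite H; congr (_ * _).
by rewrite -H' /dg addrCA.
Qed.

Lemma near_small (P : 'rV[R]_n -> Prop) (x : 'rV[R]_n) : (\forall y \near x, P y) ->
  exists2 h : R, 0 < h & forall i j (s t : R), 0 <= s <= h -> 0 <= t <= h ->
    P (t *: delta_mx ord0 j + (s *: delta_mx ord0 i + x)).
Proof.
move=> /nbhs_ballP[e /= e0 eP]; exists (e / 4); first by rewrite divr_gt0.
move=> i j s t /andP[s0 sh] /andP[t0 th]; apply: eP.
have nd k : `|delta_mx ord0 k : 'rV[R]_n| <= 1.
  rewrite [leLHS]mx_normrE; apply: bigmax_le => // -[a b] _ /=; rewrite mxE.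
  by case: (_ && _); rewrite ?normr1 ?normr0.
have e4 : 0 < e / 4 by rewrite divr_gt0.
have sm k r : 0 <= r -> r <= e / 4 -> `|r *: (delta_mx ord0 k : 'rV[R]_n)| <= e / 4.
  by move=> r0 re; rewrite normrZ ger0_norm// (le_trans _ re)// ler_piMr.
rewrite -ball_normE /= distrC addrA addrK (le_lt_trans (ler_normD _ _))//.
by apply: (@le_lt_trans _ _ (e / 4 + e / 4)); [rewrite lerD ?sm|lra].
Qed.

Lemma smooth_C1 f : smooth f -> C1 f.
Proof.
move=> sf; split; [exact: (sf [::]).1|exact: (sf [::]).2|].
by move=> i; exact: (sf [:: i]).1.
Qed.

Lemma smooth_partial f i : smooth f -> smooth (partial i f).
Proof. by move=> sf s; have := sf (rcons s i); rewrite foldr_rcons. Qed.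

(** Schwarz's theorem: the same second difference over a small square is a value of either mixed
    derivative at a nearby point, and both are continuous. It is needed to exchange derivatives when
    the square of the divergence is integrated by parts. *)
Lemma partial_comm f i j x : smooth f ->
  partial i (partial j f) x = partial j (partial i f) x.
Proof.
move=> sf; have [C0 C1i C1j] := And3 (smooth_C1 sf) (smooth_C1 (smooth_partial i sf))
  (smooth_C1 (smooth_partial j sf)).
apply/eqP/negPn/negP => ne.
pose d := `|partial i (partial j f) x - partial j (partial i f) x|.
have d0 : 0 < d by rewrite normr_gt0 subr_eq0.
have d2 : 0 < d / 2 by rewrite divr_gt0.
have [_ _ /(_ i)/(_ x)/cvgrPdist_lt/(_ _ d2)/near_small[h1 h10 H1]] := C1j.
have [_ _ /(_ j)/(_ x)/cvgrPdist_lt/(_ _ d2)/near_small[h2 h20 H2]] := C1i.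
pose h := Num.min h1 h2.
have h0 : 0 < h by rewrite lt_min h10.
have [hh1 hh2] : h <= h1 /\ h <= h2 by rewrite !ge_min !lexx ?orbT.
have [s [t [/andP[s0 sh] /andP[t0 th] E1]]] := second_difference j x h0 C0 C1i.
have [s' [t' [/andP[s'0 s'h] /andP[t'0 t'h] E2]]] := second_difference i x h0 C0 C1j.
have := H2 i j s t; rewrite s0 t0 (le_trans sh)// (le_trans th)// => /(_ isT isT) K2.
have := H1 j i s' t'; rewrite s'0 t'0 (le_trans s'h)// (le_trans t'h)// => /(_ isT isT) K1.
(* The second difference is symmetric in i and j, so the two mixed derivatives share a value at
   points where each is within d/2 of its value at x. *)
have aux (a b c e A B : R) : a - b - (c - e) = A * h * h -> a - c - (b - e) = B * h * h -> A = B.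
  have hn : h != 0 by rewrite gt_eqF.
  by move=> EA EB; apply: (mulIf hn); apply: (mulIf hn); rewrite -EA -EB; ring.
rewrite [X in f X - _ - _ = _]addrCA in E2.
have E := aux _ _ _ _ _ _ E1 E2; rewrite E distrC in K2.
have := lt_le_trans (ltrD K1 K2) (lexx _); rewrite -splitr.
by apply/negP; rewrite -leNgt; exact: ler_distD.
Qed.

End schwarz.

Section smooth_algebra.
Variables (R : realType) (n : nat).
Implicit Types (f g w : 'rV[R]_n -> R).

(* A class of functions stable under partial derivatives whose members are
   continuous and partially derivable consists of smooth functions. *)
Inductive smooth_gen : ('rV[R]_n -> R) -> Prop :=
| smooth_gen_base f : smooth f -> smooth_gen f
| smooth_gen_cst c : smooth_gen (fun=> c)
| smooth_gen_add f g : smooth_gen f -> smooth_gen g -> smooth_gen (fun x => f x + g x)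
| smooth_gen_mul f g : smooth_gen f -> smooth_gen g -> smooth_gen (fun x => f x * g x)
| smooth_gen_powR w a : smooth_gen w -> (forall x, 0 < w x) ->
    smooth_gen (fun x => w x `^ a).

Lemma is_derive_partial f i x : derivable f x (delta_mx ord0 i) ->
  is_derive x (delta_mx ord0 i) f (partial i f x).
Proof. by move=> fd; exact: DeriveDef. Qed.

Lemma smooth_gen_partial f : smooth_gen f -> continuous f /\
  forall i, (forall x, derivable f x (delta_mx ord0 i)) /\ smooth_gen (partial i f).
Proof.
elim=> {f} [f sf|c|f g gf [cf IHf] gg [cg IHg]|f g gf [cf IHf] gg [cg IHg]|w a gw [cw IHw] w0].
- split; first exact: (sf [::]).1.
  move=> i; split; first exact: (sf [::]).2.
  exact/smooth_gen_base/smooth_partial.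
- split; first exact: cst_continuous.
  move=> i; split; first by move=> x; exact: derivable_cst.
  rewrite (_ : partial i _ = fun=> 0); first exact: smooth_gen_cst.
  by apply/funext => x; exact: derive_cst.
- split; first exact: continuous_add.
  move=> i; have [[df pf] [dg pg]] := (IHf i, IHg i); split.
    by move=> x; exact: derivableD.
  rewrite (_ : partial i _ = fun x => partial i f x + partial i g x); first exact: smooth_gen_add.
  by apply/funext => x; rewrite /partial [LHS]deriveD.
- split; first exact: continuous_mul.
  move=> i; have [[df pf] [dg pg]] := (IHf i, IHg i); split.
    by move=> x; exact: derivableM.
  rewrite (_ : partial i _ = fun x => f x * partial i g x + g x * partial i f x).
    by apply: smooth_gen_add; exact: smooth_gen_mul.
  by apply/funext => x; exact: partialM.
- have dP i x := is_derive_compose (is_derive_powR a (w0 x)) (is_derive_partial ((IHw i).1 x)).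
  split.
    move=> x; apply: (@continuous_comp _ _ _ w (fun t : R => t `^ a)); first exact: cw.
    exact: continuous_powR.
  move=> i; split; first by move=> x; exact: (@ex_derive _ _ _ _ _ _ _ (dP i x)).
  rewrite (_ : partial i _ = fun x => a * w x `^ (a - 1) * partial i w x).
    apply: smooth_gen_mul; last exact: (IHw i).2.
    by apply: smooth_gen_mul; [exact: smooth_gen_cst|exact: smooth_gen_powR].
  by apply/funext => x; exact: (@derive_val _ _ _ _ _ _ _ (dP i x)).
Qed.

Lemma smooth_gen_smooth f : smooth_gen f -> smooth f.
Proof.
move=> gf s.
have : smooth_gen (foldr (@partial R n) f s).
  by elim: s => //= i s /smooth_gen_partial[_ /(_ i)[]].
by move=> /smooth_gen_partial[? H]; split => // i x; exact: (H i).1.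
Qed.

Lemma smooth_cst (c : R) : smooth (fun _ : 'rV[R]_n => c).
Proof. exact/smooth_gen_smooth/smooth_gen_cst. Qed.

Lemma smooth_add f g : smooth f -> smooth g -> smooth (fun x => f x + g x).
Proof.
by move=> sf sg; apply/smooth_gen_smooth/smooth_gen_add; exact: smooth_gen_base.
Qed.

Lemma smooth_mul f g : smooth f -> smooth g -> smooth (fun x => f x * g x).
Proof.
by move=> sf sg; apply/smooth_gen_smooth/smooth_gen_mul; exact: smooth_gen_base.
Qed.

Lemma smooth_powR w a : smooth w -> (forall x, 0 < w x) -> smooth (fun x => w x `^ a).
Proof.
by move=> sw w0; apply/smooth_gen_smooth/smooth_gen_powR => //; exact: smooth_gen_base.
Qed.

Lemma smooth_sum (I : Type) (r : seq I) (F : I -> 'rV[R]_n -> R) :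
  (forall i, smooth (F i)) -> smooth (fun x => \sum_(i <- r) F i x).
Proof.
move=> sF; elim: r => [|i r IH].
  by under eq_fun do rewrite big_nil; exact: smooth_cst.
by under eq_fun do rewrite big_cons; exact: smooth_add.
Qed.

End smooth_algebra.

(** * Test functions and approximation in H10 *)

Section test_functions.
Variables (R : realType) (N : nat) (Omega : set 'rV[R]_N).
Hypothesis mO : measurable Omega.
Implicit Types (f g phi psi : 'rV[R]_N -> R) (i j : 'I_N).

Local Notation L2 := (L2 (leb R N) Omega).
Local Notation nrm2 := (nrm2 (leb R N) Omega).
Local Notation cvg2 := (cvg2 (leb R N) Omega).

Lemma test_function_support phi : test_function Omega phi ->
  exists K, [/\ compact K, K `<=` Omega & forall x, ~ K x -> phi x = 0].
Proof.
move=> [_ cK KO]; exists (closure [set x | phi x != 0]); split => // x Kx.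
by apply/eqP/negPn/negP => px; apply: Kx; apply: subset_closure.
Qed.

Lemma test_function_C1 phi : test_function Omega phi -> C1 phi.
Proof. by move=> [/smooth_C1]. Qed.

Lemma integral_support (K : set 'rV[R]_N) g : K `<=` Omega -> (forall x, ~ K x -> g x = 0) ->
  (\int[leb R N]_(x in Omega) (g x)%:E = \int[leb R N]_x (g x)%:E)%E.
Proof.
move=> KO g0; rewrite integral_mkcond; apply: eq_integral => x _; rewrite patchE.
by case: ifPn => //; rewrite notin_setE => Ox; rewrite g0// => /KO.
Qed.

Lemma L2_compact_support (K : set 'rV[R]_N) g : compact K -> (forall x, ~ K x -> g x = 0) ->
  continuous g -> L2 g.
Proof.
move=> cK g0 cg; split; first by apply: measurable_funTS; exact: continuous_measurable_rV.
have cg2 : continuous (fun x => g x ^+ 2) by exact: continuous_compose cg (@continuous_sqr R).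
apply: (@integrableS _ _ _ _ setT) => //.
apply: integrable_boxed; first exact: continuous_measurable_rV.
by apply: (boxed_continuous cK) => // x Kx; rewrite g0// expr0n.
Qed.

Lemma test_function_L2 phi : test_function Omega phi ->
  L2 phi /\ forall i, L2 (partial i phi).
Proof.
move=> tp; have [K [cK KO p0]] := test_function_support tp.
have [cp dp cdp] := test_function_C1 tp.
split; first exact: L2_compact_support cK _ _.
move=> i; apply: (L2_compact_support cK) => // x Kx; apply: partial_off Kx => //.
by apply: compact_closed => //; exact: norm_hausdorff.
Qed.

Lemma test_function_by_parts phi psi i : test_function Omega phi -> C1 psi ->
  \int[leb R N]_(x in Omega) (phi x * partial i psi x) =
  - \int[leb R N]_(x in Omega) (partial i phi x * psi x).
Proof.
move=> tp Cpsi; have [K [cK KO p0]] := test_function_support tp.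
rewrite /Rintegral !(@integral_support K)//.
- exact: integration_by_parts_leb cK _ (test_function_C1 tp) Cpsi.
- move=> x Kx; rewrite (@partial_off _ _ K) ?mul0r//.
  by apply: compact_closed => //; exact: norm_hausdorff.
- by move=> x Kx; rewrite p0// mul0r.
Qed.

(** Both sides are minus the integral of phi times a mixed second derivative of psi, and those
    derivatives commute. *)
Lemma test_function_partial_swap phi psi i j : test_function Omega phi -> test_function Omega psi ->
  \int[leb R N]_(x in Omega) (partial i phi x * partial j psi x) =
  \int[leb R N]_(x in Omega) (partial j phi x * partial i psi x).
Proof.
move=> tp tq; have [sq _ _] := tq.
have Cq k := smooth_C1 (smooth_partial k sq).
have A := test_function_by_parts i tp (Cq j).
have B := test_function_by_parts j tp (Cq i).
have E : \int[leb R N]_(x in Omega) (phi x * partial i (partial j psi) x) =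
         \int[leb R N]_(x in Omega) (phi x * partial j (partial i psi) x).
  by apply: eq_Rintegral => x _; rewrite (partial_comm i j x sq).
exact: oppr_inj (etrans (esym A) (etrans E B)).
Qed.

Lemma in_LpP q f : 0 < q -> in_Lp Omega q f <->
  measurable_fun Omega f /\ (\int[leb R N]_(x in Omega) (`|f x| `^ q)%:E < +oo)%E.
Proof.
move=> q0.
have E : (\int[leb R N]_x (`|(f \_ Omega) x| `^ q)%:E = \int[leb R N]_(x in Omega) (`|f x| `^ q)%:E)%E.
  rewrite [RHS]integral_mkcond; apply: eq_integral => x _; rewrite !patchE.
  by case: ifPn => _//; rewrite normr0 powR0// gt_eqF.
have mE : f \_ Omega \in @mfun _ _ 'rV[R]_N R <-> measurable_fun Omega f.
  rewrite inE /=; split; first by move=> mf; apply/(measurable_restrictT _ mO).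
  by move=> mf; apply/(measurable_restrictT _ mO).
rewrite /in_Lp; split.
  move=> /andP[/mE mf]; rewrite inE /= /finite_norm unlock /= E => fin.
  by split => //; apply: lty_poweRy fin; rewrite invr_neq0// gt_eqF.
move=> [/mE mf fin]; apply/andP; split => //.
by rewrite inE /= /finite_norm unlock /= E; exact: poweR_lty.
Qed.

Lemma in_L2P f : in_Lp Omega 2 f <-> L2 f.
Proof.
have E : (\int[leb R N]_(x in Omega) (`|f x| `^ 2)%:E =
    \int[leb R N]_(x in Omega) `|(f x ^+ 2)%:E|)%E.
  apply: eq_integral => x _.
  by rewrite abse_EFin ger0_norm ?sqr_ge0// powR_mulrn// real_normK// num_real.
rewrite in_LpP// E; split=> [[mf fin]|[mf /integrableP[_ fin]]//].
by split => //; apply/integrableP; split => //; exact/measurable_EFinP/measurable_funX.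
Qed.

(** The rate 2^-n is chosen for [cvg2_ae], which then gives almost everywhere convergence of the
    whole sequence. *)
Lemma in_H10_seq f (Df : 'I_N -> 'rV[R]_N -> R) : in_H10 Omega f Df ->
  [/\ L2 f, forall i, L2 (Df i) & exists phi : nat -> 'rV[R]_N -> R,
   [/\ forall n, test_function Omega (phi n),
    forall n, nrm2 (fun x => phi n x - f x) <= 2^-1 ^+ n &
    forall n i, nrm2 (fun x => partial i (phi n) x - Df i x) <= 2^-1 ^+ n]].
Proof.
move=> [[/in_L2P Lf LDf] H].
have LD i : L2 (Df i) by apply/in_L2P; exact: (LDf i).1.
split => //.
have /choice[phi Hphi] (n : nat) : exists phi, test_function Omega phi /\
   (H1_norm Omega (fun x => phi x - f x)%R
       (fun i x => partial i phi x - Df i x)%R < (2^-1 ^+ n)%:E)%E.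
  by have [|phi ? ?] := H (2^-1 ^+ n); [rewrite exprn_gt0|exists phi].
exists phi.
have Lp n := test_function_L2 (Hphi n).1.
have LB n : L2 (fun x => phi n x - f x) by apply: L2B => //; exact: (Lp n).1.
have LBD n i : L2 (fun x => partial i (phi n) x - Df i x).
  by apply: L2B => //; exact: (Lp n).2.
have bound n g : L2 g -> (forall x, g x ^+ 2 <= (phi n x - f x) ^+ 2 +
   \sum_(i < N) (partial i (phi n) x - Df i x) ^+ 2) -> nrm2 g <= 2^-1 ^+ n.
  move=> Lg gle; rewrite -lee_fin nrm2E//.
  have [_] := Hphi n; rewrite /H1_norm; set I := (\int[_]_(_ in _) _)%E => Hn.
  have I0 : (0 <= I)%E.
    by apply: integral_ge0 => x _; rewrite lee_fin addr_ge0 ?sqr_ge0// sumr_ge0// => k _; exact: sqr_ge0.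
  have le1 : (2^-1 : R) ^+ n <= 1 by rewrite exprn_ile1// invf_le1// ler1n.
  apply: (@le_trans _ _ I).
    apply: ge0_le_integral => //.
    - by move=> x _; rewrite lee_fin sqr_ge0.
    - by apply/measurable_EFinP/measurable_funX; exact: Lg.1.
    - apply/measurable_EFinP/measurable_funD.
        by apply: measurable_funX; exact: (LB n).1.
      by apply: measurable_sum => i; apply: measurable_funX; exact: (LBD n i).1.
    - by move=> x _; rewrite lee_fin.
  (* [H1_norm] is a square root, so the integral is at most 4^-n, which is then weakened to 2^-n. *)
  apply: (@le_trans _ _ (((2^-1 : R) ^+ n ^+ 2)%:E)); last first.
    by rewrite lee_fin expr2 ler_piMr// exprn_ge0.
  have := gt0_ler_poweR (r := 2) _ _ _ (ltW Hn) => /(_ _ _ _)/wrap[].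
  - by [].
  - by rewrite in_itv/= leey andbT poweR_ge0.
  - by rewrite in_itv/= leey lee_fin exprn_ge0.
  rewrite -poweRrM mulVf ?pnatr_eq0// poweRe1// => HI; apply: (le_trans HI).
  by rewrite poweR_EFin powR_mulrn ?exprn_ge0.
split; [by move=> n; exact: (Hphi n).1| |].
- move=> n; apply: bound => // x; rewrite lerDl sumr_ge0// => k _; exact: sqr_ge0.
- move=> n i; apply: bound => // x; rewrite (bigD1 i)//= addrCA lerDl addr_ge0 ?sqr_ge0//.
  by rewrite sumr_ge0// => k _; exact: sqr_ge0.
Qed.

Lemma cvg2_geometric (phi : nat -> 'rV[R]_N -> R) f :
  (forall n, nrm2 (fun x => phi n x - f x) <= 2^-1 ^+ n) -> cvg2 phi f.
Proof.
move=> H; apply: (@squeeze_cvgr _ _ _ _ (fun=> 0) (fun n => 2^-1 ^+ n)).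
- by near=> n; rewrite nrm2_ge0 H.
- exact: cvg_cst.
- by apply: cvg_expr; rewrite ger0_norm ?invf_lt1 ?ltr1n.
Unshelve. all: by end_near. Qed.

(** The weak derivative need not be checked beforehand: integration by parts holds for each test
    function of the sequence and passes to the L2 limit on both sides. *)
Lemma in_H10_of_seq f (Df : 'I_N -> 'rV[R]_N -> R) (phi : nat -> 'rV[R]_N -> R) :
  L2 f -> (forall i, L2 (Df i)) -> (forall n, test_function Omega (phi n)) ->
  cvg2 phi f -> (forall i, cvg2 (fun n => partial i (phi n)) (Df i)) ->
  in_H10 Omega f Df.
Proof.
move=> Lf LD tp pf pDf.
have Lp n := test_function_L2 (tp n).
split.
  split; first exact/in_L2P.
  move=> i; split; first exact/in_L2P.
  move=> psi tpsi; have [Lpsi LDpsi] := test_function_L2 tpsi.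
  have H1 := cvg2_mulr mO (fun n => (Lp n).1) Lf (LDpsi i) pf.
  have H2 := cvg2_mulr mO (fun n => (Lp n).2 i) (LD i) Lpsi (pDf i).
  have E : (fun n => \int[leb R N]_(x in Omega) (phi n x * partial i psi x)) =
           (fun n => - \int[leb R N]_(x in Omega) (partial i (phi n) x * psi x)).
    by apply/funext => n; exact: test_function_by_parts (tp n) (test_function_C1 tpsi).
  rewrite E in H1.
  exact: (cvg_unique _ H1 (cvgN H2)).
move=> e e0.
pose s n := nrm2 (fun x => phi n x - f x) + \sum_(i < N) nrm2 (fun x => partial i (phi n) x - Df i x).
have LB n : L2 (fun x => phi n x - f x) by apply: L2B => //; exact: (Lp n).1.
have LBD n i : L2 (fun x => partial i (phi n) x - Df i x).
  by apply: L2B => //; exact: (Lp n).2.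
have s0 : s n @[n --> \oo] --> 0.
  rewrite (_ : 0 = 0 + \sum_(i < N) (0 : R)); last by rewrite big1// addr0.
  apply: cvgD => //.
  elim: (index_enum 'I_N) => [|i r IH].
    by under eq_fun do rewrite big_nil; rewrite big_nil; exact: cvg_cst.
  by under eq_fun do rewrite big_cons; rewrite big_cons; apply: cvgD => //; exact: pDf.
have e2 : 0 < e ^+ 2 by rewrite exprn_gt0.
have [n _ /(_ n (leqnn n))] : \forall n \near \oo, `|0 - s n| < e ^+ 2 by move/cvgrPdist_lt : s0; exact.
rewrite sub0r normrN => /(le_lt_trans (ler_norm _)) sn.
exists (phi n) => //; rewrite /H1_norm.
have -> : (\int[leb R N]_(x in Omega)
    ((phi n x - f x) ^+ 2 + \sum_(i < N) (partial i (phi n) x - Df i x) ^+ 2)%:E = (s n)%:E)%E.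
  under eq_integral do rewrite EFinD.
  rewrite ge0_integralD//; last 4 first.
  - by move=> x _; rewrite lee_fin sqr_ge0.
  - by apply/measurable_EFinP/measurable_funX; exact: (LB n).1.
  - by move=> x _; rewrite lee_fin sumr_ge0// => k _; exact: sqr_ge0.
  - apply/measurable_EFinP/measurable_sum => i; apply: measurable_funX; exact: (LBD n i).1.
  rewrite EFinD -nrm2E//; congr (_ + _)%E.
  under eq_integral do rewrite -sumEFin.
  rewrite ge0_integral_sum//.
  - by rewrite -sumEFin; apply: eq_bigr => i _; rewrite -nrm2E.
  - by move=> i; apply/measurable_EFinP/measurable_funX; exact: (LBD n i).1.
  - by move=> i x _; rewrite lee_fin sqr_ge0.
have sn0 : 0 <= s n by rewrite addr_ge0 ?nrm2_ge0// sumr_ge0// => i _; exact: nrm2_ge0.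
rewrite poweR_EFin lte_fin powR12_sqrt// -[ltRHS](ger0_norm (ltW e0)) -sqrtr_sqr.
by rewrite ltr_sqrt.
Qed.

End test_functions.

Lemma Rintegral_sum d (T : measurableType d) (R : realType) (m : {measure set T -> \bar R})
    (D : set T) (I : Type) (r : seq I) (F : I -> T -> R) : measurable D ->
  (forall i, m.-integrable D (EFin \o F i)) ->
  m.-integrable D (EFin \o (fun x => \sum_(i <- r) F i x)) /\
  \int[m]_(x in D) (\sum_(i <- r) F i x) = \sum_(i <- r) \int[m]_(x in D) F i x.
Proof.
move=> mD IF; elim: r => [|i r [IHi IH]].
  have E0 : (fun x : T => \sum_(i <- [::]) F i x) = fun=> 0 by apply/funext => x; rewrite big_nil.
  rewrite E0 big_nil; split; first exact: integrable0.
  by rewrite /Rintegral integral0.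
have E1 : (fun x : T => \sum_(j <- i :: r) F j x) = fun x => F i x + \sum_(j <- r) F j x.
  by apply/funext => x; rewrite big_cons.
rewrite E1 big_cons -IH -RintegralD//; split => //.
by have := integrableD mD (IF i) IHi; apply: eq_integrable.
Qed.

(** * Divergence against gradient *)

Section H10_inequalities.
Variables (R : realType) (N : nat) (Omega : set 'rV[R]_N).
Hypothesis mO : measurable Omega.

Local Notation L2 := (L2 (leb R N) Omega).
Local Notation nrm2 := (nrm2 (leb R N) Omega).
Local Notation cvg2 := (cvg2 (leb R N) Omega).

(** Pointwise the square of a trace is only bounded by N times the squared matrix norm. Under the
    integral d_i phi_i d_j phi_j may be replaced by d_j phi_i d_i phi_j, and 2xy <= x^2 + y^2 then
    gives the constant 1. *)
Lemma test_function_div (phi : 'I_N -> 'rV[R]_N -> R) :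
  (forall j, test_function Omega (phi j)) ->
  nrm2 (fun x => \sum_i partial i (phi i) x) <= \sum_i \sum_j nrm2 (partial i (phi j)).
Proof.
move=> tp; have Lp i j : L2 (partial i (phi j)) by exact: (test_function_L2 mO (tp j)).2.
have I2 i j k l : (leb R N).-integrable Omega (EFin \o (fun x => partial i (phi j) x * partial k (phi l) x)).
  exact: L2M.
have Is i j : (leb R N).-integrable Omega (EFin \o (fun x => partial i (phi j) x ^+ 2)).
  exact: (Lp i j).2.
rewrite /nrm2 (_ : (fun x => _ ^+ 2) = fun x =>
    \sum_i \sum_j partial i (phi i) x * partial j (phi j) x); last first.
  apply/funext => x; rewrite expr2 mulr_suml; apply: eq_bigr => i _.
  by rewrite mulr_sumr.
have J1 i := Rintegral_sum (index_enum 'I_N) mO (fun j => I2 i i j j).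
have [_ ->] := Rintegral_sum (index_enum 'I_N) mO (fun i => (J1 i).1).
apply: (@le_trans _ _ (\sum_i \sum_j (2^-1 * nrm2 (partial i (phi j)) + 2^-1 * nrm2 (partial j (phi i))))).
  apply: ler_sum => i _; rewrite (J1 i).2; apply: ler_sum => j _.
  rewrite (test_function_partial_swap i j (tp i) (tp j)) /nrm2 -!RintegralZl//.
  have Z2 k l : (leb R N).-integrable Omega (EFin \o (fun x => 2^-1 * partial k (phi l) x ^+ 2)).
    by have := integrableZl mO 2^-1 (Is k l); apply: eq_integrable.
  rewrite -RintegralD//; apply: le_Rintegral => //.
    by have := integrableD mO (Z2 i j) (Z2 j i); apply: eq_integrable.
  move=> x _; have := sqr_ge0 (partial i (phi j) x - partial j (phi i) x).
  by move: (partial i _ x) (partial j _ x) => a b; nra.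
under eq_bigr do rewrite big_split; rewrite big_split/=.
rewrite [X in _ + X]exchange_big/= -big_split/=.
apply: ler_sum => i _; rewrite -big_split/=; apply: ler_sum => j _.
have half (a : R) : 2^-1 * a + 2^-1 * a <= a by lra.
exact: half.
Qed.

Lemma cvgn_sum (I : Type) (r : seq I) (u : I -> nat -> R) (l : I -> R) :
  (forall i, u i n @[n --> \oo] --> l i) ->
  \sum_(i <- r) u i n @[n --> \oo] --> \sum_(i <- r) l i.
Proof.
move=> ul; elim: r => [|i r IH].
  by under eq_fun do rewrite big_nil; rewrite big_nil; exact: cvg_cst.
by under eq_fun do rewrite big_cons; rewrite big_cons; apply: cvgD => //; exact: ul.
Qed.

Lemma in_H10_vec_seq (u : 'rV[R]_N -> 'rV[R]_N) (Du : 'rV[R]_N -> 'M[R]_N) :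
  in_H10_vec Omega u Du ->
  [/\ forall j, L2 (fun x => u x ord0 j), forall i j, L2 (fun x => Du x i j) &
   exists phi : 'I_N -> nat -> 'rV[R]_N -> R,
   [/\ forall j n, test_function Omega (phi j n),
    forall j n, nrm2 (fun x => phi j n x - u x ord0 j) <= 2^-1 ^+ n &
    forall i j n, nrm2 (fun x => partial i (phi j n) x - Du x i j) <= 2^-1 ^+ n]].
Proof.
move=> Hu; have H j := in_H10_seq mO (Hu j).
split; [by move=> j; case: (H j)|by move=> i j; have [_ + _] := H j; apply|].
have /choice[phi Hphi] j : exists phi : nat -> 'rV[R]_N -> R,
   [/\ forall n, test_function Omega (phi n),
    forall n, nrm2 (fun x => phi n x - u x ord0 j) <= 2^-1 ^+ n &
    forall n i, nrm2 (fun x => partial i (phi n) x - Du x i j) <= 2^-1 ^+ n].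
  by have [] := H j.
by exists phi; split; [move=> j; case: (Hphi j)|move=> j; case: (Hphi j)|move=> i j n; case: (Hphi j)].
Qed.

Lemma in_H10_vec_div (u : 'rV[R]_N -> 'rV[R]_N) (Du : 'rV[R]_N -> 'M[R]_N) :
  in_H10_vec Omega u Du ->
  nrm2 (fun x => \tr (Du x)) <= \sum_i \sum_j nrm2 (fun x => Du x i j).
Proof.
move=> /in_H10_vec_seq[Lu LD [phi [tp _ pD]]].
have Lp i j n : L2 (partial i (phi j n)) by exact: (test_function_L2 mO (tp j n)).2.
have cD i j : cvg2 (fun n => partial i (phi j n)) (fun x => Du x i j).
  exact: cvg2_geometric.
have c1 := cvg2_nrm2 mO (fun n => L2_sum mO (index_enum 'I_N) (fun i => Lp i i n))
  (L2_sum mO (index_enum 'I_N) (fun i => LD i i))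
  (cvg2_sum mO (index_enum 'I_N) (fun i => Lp i i) (fun i => LD i i) (fun i => cD i i)).
have c2 := cvgn_sum (r := index_enum 'I_N) (fun i => cvgn_sum (r := index_enum 'I_N)
  (fun j => cvg2_nrm2 mO (Lp i j) (LD i j) (cD i j))).
apply: (ler_cvg_to c1 c2); apply: nearW => n /=.
exact: (test_function_div (fun j => tp j n)).
Qed.

End H10_inequalities.

(** * Sobolev inequality and truncation in H10 *)

Lemma cvgn_comp (R : realType) (h : R -> R) (u : nat -> R) (l : R) :
  {for l, continuous h} -> u n @[n --> \oo] --> l -> h (u n) @[n --> \oo] --> h l.
Proof. by move=> ch ul; exact: (@continuous_cvg _ _ _ \oo _ u h l ch ul). Qed.

Section sobolev_H10.
Variables (R : realType).

(** The higher integrability of f is not known in advance, so the left-hand side passes to the limit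
    by Fatou. The slack e serves because the gradient norms of the approximations are only
    eventually below Z + e. *)
Lemma sobolev_H10 n : exists2 S : R, 0 <= S & forall (Omega : set 'rV[R]_n.+3)
    (f : 'rV[R]_n.+3 -> R) Df, measurable Omega -> in_H10 Omega f Df ->
  ((\int[leb R n.+3]_(x in Omega) ((f x ^+ 2) `^ (n.+3%:R / n.+1%:R))%:E) `^ (n.+1%:R / n.+3%:R) <=
   (S * \sum_i nrm2 (leb R n.+3) Omega (Df i))%:E)%E.
Proof.
have [S S0 HS] := sobolev_C1 R n; exists S => // Omega f Df mO /(in_H10_seq mO).
move=> [Lf LD [phi [tp pf pD]]].
set k : R := n.+3%:R / n.+1%:R; set k' : R := n.+1%:R / n.+3%:R.
have k0 : 0 < k by rewrite divr_gt0.
have k'0 : 0 < k' by rewrite divr_gt0.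
have kk' : k' * k = 1 by rewrite /k /k' mulrA mulfVK ?divff ?pnatr_eq0.
have Lp m := test_function_L2 mO (tp m).
set Z := S * _.
have Z0 : 0 <= Z by rewrite mulr_ge0// sumr_ge0// => i _; exact: nrm2_ge0.
have cZ : S * \sum_i nrm2 (leb R n.+3) Omega (partial i (phi m)) @[m --> \oo] --> Z.
  apply: cvgn_mull; apply: cvgn_sum => i; apply: cvg2_nrm2 => //.
    by move=> m; exact: (Lp m).2.
  exact: cvg2_geometric.
have cf : continuous (fun t : R => (t ^+ 2) `^ k) by exact: continuous_sqr_powR.
have mk (g : 'rV[R]_n.+3 -> R) : measurable_fun Omega g -> measurable_fun Omega (fun x => (g x ^+ 2) `^ k).
  move=> mg; apply: measurableT_comp (measurable_powR _) _.
  exact: measurable_funX.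
have Hm m : (\int[leb R n.+3]_(x in Omega) ((phi m x ^+ 2) `^ k)%:E <=
    ((S * \sum_i nrm2 (leb R n.+3) Omega (partial i (phi m))) `^ k)%:E)%E.
  have [K [cK KO p0]] := test_function_support (tp m).
  have := HS K (phi m) cK p0 (test_function_C1 (tp m)).
  rewrite -(@integral_support _ _ Omega K (fun x => (phi m x ^+ 2) `^ k))//; last first.
    by move=> x Kx; rewrite p0// expr0n powR0// gt_eqF.
  rewrite -(@integral_support _ _ Omega K (fun x => \sum_i partial i (phi m) x ^+ 2))//; last first.
    move=> x Kx; rewrite big1// => i _; rewrite (@partial_off _ _ K)//; last first.
      by apply: compact_closed => //; exact: norm_hausdorff.
    by rewrite expr0n.
  under [X in (_ <= _ * X)%E -> _]eq_integral do rewrite -sumEFin.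
  rewrite ge0_integral_sum//; last 2 first.
  - by move=> i; apply/measurable_EFinP/measurable_funX; exact: ((Lp m).2 i).1.
  - by move=> i x _; rewrite lee_fin sqr_ge0.
  rewrite (eq_bigr (fun i => (nrm2 (leb R n.+3) Omega (partial i (phi m)))%:E)); last first.
    by move=> i _; rewrite nrm2E//; exact: (Lp m).2.
  rewrite sumEFin -EFinM => H.
  have := gt0_ler_poweR (r := k) (ltW k0) _ _ H => /(_ _ _)/wrap[].
  - by rewrite in_itv/= leey poweR_ge0.
  - by rewrite in_itv/= leey lee_fin mulr_ge0// sumr_ge0// => i _; exact: nrm2_ge0.
  rewrite -poweRrM kk' poweRe1// integral_ge0// => x _.
  by rewrite lee_fin powR_ge0.
have ae : {ae leb R n.+3, forall x, Omega x -> phi m x @[m --> \oo] --> f x}.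
  by apply: cvg2_ae pf => // m; apply: L2B => //; exact: (Lp m).1.
apply/lee_addgt0Pr => e e0.
have : (\int[leb R n.+3]_(x in Omega) ((f x ^+ 2) `^ k)%:E <= ((Z + e) `^ k)%:E)%E.
  apply: (fatou_le mO (f_ := fun m x => (phi m x ^+ 2) `^ k)).
  - by move=> m; apply: mk; exact: (Lp m).1.1.
  - by apply: mk; exact: Lf.1.
  - by move=> m x _; exact: powR_ge0.
  - by move=> x _; exact: powR_ge0.
  - apply: filterS ae => x H Ox.
    exact: (cvgn_comp (cf (f x)) (H Ox)).
  - move/cvgrPdist_lt : cZ => /(_ _ e0); apply: filterS => m Hd.
    apply: le_trans (Hm m) _; rewrite lee_fin ge0_ler_powR ?nnegrE ?(ltW k0)//.
    + by rewrite mulr_ge0// sumr_ge0// => i _; exact: nrm2_ge0.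
    + by rewrite addr_ge0// ltW.
    + by rewrite -lerBlDl ltW// (le_lt_trans (ler_norm _))// distrC.
move/(gt0_ler_poweR (ltW k'0)) => /(_ _ _)/wrap[].
- by rewrite in_itv/= leey andbT integral_ge0// => x _; rewrite lee_fin powR_ge0.
- by rewrite in_itv/= leey lee_fin powR_ge0.
by rewrite poweR_EFin -powRrM mulrC kk' powRr1// addr_ge0// ltW.
Qed.

End sobolev_H10.

(** * The regularized weight *)

Section cutoff.
Variables (R : realType) (nu : R) (nu1 : 1 <= nu).
Implicit Types (b s : R).

(* Equals (1 + nu s) / (nu + s) for s >= 0, which increases from 1/nu to nu and
   tends to s as nu tends to infinity. The expression below involves only sums,
   products and powers, so that it preserves smoothness. *)
Definition cutoff s := nu - (nu ^+ 2 - 1) * (nu + s) `^ (-1).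

Definition cutoff_pow b s := cutoff s `^ b.

(** The derivative of [cutoff_pow b] on s >= 0, see [is_derive_cutoff_pow]. *)
Definition cutoff_pow' b s :=
  b * cutoff s `^ (b - 1) * ((nu ^+ 2 - 1) * (nu + s) `^ (-2)).

Let nu0 : 0 < nu. Proof. exact: lt_le_trans nu1. Qed.

Lemma cutoffE s : 0 <= s -> cutoff s = (1 + nu * s) / (nu + s).
Proof.
move=> s0; have ns : 0 < nu + s by rewrite ltr_wpDr.
by rewrite /cutoff powR_inv1 ?(ltW ns)//; field; rewrite gt_eqF.
Qed.

Lemma cutoff_gt0 s : 0 <= s -> 0 < cutoff s.
Proof.
move=> s0; rewrite cutoffE// divr_gt0//; last by rewrite ltr_wpDr.
by rewrite ltr_wpDr// mulr_ge0// ltW.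
Qed.

Lemma cutoff_le s : cutoff s <= nu.
Proof.
rewrite /cutoff gerBl mulr_ge0 ?powR_ge0// subr_ge0.
by rewrite expr2 (le_trans nu1)// ler_peMl// ltW.
Qed.

Lemma cutoff_pow_gt0 b s : 0 <= s -> 0 < cutoff_pow b s.
Proof. by move=> s0; rewrite powR_gt0// cutoff_gt0. Qed.

Lemma cutoff_pow_le b s : 0 <= b -> 0 <= s -> cutoff_pow b s <= nu `^ b.
Proof.
move=> b0 s0; rewrite ge0_ler_powR ?nnegrE ?cutoff_le// ltW//.
exact: cutoff_gt0.
Qed.

Lemma sqrB1_ge0 : 0 <= nu ^+ 2 - 1.
Proof. by rewrite subr_ge0 expr2 (le_trans nu1)// ler_peMl// ltW. Qed.

Lemma cutoff_pow'_ge0 b s : 0 <= b -> 0 <= cutoff_pow' b s.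
Proof.
by move=> b0; rewrite /cutoff_pow' !mulr_ge0 ?powR_ge0// sqrB1_ge0.
Qed.

(** This is s X'(s) <= X(s), with equality for the untruncated X(s) = s. After clearing denominators
    it reads s (nu^2 - 1) <= (1 + nu s)(nu + s). It yields both the boundedness of the truncated
    coefficients and the constant 1 - 2/p. *)
Lemma cutoff_pow'_le b s : 0 <= b -> 0 <= s -> cutoff_pow' b s * s <= b * cutoff_pow b s.
Proof.
move=> b0 s0; have ns : 0 < nu + s by rewrite ltr_wpDr.
have c0 := cutoff_gt0 s0.
rewrite /cutoff_pow' /cutoff_pow -!mulrA ler_wpM2l//.
have -> : cutoff s `^ b = cutoff s `^ (b - 1) * cutoff s.
  rewrite -{1}(subrK 1 b) [LHS]powRD; last by rewrite (gt_eqF c0) implybT.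
  by rewrite powRr1// ltW.
rewrite ler_wpM2l ?powR_ge0// cutoffE//.
rewrite powR_invn ?(ltW ns)//.
have -> : (nu ^+ 2 - 1) * ((nu + s) ^- 2 * s) = s * (nu ^+ 2 - 1) / (nu + s) / (nu + s).
  by field; rewrite gt_eqF.
rewrite ler_pM2r ?invr_gt0// ler_pdivrMr//.
have := mulr_ge0 s0 s0; have := mulr_ge0 (ltW nu0) s0; have := mulr_ge0 (ltW nu0) (ltW nu0).
have := mulr_ge0 (ltW nu0) (mulr_ge0 s0 s0).
by nra.
Qed.

Lemma is_derive_cutoff_pow b s : 0 <= s -> is_derive s 1 (cutoff_pow b) (cutoff_pow' b s).
Proof.
move=> s0; have ns : 0 < nu + s by rewrite ltr_wpDr.
have D1 : is_derive s 1 (fun s => nu + s) (0 + 1).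
  exact: (is_deriveD (is_derive_cst nu s 1) (is_derive_id s 1)).
have D2 := is_derive1_comp (is_derive_powR (-1) ns) D1.
have D3 : is_derive s 1 cutoff ((nu ^+ 2 - 1) * (nu + s) `^ (-2)).
  have D3 := is_deriveB (is_derive_cst nu s 1) (is_deriveZ (nu ^+ 2 - 1) D2).
  apply: is_derive_eq D3 _.
  rewrite /GRing.scale/= (_ : (-1 - 1 : R) = -2); last by ring.
  by move: (_ `^ _) => z; ring.
exact: (is_derive1_comp (is_derive_powR b (cutoff_gt0 s0)) D3).
Qed.

Lemma measurable_cutoff : measurable_fun setT cutoff.
Proof.
apply: measurable_funB; first exact: measurable_cst.
apply: measurable_funM; first exact: measurable_cst.
apply: measurableT_comp (measurable_powR _) _.
by apply: measurable_funD; [exact: measurable_cst|exact: measurable_id].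
Qed.

Lemma measurable_cutoff_pow b : measurable_fun setT (cutoff_pow b).
Proof. exact: measurableT_comp (measurable_powR _) measurable_cutoff. Qed.

Lemma measurable_cutoff_pow' b : measurable_fun setT (cutoff_pow' b).
Proof.
apply: measurable_funM.
  apply: measurable_funM; first exact: measurable_cst.
  exact: measurableT_comp (measurable_powR _) measurable_cutoff.
apply: measurable_funM; first exact: measurable_cst.
apply: measurableT_comp (measurable_powR _) _.
by apply: measurable_funD; [exact: measurable_cst|exact: measurable_id].
Qed.

Lemma cvgn_powR (a l : R) (u : nat -> R) : 0 < l ->
  u n @[n --> \oo] --> l -> u n `^ a @[n --> \oo] --> l `^ a.
Proof.
by move=> l0; apply: (@cvgn_comp R (fun t => t `^ a)); exact: continuous_powR.
Qed.

Lemma cvgn_cutoff (u : nat -> R) s : 0 <= s -> u n @[n --> \oo] --> s ->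
  cutoff (u n) @[n --> \oo] --> cutoff s.
Proof.
move=> s0 us; have ns : 0 < nu + s by rewrite ltr_wpDr.
apply: cvgn_sub; first exact: cvg_cst.
apply: cvgn_mull; apply: cvgn_powR => //.
by apply: cvgD => //; exact: cvg_cst.
Qed.

Lemma cvgn_cutoff_pow b (u : nat -> R) s : 0 <= s -> u n @[n --> \oo] --> s ->
  cutoff_pow b (u n) @[n --> \oo] --> cutoff_pow b s.
Proof.
by move=> s0 us; apply: cvgn_powR; [exact: cutoff_gt0|exact: cvgn_cutoff].
Qed.

Lemma cvgn_cutoff_pow' b (u : nat -> R) s : 0 <= s -> u n @[n --> \oo] --> s ->
  cutoff_pow' b (u n) @[n --> \oo] --> cutoff_pow' b s.
Proof.
move=> s0 us; have ns : 0 < nu + s by rewrite ltr_wpDr.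
apply: cvgn_mul; apply: cvgn_mull.
  by apply: cvgn_powR; [exact: cutoff_gt0|exact: cvgn_cutoff].
apply: cvgn_powR => //.
by apply: cvgD => //; exact: cvg_cst.
Qed.

End cutoff.

(** * Truncation of vector fields in H10 *)

Section truncation.
Variables (R : realType) (N : nat) (nu b : R).
Hypotheses (nu1 : 1 <= nu) (b0 : 0 <= b).
Implicit Types (x : 'rV[R]_N) (phi : 'I_N -> 'rV[R]_N -> R).

Definition sqn (m : nat) (v : 'rV[R]_m) := \sum_j v ord0 j ^+ 2.

Lemma sqn_ge0 m (v : 'rV[R]_m) : 0 <= sqn v.
Proof. by apply: sumr_ge0 => j _; exact: sqr_ge0. Qed.

Definition trunc_vec (u : 'rV[R]_N -> 'rV[R]_N) x :=
  cutoff_pow nu b (sqn (u x)) *: u x.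

(** The gradient of [trunc_vec u] according to the formal chain rule; [in_H10_vec_trunc] shows that
    it is the weak one. *)
Definition trunc_mx (u : 'rV[R]_N -> 'rV[R]_N) (Du : 'rV[R]_N -> 'M[R]_N) x : 'M[R]_N :=
  \matrix_(i, j) (cutoff_pow nu b (sqn (u x)) * Du x i j +
    2 * cutoff_pow' nu b (sqn (u x)) * (\sum_l u x ord0 l * Du x i l) * u x ord0 j).

Lemma is_derive_bigsum (I : Type) (r : seq I) (F : I -> 'rV[R]_N -> R) (dF : I -> R) x v :
  (forall i, is_derive x v (F i) (dF i)) ->
  is_derive x v (fun x => \sum_(i <- r) F i x) (\sum_(i <- r) dF i).
Proof.
move=> H; elim: r => [|i r IH].
  rewrite big_nil (_ : (fun _ => _) = cst 0); first exact: is_derive_cst.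
  by apply/funext => y; rewrite big_nil.
rewrite big_cons (_ : (fun _ => _) = F i + (fun y => \sum_(i <- r) F i y)).
  exact: is_deriveD.
by apply/funext => y; rewrite big_cons.
Qed.

Lemma smooth_sqn phi : (forall j, smooth (phi j)) -> smooth (fun x => \sum_j phi j x ^+ 2).
Proof.
by move=> sphi; apply: smooth_sum => j; under eq_fun do rewrite expr2; exact: smooth_mul.
Qed.

Lemma smooth_trunc phi k : (forall j, smooth (phi j)) ->
  smooth (fun x => cutoff_pow nu b (\sum_j phi j x ^+ 2) * phi k x).
Proof.
move=> sphi; apply: smooth_mul => //.
have s0 x : 0 <= \sum_j phi j x ^+ 2 by apply: sumr_ge0 => j _; exact: sqr_ge0.
rewrite /cutoff_pow; apply: smooth_powR => [|x]; last exact: cutoff_gt0.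
apply: smooth_add; first exact: smooth_cst.
rewrite (_ : (fun x => _) = fun x => (- (nu ^+ 2 - 1)) * (nu + \sum_j phi j x ^+ 2) `^ (-1)); last first.
  by apply/funext => x; rewrite mulNr.
apply: smooth_mul; first exact: smooth_cst.
apply: smooth_powR => [|x].
  by apply: smooth_add; [exact: smooth_cst|exact: smooth_sqn].
by rewrite ltr_wpDr// (lt_le_trans ltr01).
Qed.

Lemma test_function_trunc (Omega : set 'rV[R]_N) phi k :
  (forall j, test_function Omega (phi j)) ->
  test_function Omega (fun x => cutoff_pow nu b (\sum_j phi j x ^+ 2) * phi k x).
Proof.
move=> tp; have [_ cK KO] := tp k.
have sub : closure [set x | cutoff_pow nu b (\sum_j phi j x ^+ 2) * phi k x != 0] `<=`
           closure [set x | phi k x != 0].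
  by apply: closure_subset => x /=; rewrite mulf_eq0 negb_or => /andP[].
split.
- by apply: smooth_trunc => j; case: (tp j).
- by apply: subclosed_compact cK sub; exact: closed_closure.
- exact: subset_trans sub KO.
Qed.

Lemma partial_trunc phi k i x : (forall j, smooth (phi j)) ->
  partial i (fun x => cutoff_pow nu b (\sum_j phi j x ^+ 2) * phi k x) x =
  cutoff_pow nu b (\sum_j phi j x ^+ 2) * partial i (phi k) x +
  2 * cutoff_pow' nu b (\sum_j phi j x ^+ 2) *
     (\sum_l phi l x * partial i (phi l) x) * phi k x.
Proof.
move=> sphi; pose s (y : 'rV[R]_N) := \sum_j phi j y ^+ 2.
have dphi j : is_derive x (delta_mx ord0 i) (phi j) (partial i (phi j) x).
  by apply: is_derive_partial; have [_ + _] := smooth_C1 (sphi j); exact.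
have Ds : is_derive x (delta_mx ord0 i) s (2 * \sum_l phi l x * partial i (phi l) x).
  rewrite mulr_sumr; apply: is_derive_bigsum => j.
  rewrite (_ : (fun y => _) = (phi j) ^+ 2)//.
  have H := is_deriveX 2 (dphi j); apply: is_derive_eq H _.
  by rewrite /GRing.scale/= expr1 mulrA.
have s0 : 0 <= s x by apply: sumr_ge0 => j _; exact: sqr_ge0.
have Dc := is_derive_compose (is_derive_cutoff_pow nu1 b s0) Ds.
have D := is_deriveM Dc (dphi k).
apply: etrans (@derive_val _ _ _ _ _ _ _ D) _; rewrite /GRing.scale/= -/(s x).
by congr (_ + _); rewrite mulrC mulrA (mulrC 2).
Qed.

Lemma sqr_le_sqn m (v : 'rV[R]_m) j : v ord0 j ^+ 2 <= sqn v.
Proof. by rewrite /sqn (bigD1 j)//= lerDl sumr_ge0// => i _; exact: sqr_ge0. Qed.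

(** The two factors of v cost at most |v|^2, which [cutoff_pow'_le] absorbs. Hence truncation
    preserves L2 although [u] may be unbounded. *)
Lemma trunc_coef_le (v : 'rV[R]_N) j l :
  `|2 * cutoff_pow' nu b (sqn v) * (v ord0 l * v ord0 j)| <= 2 * b * nu `^ b.
Proof.
have s0 := sqn_ge0 v; have d0 := cutoff_pow'_ge0 nu1 (sqn v) b0.
have p0 : 0 <= 2 * cutoff_pow' nu b (sqn v) by exact: mulr_ge0.
rewrite normrM [`|2 * _|](ger0_norm p0).
have vv : `|v ord0 l * v ord0 j| <= sqn v.
  have := sqr_le_sqn v j; have := sqr_le_sqn v l; rewrite normrM.
  rewrite -(real_normK (num_real (v ord0 l))) -(real_normK (num_real (v ord0 j))).
  have := sqr_ge0 (`|v ord0 l| - `|v ord0 j|).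
  by move: `|v ord0 l| `|v ord0 j| (sqn v) => p q s; nra.
apply: (@le_trans _ _ (2 * cutoff_pow' nu b (sqn v) * sqn v)).
  by rewrite ler_wpM2l.
rewrite -[leLHS]mulrA -[leRHS]mulrA ler_wpM2l//.
apply: le_trans (cutoff_pow'_le nu1 b0 s0) _.
by rewrite ler_wpM2l// cutoff_pow_le.
Qed.

(** Displays the truncated gradient as linear in [Du] with coefficients that depend on [u] only and
    are bounded, the shape required by [cvg2_bounded_mul]. *)
Lemma trunc_mxE u Du x i j : trunc_mx u Du x i j =
  \sum_l ((if l == j then cutoff_pow nu b (sqn (u x)) else 0) +
    2 * cutoff_pow' nu b (sqn (u x)) * (u x ord0 l * u x ord0 j)) * Du x i l.
Proof.
rewrite mxE; under [RHS]eq_bigr do rewrite mulrDl; rewrite [RHS]big_split/=; congr (_ + _).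
  by rewrite (bigD1 j)//= eqxx big1 ?addr0// => l /negPf ->; rewrite mul0r.
rewrite mulr_sumr mulr_suml; apply: eq_bigr => l _; ring.
Qed.

(** For test functions the truncation is again a test function and the chain rule is classical.
    Along the approximating sequence the coefficients [C] are uniformly bounded and converge almost
    everywhere, so the truncated functions and their gradients converge in L2. *)
Lemma in_H10_vec_trunc (Omega : set 'rV[R]_N) u Du : measurable Omega ->
  in_H10_vec Omega u Du -> in_H10_vec Omega (trunc_vec u) (trunc_mx u Du).
Proof.
move=> mO /(in_H10_vec_seq mO)[Lu LD [phi [tp pu pD]]].
pose w n x : 'rV[R]_N := \row_j phi j n x.
pose Dw n x : 'M[R]_N := \matrix_(i, j) partial i (phi j n) x.
have wE n x j : w n x ord0 j = phi j n x by rewrite mxE.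
have sqE n x : sqn (w n x) = \sum_j phi j n x ^+ 2.
  by apply: eq_bigr => j _; rewrite wE.
have Lp j n := test_function_L2 mO (tp j n).
pose C (v : 'rV[R]_N) j l := (if l == j then cutoff_pow nu b (sqn v) else 0) +
    2 * cutoff_pow' nu b (sqn v) * (v ord0 l * v ord0 j).
have nub0 : 0 <= nu `^ b by exact: powR_ge0.
have theta_le (v : 'rV[R]_N) : `|cutoff_pow nu b (sqn v)| <= nu `^ b.
  rewrite ger0_norm ?cutoff_pow_le ?sqn_ge0// ltW//.
  by rewrite cutoff_pow_gt0// sqn_ge0.
have C_le v j l : `|C v j l| <= nu `^ b + 2 * b * nu `^ b.
  apply: le_trans (ler_normD _ _) _; apply: lerD; last exact: trunc_coef_le.
  by case: ifPn => // _; rewrite normr0.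
have msq (g : 'rV[R]_N -> 'rV[R]_N) : (forall j, measurable_fun Omega (fun x => g x ord0 j)) ->
    measurable_fun Omega (fun x => sqn (g x)).
  by move=> mg; apply: measurable_sum => j; apply: measurable_funX.
have mtheta (g : 'rV[R]_N -> 'rV[R]_N) : (forall j, measurable_fun Omega (fun x => g x ord0 j)) ->
    measurable_fun Omega (fun x => cutoff_pow nu b (sqn (g x))).
  by move=> mg; apply: measurableT_comp (measurable_cutoff_pow _ _) _; exact: msq.
have mC (g : 'rV[R]_N -> 'rV[R]_N) j l : (forall j, measurable_fun Omega (fun x => g x ord0 j)) ->
    measurable_fun Omega (fun x => C (g x) j l).
  move=> mg; apply: measurable_funD.
    by case: (l == j); [exact: mtheta|exact: measurable_cst].
  apply: measurable_funM; last exact: measurable_funM.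
  apply: measurable_funM; first exact: measurable_cst.
  by apply: measurableT_comp (measurable_cutoff_pow' _ _) _; exact: msq.
have mw n j : measurable_fun Omega (fun x => w n x ord0 j).
  by under eq_fun do rewrite wE; exact: (Lp j n).1.1.
have mu j : measurable_fun Omega (fun x => u x ord0 j) by exact: (Lu j).1.
have ae : {ae leb R N, forall x, Omega x -> forall j, w n x ord0 j @[n --> \oo] --> u x ord0 j}.
  have aej (j : 'I_N) : {ae leb R N, forall x, Omega x -> w n x ord0 j @[n --> \oo] --> u x ord0 j}.
    under [X in \forall x \ae _, X x]eq_fun => x do under eq_fun do rewrite wE.
    by apply: cvg2_ae (pu j) => // n; apply: L2B => //; exact: (Lp j n).1.
  have H0 : {ae leb R N, forall x, forall j, Omega x -> w n x ord0 j @[n --> \oo] --> u x ord0 j}.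
    exact: filter_forall.
  by apply: filterS H0 => x H Ox j; exact: H.
have sq_cvg x : (forall j, w n x ord0 j @[n --> \oo] --> u x ord0 j) ->
    sqn (w n x) @[n --> \oo] --> sqn (u x).
  by move=> H; apply: cvgn_sum => j; rewrite expr2; under eq_fun do rewrite expr2; exact: cvgn_mul.
have aetheta : {ae leb R N, forall x, Omega x ->
    cutoff_pow nu b (sqn (w n x)) @[n --> \oo] --> cutoff_pow nu b (sqn (u x))}.
  apply: filterS ae => x H Ox; apply: cvgn_cutoff_pow => //; first exact: sqn_ge0.
  by apply: sq_cvg; exact: H.
have aeC j l : {ae leb R N, forall x, Omega x ->
    C (w n x) j l @[n --> \oo] --> C (u x) j l}.
  apply: filterS2 ae aetheta => x H H' Ox; apply: cvgD.
    by case: (l == j); [exact: H'|exact: cvg_cst].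
  apply: cvgn_mul; last by apply: cvgn_mul; exact: H.
  apply: cvgn_mull; apply: cvgn_cutoff_pow' => //; first exact: sqn_ge0.
  by apply: sq_cvg; exact: H.
have cu j : cvg2 (leb R N) Omega (phi j) (fun x => u x ord0 j) by exact: cvg2_geometric.
have cD i j : cvg2 (leb R N) Omega (fun n => partial i (phi j n)) (fun x => Du x i j).
  exact: cvg2_geometric.
move=> k; pose v n x := cutoff_pow nu b (\sum_j phi j n x ^+ 2) * phi k n x.
have tv n : test_function Omega (v n) by apply: test_function_trunc => j.
have E1 : (fun x => trunc_vec u x ord0 k) = fun x => cutoff_pow nu b (sqn (u x)) * u x ord0 k.
  by apply/funext => x; rewrite mxE.
have E2 i : (fun x => trunc_mx u Du x i k) = fun x => \sum_l C (u x) k l * Du x i l.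
  by apply/funext => x; rewrite trunc_mxE.
have E3 i n : partial i (v n) = fun x => \sum_l C (w n x) k l * partial i (phi l n) x.
  apply/funext => x; rewrite partial_trunc; last by move=> j; case: (tp j n).
  have := trunc_mxE (w n) (Dw n) x i k; rewrite mxE => H.
  under [RHS]eq_bigr do rewrite /C.
  move: H; rewrite !mxE sqE => H.
  have -> : \sum_l phi l n x * partial i (phi l n) x = \sum_l w n x ord0 l * Dw n x i l.
    by apply: eq_bigr => l _; rewrite !mxE.
  by rewrite H; apply: eq_bigr => l _; rewrite !mxE.
have E4 : v = fun n x => cutoff_pow nu b (sqn (w n x)) * phi k n x.
  by apply/funext => n; apply/funext => x; rewrite sqE.
have LC (g : 'rV[R]_N -> 'rV[R]_N) i l (f : 'rV[R]_N -> R) : (forall j, measurable_fun Omega (fun x => g x ord0 j)) ->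
    L2 (leb R N) Omega f -> L2 (leb R N) Omega (fun x => C (g x) i l * f x).
  move=> mg; apply: (L2_bounded_mul mO (K := nu `^ b + 2 * b * nu `^ b)); first exact: mC.
  by move=> x _; exact: C_le.
have L1 : L2 (leb R N) Omega (fun x => cutoff_pow nu b (sqn (u x)) * u x ord0 k).
  exact: (L2_bounded_mul mO (mtheta u mu) (fun x _ => theta_le (u x)) (Lu k)).
have L2' i : L2 (leb R N) Omega (fun x => \sum_l C (u x) k l * Du x i l).
  by apply: (L2_sum mO) => l; exact: LC.
have c1 : cvg2 (leb R N) Omega (fun n x => cutoff_pow nu b (sqn (w n x)) * phi k n x)
    (fun x => cutoff_pow nu b (sqn (u x)) * u x ord0 k).
  exact: (cvg2_bounded_mul mO (fun n => mtheta (w n) (mw n)) (mtheta u mu)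
    (fun n x _ => theta_le (w n x)) (fun x _ => theta_le (u x)) aetheta
    (fun n => (Lp k n).1) (Lu k) (cu k)).
have c2 i : cvg2 (leb R N) Omega (fun n x => \sum_l C (w n x) k l * partial i (phi l n) x)
    (fun x => \sum_l C (u x) k l * Du x i l).
  have c2l l := cvg2_bounded_mul mO (fun n => mC (w n) k l (mw n)) (mC u k l mu)
    (fun n x _ => C_le (w n x) k l) (fun x _ => C_le (u x) k l) (aeC k l)
    (fun n => (Lp l n).2 i) (LD i l) (cD i l).
  exact: (cvg2_sum mO (index_enum 'I_N) (fun l n => LC (w n) k l _ (mw n) ((Lp l n).2 i))
    (fun l => LC u k l _ mu (LD i l)) c2l).
apply: (in_H10_of_seq (phi := v) mO) tv _ _.
- by move: L1; rewrite -E1.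
- by move=> i; move: (L2' i); rewrite -E2.
- by move: c1; rewrite -E1 -E4.
- move=> i; move: (c2 i); rewrite -E2; apply: cvg_trans.
  by apply: near_eq_cvg; apply: nearW => n; rewrite E3.
Qed.

End truncation.

(** * Coercivity of the elastic form *)

Section pointwise.
Variables (R : realType) (N : nat).
Implicit Types (a b : 'I_N -> R) (A B D F M W : 'M[R]_N) (u : 'rV[R]_N).

(** Lagrange's identity: the double sum of squares is twice the defect in the inequality. *)
Lemma sum_cauchy_schwarz a b :
  (\sum_i a i * b i) ^+ 2 <= (\sum_i a i ^+ 2) * (\sum_i b i ^+ 2).
Proof.
have H : 0 <= \sum_i \sum_j (a i * b j - a j * b i) ^+ 2.
  by apply: sumr_ge0 => i _; apply: sumr_ge0 => j _; exact: sqr_ge0.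
have E : \sum_i \sum_j (a i * b j - a j * b i) ^+ 2 =
   2 * ((\sum_i a i ^+ 2) * (\sum_i b i ^+ 2)) - 2 * (\sum_i a i * b i) ^+ 2.
  rewrite (eq_bigr (fun i => a i ^+ 2 * (\sum_j b j ^+ 2) + b i ^+ 2 * (\sum_j a j ^+ 2)
     - 2 * ((a i * b i) * \sum_j a j * b j))); last first.
    move=> i _; rewrite !mulr_sumr -big_split -sumrB/=.
    by apply: eq_bigr => j _; ring.
  rewrite sumrB big_split/= -!mulr_suml -mulr_sumr -mulr_suml.
  by move: (\sum_i a i ^+ 2) (\sum_i b i ^+ 2) (\sum_i a i * b i) => x y z; ring.
by move: H; rewrite E -mulrBr pmulr_rge0// subr_ge0.
Qed.

Definition fsq (m n : nat) (A : 'M[R]_(m, n)) := \sum_i \sum_j A i j ^+ 2.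

Lemma fsq_ge0 m n (A : 'M[R]_(m, n)) : 0 <= fsq A.
Proof. by apply: sumr_ge0 => i _; apply: sumr_ge0 => j _; exact: sqr_ge0. Qed.

Section truncated_field.
Variables (h t k : R) (u : 'rV[R]_N) (D : 'M[R]_N).
Hypotheses (h0 : 0 < h) (t0 : 0 <= t) (k0 : 0 <= k) (k1 : k <= 1).
Hypothesis tk : t * sqn u * (1 - k) <= k * h.

Let A i := \sum_l u ord0 l * D i l.
Let E : 'M[R]_N := \matrix_(i, j) (t * A i * u ord0 j).
Let M : 'M[R]_N := \matrix_(i, j) (h * D i j + t * A i * u ord0 j).
Let W : 'M[R]_N := \matrix_(i, j) (h ^+ 2 * D i j + 2 * h * t * A i * u ord0 j).

Let ts0 : 0 <= t * sqn u. Proof. by rewrite mulr_ge0// sqn_ge0. Qed.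

Let fsqE : fsq E = t ^+ 2 * (\sum_i A i ^+ 2) * sqn u.
Proof.
rewrite /fsq mulr_sumr mulr_suml; apply: eq_bigr => i _.
by rewrite /sqn mulr_sumr; apply: eq_bigr => j _; rewrite mxE !exprMn.
Qed.

(** Multiplying M by u gives (h + t |u|^2) A, so Cauchy-Schwarz on each row bounds (h + t |u|^2)^2
    |A|^2 by |M|^2 |u|^2, while |E|^2 = t^2 |A|^2 |u|^2. Hypothesis [tk] says that t |u|^2 is at
    most the fraction k of h + t |u|^2. *)
Let fsqE_le : fsq E <= k ^+ 2 * fsq M.
Proof.
have hts : 0 < h + t * sqn u by rewrite ltr_wpDr.
have B i : (\sum_l M i l * u ord0 l) = (h + t * sqn u) * A i.
  rewrite mulrDl /A mulr_sumr -/(A i) /sqn (mulrC t) -mulrA mulr_suml -big_split/=.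
  by apply: eq_bigr => l _; rewrite mxE; ring.
have H : (h + t * sqn u) ^+ 2 * (\sum_i A i ^+ 2) <= fsq M * sqn u.
  rewrite mulr_sumr /fsq mulr_suml; apply: ler_sum => i _.
  by rewrite -exprMn -B; exact: sum_cauchy_schwarz.
have tsk : t * sqn u <= k * (h + t * sqn u) by move: tk; lra.
rewrite -(ler_pM2l (exprn_gt0 2 hts)) fsqE.
apply: (@le_trans _ _ ((t * sqn u) ^+ 2 * fsq M)).
  have a1 (x s : R) : (h + t * s) ^+ 2 * (t ^+ 2 * x * s) = t ^+ 2 * s * ((h + t * s) ^+ 2 * x) by ring.
  have a2 (x s : R) : (t * s) ^+ 2 * x = t ^+ 2 * s * (x * s) by ring.
  rewrite a1 a2.
  by rewrite ler_wpM2l// mulr_ge0 ?sqr_ge0// sqn_ge0.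
rewrite mulrA; apply: ler_wpM2r; first exact: fsq_ge0.
rewrite -exprMn (mulrC _ k); apply: lerXn2r => //; rewrite nnegrE.
by rewrite mulr_ge0// ltW.
Qed.

Let trE2 : (\tr E) ^+ 2 <= fsq E.
Proof.
rewrite fsqE (_ : \tr E = t * \sum_i A i * u ord0 i); last first.
  by rewrite mulr_sumr; apply: eq_bigr => i _; rewrite mxE mulrA.
rewrite exprMn -mulrA ler_wpM2l ?sqr_ge0//.
exact: sum_cauchy_schwarz.
Qed.

Let ME i j : M i j = h * D i j + E i j. Proof. by rewrite !mxE. Qed.
Let WE i j : W i j = h ^+ 2 * D i j + 2 * h * E i j. Proof. by rewrite !mxE !mulrA. Qed.

Let trM : \tr M = h * \tr D + \tr E.
Proof. by rewrite /mxtrace mulr_sumr -big_split/=; apply: eq_bigr => i _; exact: ME. Qed.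

Let trW : \tr W = h ^+ 2 * \tr D + 2 * h * \tr E.
Proof. by rewrite /mxtrace !mulr_sumr -big_split/=; apply: eq_bigr => i _; exact: WE. Qed.

(** In |h D + E|^2 the cross term equals 2 h t |A|^2 and is nonnegative. This returns from the
    energy of V to the weighted gradient of [u]. *)
Lemma fsq_truncated : h ^+ 2 * fsq D <= fsq M.
Proof.
rewrite -subr_ge0.
have -> : fsq M - h ^+ 2 * fsq D = 2 * h * t * (\sum_i A i ^+ 2) + fsq E.
  rewrite /fsq !mulr_sumr -sumrB -big_split/=; apply: eq_bigr => i _.
  rewrite !mulr_sumr -sumrB.
  have -> : 2 * h * t * A i ^+ 2 = \sum_j 2 * h * (D i j * E i j).
    rewrite (eq_bigr (fun j => 2 * h * t * A i * (u ord0 j * D i j))); last first.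
      by move=> j _; rewrite mxE; ring.
    by rewrite -mulr_sumr -/(A i) expr2 mulrA.
  by rewrite -big_split/=; apply: eq_bigr => j _; rewrite ME; ring.
by rewrite addr_ge0 ?fsq_ge0// !mulr_ge0 ?(ltW h0)// sumr_ge0// => i _; exact: sqr_ge0.
Qed.

(* Since h D = M - E and W = h (M + E), the form is
   mu (|M|^2 - |E|^2) + (lam + mu) ((tr M)^2 - (tr E)^2). *)
Lemma elastic_form_ge (lam mu c e : R) : 0 < mu ->
  c = (if 0 < lam + mu then mu - k ^+ 2 * (lam + 2 * mu)
       else lam + 2 * mu - k ^+ 2 * mu) ->
  e = (if 0 < lam + mu then 0 else lam + mu) ->
  c * fsq M + e * ((\tr M) ^+ 2 - fsq M) <=
  mu * (\sum_i \sum_j D i j * W i j) + (lam + mu) * \tr D * \tr W.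
Proof.
move=> mu0 -> ->.
have -> : \sum_i \sum_j D i j * W i j = fsq M - fsq E.
  rewrite /fsq -sumrB; apply: eq_bigr => i _; rewrite -sumrB; apply: eq_bigr => j _.
  by rewrite WE ME; ring.
have -> : (lam + mu) * \tr D * \tr W = (lam + mu) * ((\tr M) ^+ 2 - (\tr E) ^+ 2).
  by rewrite trM trW; ring.
have m0 := fsq_ge0 M; have x0 := sqr_ge0 (\tr M); have y0 := sqr_ge0 (\tr E).
have e0 := fsq_ge0 E; move: trE2 fsqE_le m0 x0 y0 e0.
move: (fsq M) (fsq E) ((\tr M) ^+ 2) ((\tr E) ^+ 2) (k ^+ 2) => m r x y q yr rq m0 x0 y0 r0.
(* For lam + mu > 0 the term (tr M)^2 is dropped and (tr E)^2 <= |E|^2 is used. Otherwise the term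
   in (tr E)^2 has the good sign and is dropped, while (tr M)^2 is kept on the left through e. *)
case: ltP => lm.
  have := ler_wpM2l (ltW lm) yr; have := mulr_ge0 (ltW lm) x0.
  have := ler_wpM2l (ltW mu0) rq; have := ler_wpM2l (ltW lm) rq; lra.
have := mulr_le0_ge0 lm y0; have := ler_wpM2l (ltW mu0) rq; lra.
Qed.

(** As W = h (M + E), Young's inequality with parameter eta leaves eta/2 (|M|^2 + |E|^2), and |E| <=
    |M| because k <= 1. *)
Lemma truncated_rhs_le (F : 'M[R]_N) (eta : R) : 0 < eta ->
  \sum_i \sum_j F i j * W i j <= eta^-1 * (h ^+ 2 * fsq F) + eta * fsq M.
Proof.
move=> eta0.
have H : \sum_i \sum_j F i j * W i j <= eta^-1 * (h ^+ 2 * fsq F) + eta / 2 * (fsq M + fsq E).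
  rewrite /fsq -big_split/= !mulr_sumr -big_split/=; apply: ler_sum => i _.
  rewrite -big_split/= !mulr_sumr -big_split/=; apply: ler_sum => j _.
  rewrite (_ : W i j = h * (M i j + E i j)); last by rewrite WE ME; ring.
  move: (F i j) (M i j) (E i j) => f x y.
  (* The gap in Young's inequality, written exactly as a sum of two squares. *)
  rewrite -subr_ge0 (_ : _ - _ = eta^-1 *
    ((2 * h * f - eta * (x + y)) ^+ 2 / 4 + (eta * (x - y)) ^+ 2 / 4)); last first.
    by field; rewrite gt_eqF.
  by rewrite mulr_ge0 ?invr_ge0 ?(ltW eta0)// addr_ge0// divr_ge0// sqr_ge0.
apply: le_trans H _; rewrite lerD2l -mulrA ler_wpM2l ?(ltW eta0)//.
have := fsqE_le; have := fsq_ge0 M.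
have : k ^+ 2 <= 1 by rewrite expr_le1.
by move: (fsq E) (fsq M) (k ^+ 2) => x y z z1 y0 xy; have := ler_wpM2r y0 z1; lra.
Qed.

End truncated_field.

End pointwise.

(** * Inequalities and limits for powers and for the cutoff *)

Section real_lemmas.
Variable R : realType.
Implicit Types (a b k s x : R).

(** Either the nonlinear term is at most x/2, whence x <= 2a, or x < 2b x^k, which bounds x^(1-k) by
    2b. *)
Lemma le_absorb x a b k : 0 <= x -> 0 <= a -> 0 <= b -> 0 <= k < 1 ->
  x <= a + b * x `^ k -> x <= 2 * a + (2 * b) `^ (1 - k)^-1.
Proof.
move=> x0 a0 b0 /andP[k0 k1] H.
have [Hle|Hlt] := leP (b * x `^ k) (x / 2).
  by have := powR_ge0 (2 * b) (1 - k)^-1; lra.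
have [x00|xn0] := eqVneq x 0.
  by rewrite x00 addr_ge0 ?powR_ge0// mulr_ge0.
have xgt : 0 < x by rewrite lt_neqAle eq_sym xn0.
have k1' : 0 < 1 - k by rewrite subr_gt0.
have xk : 0 < x `^ k by exact: powR_gt0.
have : x `^ (1 - k) <= 2 * b.
  rewrite -(ler_pM2r xk) -powRD; last by rewrite xn0 implybT.
  by rewrite subrK powRr1//; lra.
move=> /(ge0_ler_powR (r := (1 - k)^-1)) => /(_ _ _ _)/wrap[].
- by rewrite invr_ge0 ltW.
- by rewrite nnegrE powR_ge0.
- by rewrite nnegrE mulr_ge0.
rewrite -powRrM divff ?gt_eqF// powRr1// => Hx.
by rewrite (le_trans Hx)// lerDr mulr_ge0.
Qed.

(** Every term is compared with the largest one. *)
Lemma powR_sum_le n (f : 'I_n.+1 -> R) k : 0 <= k -> (forall i, 0 <= f i) ->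
  (\sum_i f i) `^ k <= n.+1%:R `^ k * \sum_i f i `^ k.
Proof.
move=> k0 f0; have [i _ Hi] := @Order.TotalTheory.arg_maxP _ _ _ (ord0 : 'I_n.+1) xpredT f isT.
apply: (@le_trans _ _ ((n.+1%:R * f i) `^ k)).
  rewrite ge0_ler_powR ?nnegrE ?sumr_ge0 ?mulr_ge0//.
  apply: le_trans (ler_sum _ (fun j _ => Hi j isT)) _.
  by rewrite sumr_const card_ord mulr_natl.
rewrite powRM// ler_wpM2l ?powR_ge0// (bigD1 i)//= lerDl sumr_ge0// => j _.
exact: powR_ge0.
Qed.

(** Covers the limit l = 0, which [cvgn_powR] excludes, by rewriting x^a as a power of x^2; it is
    needed at zeros of [u]. *)
Lemma cvgn_powR_ge0 a (u : nat -> R) (l : R) : 0 <= a -> (forall n, 0 <= u n) -> 0 <= l ->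
  u n @[n --> \oo] --> l -> u n `^ a @[n --> \oo] --> l `^ a.
Proof.
rewrite le_eqVlt => /predU1P[<- _ _ _|a0 u0 l0 ul].
  by rewrite powRr0; under eq_fun do rewrite powRr0; exact: cvg_cst.
have E x : 0 <= x -> x `^ a = (x ^+ 2) `^ (a / 2).
  by move=> x0; rewrite -powR_mulrn// -powRrM mulrC mulfVK.
rewrite E//; under eq_fun do rewrite E//.
apply: (@cvgn_comp R (fun t => (t ^+ 2) `^ (a / 2))) => //.
by apply: continuous_sqr_powR; rewrite divr_gt0.
Qed.

Lemma cutoff_cvg s : 0 <= s -> cutoff n.+1%:R s @[n --> \oo] --> s.
Proof.
move=> s0.
have H1 : (n.+1%:R + s)^-1 @[n --> \oo] --> (0 : R).
  apply: (@squeeze_cvgr _ _ _ _ (fun=> 0) (@harmonic R)).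
  - apply: nearW => n; rewrite invr_ge0 addr_ge0//=.
    by rewrite /harmonic /= lef_pV2 ?posrE ?lerDl// ltr_wpDr.
  - exact: cvg_cst.
  - exact: cvg_harmonic.
(* The cutoff in the form X(s) = s + (1 - s^2)/(nu + s), whose second term vanishes in the limit. *)
have : s + (1 - s ^+ 2) * (n.+1%:R + s)^-1 @[n --> \oo] --> s + (1 - s ^+ 2) * 0.
  by apply: cvgD; [exact: cvg_cst|exact: cvgn_mull].
rewrite mulr0 addr0; apply: cvg_trans; apply: near_eq_cvg; apply: nearW => n.
rewrite cutoffE ?ler1n//; have : 0 < n.+1%:R + s by rewrite ltr_wpDr.
by move: (n.+1%:R) => x x0; field; rewrite gt_eqF.
Qed.

Lemma cutoff_pow_cvg b s : 0 <= b -> 0 <= s ->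
  cutoff_pow n.+1%:R b s @[n --> \oo] --> s `^ b.
Proof.
move=> b0 s0; apply: cvgn_powR_ge0 => //; last exact: cutoff_cvg.
by move=> n; apply/ltW/cutoff_gt0; rewrite ?ler1n.
Qed.

(** A bound for the weight X^b where s <= 1/nu. For b = 0 the power would be 1 and would not tend to
    0, but then no error term is needed. *)
Definition cutoff_err nu b : R := if b == 0 then 0 else (2 / nu) `^ b.

Lemma cutoff_err_cvg b : 0 <= b -> cutoff_err n.+1%:R b @[n --> \oo] --> (0 : R).
Proof.
move=> b0; rewrite /cutoff_err; case: eqVneq => [_|bn0]; first exact: cvg_cst.
rewrite -(powR0 bn0); apply: cvgn_powR_ge0 => //.
have := cvgn_mull (k := 2) (@cvg_harmonic R); rewrite mulr0; exact.
Qed.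

Lemma cutoff_err_ge0 nu b : 0 <= cutoff_err nu b.
Proof. by rewrite /cutoff_err; case: ifP => // _; exact: powR_ge0. Qed.

(** If s <= 1/nu then X <= 2/nu, which is the error term. If s > 1/nu then X <= 2s, so X^b s >=
    X^(b+1)/2, and the power b/(b+1) gives X^b up to the factor 2^(b/(b+1)) <= 2. In the application
    X^b s is |V|^2. *)
Lemma cutoff_pow_le_err nu b s : 1 <= nu -> 0 <= b -> 0 <= s ->
  cutoff_pow nu b s <= cutoff_err nu b + 2 * (cutoff_pow nu b s * s) `^ (b / (b + 1)).
Proof.
move=> nu1 b0 s0; have nu0 : 0 < nu by exact: lt_le_trans nu1.
have ns : 0 < nu + s by rewrite ltr_wpDr.
rewrite /cutoff_err; case: eqVneq => [->|bn0].
  by rewrite mul0r powRr0 mulr1 add0r /cutoff_pow powRr0 ler1n.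
have X0 := cutoff_gt0 nu1 s0; have b1 : 0 < b + 1 by rewrite ltr_wpDl.
have [sle|slt] := leP s nu^-1.
  apply: ler_wpDr; first by rewrite mulr_ge0// powR_ge0.
  rewrite /cutoff_pow ge0_ler_powR ?nnegrE ?(ltW X0) ?divr_ge0 ?(ltW nu0)//.
  rewrite cutoffE//; apply: (@le_trans _ _ ((1 + nu * s) / nu)).
    rewrite ler_pM2l ?lef_pV2 ?posrE ?lerDl//.
    by rewrite ltr_wpDr// mulr_ge0// ltW.
  rewrite ler_pM2r ?invr_gt0//.
  by have := ler_wpM2l (ltW nu0) sle; rewrite divff ?gt_eqF//; lra.
apply: ler_wpDl; first exact: powR_ge0.
have X2 : cutoff nu s <= 2 * s.
  rewrite cutoffE// ler_pdivrMr//.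
  have : 1 <= nu * s.
    by rewrite -ler_pdivrMl// mulr1 ltW.
  have := mulr_ge0 s0 s0; lra.
have bb0 : 0 <= b / (b + 1) by rewrite divr_ge0// ltW.
apply: (@le_trans _ _ (2 * (cutoff_pow nu b s * (cutoff nu s / 2)) `^ (b / (b + 1)))); last first.
  rewrite ler_wpM2l// ge0_ler_powR ?nnegrE//.
  - by rewrite mulr_ge0 ?powR_ge0// divr_ge0// ltW.
  - by rewrite mulr_ge0 ?powR_ge0.
  - by rewrite ler_wpM2l ?powR_ge0// ler_pdivrMr// mulrC.
rewrite mulrA powRM ?mulr_ge0 ?powR_ge0 ?(ltW X0) ?invr_ge0//.
have -> : (cutoff_pow nu b s * cutoff nu s) `^ (b / (b + 1)) = cutoff_pow nu b s.
  rewrite /cutoff_pow -{2}(powRr1 (ltW X0)) -powRD; last by rewrite (gt_eqF X0) implybT.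
  by rewrite -powRrM mulrC mulfVK// gt_eqF.
rewrite mulrCA ler_peMr ?powR_ge0//.
have -> : (2^-1 : R) = 2 `^ (-1) by rewrite powR_inv1.
rewrite -powRrM mulN1r powRN -ler_pdivrMr ?invr_gt0 ?powR_gt0// invrK mul1r.
apply: (@le_trans _ _ (2 `^ 1)); last by rewrite powRr1.
by rewrite ler_powR ?ler1n// ler_pdivrMr// mul1r lerDl.
Qed.

Lemma cutoff_pow_half nu b s : 1 <= nu -> 0 <= s ->
  cutoff_pow nu (b / 2) s ^+ 2 = cutoff_pow nu b s.
Proof.
move=> nu1 s0; have X0 := cutoff_gt0 nu1 s0.
rewrite /cutoff_pow expr2 -powRD ?(gt_eqF X0) ?implybT//.
by congr powR; rewrite -splitr.
Qed.

Lemma cutoff_pow'_half nu b s : 1 <= nu -> 0 <= s ->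
  2 * cutoff_pow' nu b s =
  2 * cutoff_pow nu (b / 2) s * (2 * cutoff_pow' nu (b / 2) s).
Proof.
move=> nu1 s0; have X0 := cutoff_gt0 nu1 s0.
rewrite /cutoff_pow' /cutoff_pow.
have -> : cutoff nu s `^ (b - 1) = cutoff nu s `^ (b / 2) * cutoff nu s `^ (b / 2 - 1).
  rewrite -powRD ?(gt_eqF X0) ?implybT//.
  by congr powR; rewrite addrA -splitr.
by move: (_ `^ (b / 2)) (_ `^ (b / 2 - 1)) ((nu + s) `^ (-2)) => x y z; field.
Qed.

End real_lemmas.

(** * The weighted energy estimate *)

Section domain_lemmas.
Variables (R : realType) (N : nat) (Omega : set 'rV[R]_N).

Lemma bounded_leb_lty : bounded_set Omega -> measurable Omega -> (leb R N Omega < +oo)%E.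
Proof.
move=> [L [_ LO]] mO; apply: le_lt_trans (leb_box_lty N (`|L| + 1)).
apply: le_measure; rewrite ?inE//; first exact: measurable_box.
move=> x Ox i; have := LO (`|L| + 1) _ x Ox.
rewrite (le_lt_trans (ler_norm _)) ?ltrDl// => /(_ isT) xL.
by rewrite in_itv/= -ler_norml (le_trans (coord_le_norm x i)).
Qed.

Lemma L2_of_in_Lp q (f : 'rV[R]_N -> R) : 2 <= q -> measurable Omega ->
  (leb R N Omega < +oo)%E -> in_Lp Omega q f -> L2 (leb R N) Omega f.
Proof.
move=> q2 mO fO; rewrite in_LpP//; last by rewrite (lt_le_trans _ q2).
move=> [mf fin]; split => //; apply/integrableP; split.
  by apply/measurable_EFinP/measurable_funX.
have mq : measurable_fun Omega (fun x => `|f x| `^ q).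
  by apply: measurableT_comp (measurable_powR _) _; exact: measurableT_comp.
apply: (@le_lt_trans _ _ (\int[leb R N]_(x in Omega) ((fun=> 1%:E) x + (`|f x| `^ q)%:E))%E).
  apply: ge0_le_integral => //.
  - by apply: measurableT_comp => //; apply/measurable_EFinP/measurable_funX.
  - apply: emeasurable_funD; first exact: measurable_cst.
    exact/measurable_EFinP.
  - move=> x _; rewrite abse_EFin lee_fin ger0_norm ?sqr_ge0//.
    have [f1|f1] := leP `|f x| 1.
      apply: (@le_trans _ _ 1); last by rewrite lerDl powR_ge0.
      by rewrite -(real_normK (num_real (f x))) expr_le1.
    apply: (@le_trans _ _ (`|f x| `^ q)); last by rewrite lerDr.
    rewrite -(real_normK (num_real (f x))) -powR_mulrn//.
    by rewrite ler_powR// ltW.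
rewrite ge0_integralD//; last exact/measurable_EFinP.
by rewrite integral_cst// mul1e lte_add_pinfty.
Qed.

End domain_lemmas.

Section integrable_EFin.
Context d (T : measurableType d) (R : realType) (m : {measure set T -> \bar R}).
Context (D : set T) (mD : measurable D).
Implicit Types f g : T -> R.

Lemma integrable_add f g : m.-integrable D (EFin \o f) -> m.-integrable D (EFin \o g) ->
  m.-integrable D (EFin \o (fun x => f x + g x)).
Proof. by move=> If Ig; have := integrableD mD If Ig; apply: eq_integrable. Qed.

Lemma integrable_scale k f : m.-integrable D (EFin \o f) ->
  m.-integrable D (EFin \o (fun x => k * f x)).
Proof. by move=> If; have := integrableZl mD k If; apply: eq_integrable. Qed.

Lemma integrable_fsq (M N : nat) (G : T -> 'M[R]_(M, N)) :
  (forall i j, L2 m D (fun x => G x i j)) ->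
  m.-integrable D (EFin \o (fun x => fsq (G x))) /\
  \int[m]_(x in D) fsq (G x) = \sum_i \sum_j nrm2 m D (fun x => G x i j).
Proof.
move=> LG; have H i := Rintegral_sum (index_enum 'I_N) mD (fun j => (LG i j).2).
have [I1 E1] := Rintegral_sum (index_enum 'I_M) mD (fun i => (H i).1).
by split => //; rewrite E1; apply: eq_bigr => i _; exact: (H i).2.
Qed.

Lemma integrable_dot (M N : nat) (G H : T -> 'M[R]_(M, N)) :
  (forall i j, L2 m D (fun x => G x i j)) -> (forall i j, L2 m D (fun x => H x i j)) ->
  m.-integrable D (EFin \o (fun x => \sum_i \sum_j G x i j * H x i j)).
Proof.
move=> LG LH.
have I1 i := Rintegral_sum (index_enum 'I_N) mD (fun j => L2M mD (LG i j) (LH i j)).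
by have [] := Rintegral_sum (index_enum 'I_M) mD (fun i => (I1 i).1).
Qed.

End integrable_EFin.

Section energy.
Variables (R : realType) (n : nat) (Omega : set 'rV[R]_n.+3).
Hypotheses (mO : measurable Omega).
Variables (lam mu p : R).
Hypotheses (mu0 : 0 < mu) (p2 : 2 <= p).

Let N := n.+3.
Let lebN := leb R N.
Let beta := (p - 2) / 2.
Let kap := 1 - 2 / p.

(** The coercivity constant of the form. That it is positive is the hypothesis on p with the
    denominator cleared. *)
Definition elastic_gap := if 0 < lam + mu then mu - kap ^+ 2 * (lam + 2 * mu)
           else lam + 2 * mu - kap ^+ 2 * mu.
Hypothesis gap0 : 0 < elastic_gap.

Let p0 : 0 < p. Proof. exact: lt_le_trans p2. Qed.
Let beta0 : 0 <= beta. Proof. by rewrite divr_ge0// subr_ge0. Qed.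
Let kap0 : 0 <= kap. Proof. by rewrite /kap subr_ge0 ler_pdivrMr// mul1r. Qed.
Let kap1 : kap < 1. Proof. by rewrite /kap ltrBlDr ltrDl divr_gt0. Qed.

Variables (F : 'rV[R]_N -> 'M[R]_N) (u : 'rV[R]_N -> 'rV[R]_N) (Du : 'rV[R]_N -> 'M[R]_N).
Hypothesis LF : forall i j, L2 lebN Omega (fun x => F x i j).
Hypothesis sol : dirichlet_solution Omega lam mu F u Du.

Section truncated.
Variables (nu : R) (nu1 : 1 <= nu).

Let theta x := cutoff_pow nu beta (sqn (u x)).
Let V := trunc_vec nu (beta / 2) u.
Let M := trunc_mx nu (beta / 2) u Du.
Let W := trunc_mx nu beta u Du.

Definition trunc_energy := \sum_i \sum_j nrm2 lebN Omega (fun x => M x i j).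

Lemma trunc_energy_ge0 : 0 <= trunc_energy.
Proof. by apply: sumr_ge0 => i _; apply: sumr_ge0 => j _; exact: nrm2_ge0. Qed.

Let b20 : 0 <= beta / 2. Proof. exact: divr_ge0. Qed.
Let HV : in_H10_vec Omega V M. Proof. exact: (in_H10_vec_trunc nu1 b20 mO sol.1). Qed.
Let HW : in_H10_vec Omega (trunc_vec nu beta u) W.
Proof. exact: (in_H10_vec_trunc nu1 beta0 mO sol.1). Qed.

Let LD i j : L2 lebN Omega (fun x => Du x i j).
Proof. by have [_ + _] := in_H10_vec_seq mO sol.1; apply. Qed.
Let Lu j : L2 lebN Omega (fun x => u x ord0 j).
Proof. by have [+ _ _] := in_H10_vec_seq mO sol.1; apply. Qed.
Let LM i j : L2 lebN Omega (fun x => M x i j).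
Proof. by have [_ + _] := in_H10_vec_seq mO HV; apply. Qed.
Let LW i j : L2 lebN Omega (fun x => W x i j).
Proof. by have [_ + _] := in_H10_vec_seq mO HW; apply. Qed.

Let h x := cutoff_pow nu (beta / 2) (sqn (u x)).
Let t x := 2 * cutoff_pow' nu (beta / 2) (sqn (u x)).

Let h0 x : 0 < h x. Proof. by rewrite cutoff_pow_gt0// sqn_ge0. Qed.
Let t0 x : 0 <= t x. Proof. by rewrite mulr_ge0// cutoff_pow'_ge0. Qed.
Let h2 x : h x ^+ 2 = theta x.
Proof. by rewrite /h cutoff_pow_half// sqn_ge0. Qed.

(** From s X'(s) <= X(s) one gets t |u|^2 <= beta h, and beta (1 - kap) = kap. This is where the
    number 1 - 2/p arises. *)
Let tk x : t x * sqn (u x) * (1 - kap) <= kap * h x.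
Proof.
have H : t x * sqn (u x) <= beta * h x.
  have aux (c d s : R) : c * s <= beta / 2 * d -> 2 * c * s <= beta * d by lra.
  exact: aux (cutoff_pow'_le nu1 b20 (sqn_ge0 (u x))).
have k1 : 0 <= 1 - kap by rewrite subr_ge0 ltW.
apply: le_trans (ler_wpM2r k1 H) _.
rewrite mulrAC ler_wpM2r ?(ltW (h0 x))// /beta /kap le_eqVlt; apply/orP; left; apply/eqP.
by field; rewrite gt_eqF.
Qed.

Let WE x : W x = \matrix_(i, j) (h x ^+ 2 * Du x i j +
   2 * h x * t x * (\sum_l u x ord0 l * Du x i l) * u x ord0 j).
Proof.
apply/matrixP => i j; rewrite !mxE h2 /theta /h /t.
by rewrite (cutoff_pow'_half beta nu1 (sqn_ge0 (u x))).
Qed.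

Let mtheta : measurable_fun Omega theta.
Proof.
apply: measurableT_comp (measurable_cutoff_pow _ _) _.
by apply: measurable_sum => j; apply: measurable_funX; exact: (Lu j).1.
Qed.

Let theta0 x : 0 <= theta x.
Proof. by apply/ltW; rewrite cutoff_pow_gt0// sqn_ge0. Qed.

Let theta_le x : theta x <= nu `^ beta.
Proof. by rewrite cutoff_pow_le// sqn_ge0. Qed.

Let IF : lebN.-integrable Omega (EFin \o (fun x => fsq (F x))).
Proof. exact: (integrable_fsq mO LF).1. Qed.

Let IthF : lebN.-integrable Omega (EFin \o (fun x => theta x * fsq (F x))).
Proof.
have := integrable_scale mO (nu `^ beta) IF; apply: le_integrable => //.
  apply/measurable_EFinP/measurable_funM => //.
  by have /integrableP[/measurable_EFinP] := IF.
move=> x _ /=; rewrite lee_fin !ger0_norm ?mulr_ge0 ?powR_ge0 ?fsq_ge0//.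
by rewrite ler_wpM2r ?fsq_ge0.
Qed.

(** With Young's parameter c/2, where c is the gap, half of the coercive term absorbs the energy
    produced by F. What remains is c/2 X <= 2/c Y, hence the constant 4/c^2. *)
Lemma trunc_energy_le : trunc_energy <=
  4 / elastic_gap ^+ 2 * \int[lebN]_(x in Omega) (theta x * fsq (F x)).
Proof.
(* For lam + mu <= 0 the divergence is kept until after integration, since (tr M)^2 is bounded by
   |M|^2 with constant 1 only in the integrated form [S2]. *)
pose e := if 0 < lam + mu then 0 else lam + mu.
have e0 : e <= 0 by rewrite /e; case: ltP.
have [IM EM] := integrable_fsq mO LM.
have LT : L2 lebN Omega (fun x => \tr (M x)) by exact: (L2_sum mO (index_enum 'I_N) (fun i => LM i i)).
have LTD : L2 lebN Omega (fun x => \tr (Du x)) by exact: (L2_sum mO (index_enum 'I_N) (fun i => LD i i)).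
have LTW : L2 lebN Omega (fun x => \tr (W x)) by exact: (L2_sum mO (index_enum 'I_N) (fun i => LW i i)).
have IT : lebN.-integrable Omega (EFin \o (fun x => (\tr (M x)) ^+ 2)) by exact: LT.2.
have INM : lebN.-integrable Omega (EFin \o (fun x => -1 * fsq (M x))).
  exact: integrable_scale.
have Iform : lebN.-integrable Omega (EFin \o (fun x =>
    mu * (\sum_i \sum_j Du x i j * W x i j) + (lam + mu) * \tr (Du x) * \tr (W x))).
  apply: integrable_add => //; first by apply: integrable_scale => //; exact: integrable_dot.
  have := integrable_scale mO (lam + mu) (L2M mO LTD LTW); apply: eq_integrable => //.
  by move=> x _; rewrite /= mulrA.
have IFW : lebN.-integrable Omega (EFin \o (fun x => \sum_i \sum_j F x i j * W x i j)).
  exact: integrable_dot.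
set c := elastic_gap.
set X := trunc_energy; set Y := \int[lebN]_(x in Omega) (theta x * fsq (F x)).
have S1 : c * X + e * (nrm2 lebN Omega (fun x => \tr (M x)) + -1 * X) <=
    \int[lebN]_(x in Omega) (mu * (\sum_i \sum_j Du x i j * W x i j) +
      (lam + mu) * \tr (Du x) * \tr (W x)).
  rewrite /X /trunc_energy -EM /nrm2 -[-1 * _]RintegralZl// -[X in e * X]RintegralD//.
  have IE := integrable_scale mO e (integrable_add mO IT INM).
  rewrite -!RintegralZl//; last exact: (integrable_add mO IT INM).
  rewrite -RintegralD//; last exact: integrable_scale.
  apply: le_Rintegral => //; first by apply: integrable_add => //; exact: integrable_scale.
  move=> x _; rewrite WE mulN1r.
  exact: (@elastic_form_ge _ _ _ _ _ (u x) (Du x) (h0 x) (t0 x) kap0 (tk x) lam mu c e mu0 erefl erefl).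
have S2 : nrm2 lebN Omega (fun x => \tr (M x)) <= X by have := in_H10_vec_div mO HV; exact.
have S3 : \int[lebN]_(x in Omega) (\sum_i \sum_j F x i j * W x i j) <=
    (c / 2)^-1 * Y + c / 2 * X.
  rewrite /X /trunc_energy -EM /Y -!RintegralZl// -RintegralD//; last 2 first.
  - exact: integrable_scale.
  - exact: integrable_scale.
  apply: le_Rintegral => //.
    by apply: integrable_add => //; exact: integrable_scale.
  move=> x _; rewrite WE -h2.
  have c2 : 0 < c / 2 by rewrite divr_gt0.
  exact: (@truncated_rhs_le _ _ _ _ _ (u x) (Du x) (h0 x) (t0 x) kap0 (ltW kap1) (tk x) (F x) _ c2).
move: S1; rewrite (sol.2 _ _ HW) => S1; have S4 := le_trans S1 S3.
have {}S4 : c / 2 * X <= 2 / c * Y.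
  (* By e <= 0 and [S2] the divergence contribution on the left of [S1] is nonnegative and may be
     discarded. *)
  have := mulr_le0_ge0 e0 (_ : 0 <= X - nrm2 lebN Omega (fun x => \tr (M x))).
  rewrite subr_ge0 => /(_ S2).
  move: S4; rewrite invfM invrK (mulrC c^-1).
  by move: (nrm2 _ _ _) => z; lra.
have c0 : 0 < c := gap0.
rewrite -(@ler_pM2l _ (c / 2)) ?divr_gt0//; apply: le_trans S4 _.
rewrite le_eqVlt; apply/orP; left; apply/eqP.
have aux (a y : R) : 0 < a -> 2 / a * y = a / 2 * (4 / a ^+ 2 * y).
  by move=> a0; field; rewrite gt_eqF.
exact: aux.
Qed.

Lemma le_trunc_energy : (\int[lebN]_(x in Omega) (theta x * fsq (Du x))%:E <= trunc_energy%:E)%E.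
Proof.
have [IM EM] := integrable_fsq mO LM.
rewrite /trunc_energy -EM fineK; last exact: integrable_fin_num.
have /integrableP[/measurable_EFinP mD _] := (integrable_fsq mO LD).1.
apply: ge0_le_integral => //.
- by move=> x _; rewrite lee_fin mulr_ge0// fsq_ge0.
- by apply/measurable_EFinP/measurable_funM.
- by case/integrableP : IM.
- move=> x _; rewrite lee_fin -h2.
  exact: (@fsq_truncated _ _ (h x) (t x) (u x) (Du x) (h0 x) (t0 x)).
Qed.

End truncated.
End energy.

Section sobolev_vector.
Variable R : realType.

(** The scalar inequality for each component; passing to |V|^2 and summing costs only factors
    depending on N, collected in K. *)
Lemma sobolev_H10_vec n : exists2 K : R, 0 <= K & forall (Omega : set 'rV[R]_n.+3)
    (V : 'rV[R]_n.+3 -> 'rV[R]_n.+3) (M : 'rV[R]_n.+3 -> 'M[R]_n.+3),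
  measurable Omega -> in_H10_vec Omega V M ->
  (\int[leb R n.+3]_(x in Omega) (sqn (V x) `^ (n.+3%:R / n.+1%:R))%:E <=
   (K * (\sum_i \sum_j nrm2 (leb R n.+3) Omega (fun x => M x i j)) `^ (n.+3%:R / n.+1%:R))%:E)%E.
Proof.
have [S S0 HS] := sobolev_H10 R n.
set k : R := n.+3%:R / n.+1%:R.
have k0 : 0 < k by rewrite divr_gt0.
exists (n.+3%:R `^ k * (n.+3%:R * S `^ k)); first by rewrite !mulr_ge0 ?powR_ge0.
move=> Omega V M mO HV; set X := \sum_i _.
have nn i j : 0 <= nrm2 (leb R n.+3) Omega (fun x => M x i j) by exact: nrm2_ge0.
have [LV LM _] := in_H10_vec_seq mO HV.
have X0 : 0 <= X by apply: sumr_ge0 => i _; exact: sumr_ge0.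
have Hj j : (\int[leb R n.+3]_(x in Omega) ((V x ord0 j ^+ 2) `^ k)%:E <= (S `^ k * X `^ k)%:E)%E.
  have := HS Omega _ _ mO (HV j); rewrite -/k.
  move=> /(gt0_ler_poweR (ltW k0)) => /(_ _ _)/wrap[].
  - by rewrite in_itv/= leey poweR_ge0.
  - by rewrite in_itv/= leey lee_fin mulr_ge0// sumr_ge0// => i _; exact: nrm2_ge0.
  rewrite -poweRrM (_ : _ * k = 1); last first.
    by rewrite /k mulrA mulfVK ?divff ?pnatr_eq0.
  rewrite poweRe1; last by apply: integral_ge0 => x _; rewrite lee_fin powR_ge0.
  move=> H; apply: (le_trans H); rewrite poweR_EFin lee_fin -powRM//.
  rewrite ge0_ler_powR ?nnegrE ?(ltW k0) ?mulr_ge0// ?sumr_ge0//.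
  rewrite ler_wpM2l// /X; apply: ler_sum => i _.
  by rewrite (bigD1 j)//= lerDl sumr_ge0.
have mV j : measurable_fun Omega (fun x => (V x ord0 j ^+ 2) `^ k).
  by apply: measurableT_comp (measurable_powR _) _; apply: measurable_funX; exact: (LV j).1.
apply: (@le_trans _ _ (\int[leb R n.+3]_(x in Omega)
    ((n.+3%:R `^ k)%:E * \sum_j ((V x ord0 j ^+ 2) `^ k)%:E))%E).
  apply: ge0_le_integral => //.
  - by move=> x _; rewrite lee_fin powR_ge0.
  - apply/measurable_EFinP; apply: measurableT_comp (measurable_powR _) _.
    by apply: measurable_sum => j; apply: measurable_funX; exact: (LV j).1.
  - apply: emeasurable_funM; first exact: measurable_cst.
    by apply: emeasurable_sum => j; exact/measurable_EFinP.
  - move=> x _; rewrite sumEFin -EFinM lee_fin.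
    by apply: powR_sum_le (ltW k0) _ => j; exact: sqr_ge0.
rewrite ge0_integralZl//; try (by rewrite lee_fin powR_ge0);
  try (by apply: emeasurable_sum => j; exact/measurable_EFinP);
  try (by move=> x _; apply: sume_ge0 => j _; rewrite lee_fin powR_ge0).
rewrite -mulrA EFinM; apply: lee_wpmul2l; first by rewrite lee_fin powR_ge0.
rewrite ge0_integral_sum//; try (by move=> j; exact/measurable_EFinP);
  try (by move=> j x _; rewrite lee_fin powR_ge0).
apply: le_trans (lee_sum _ (fun j _ => Hj j)) _.
by rewrite sumEFin sumr_const card_ord -mulrA mulr_natl.
Qed.

End sobolev_vector.

(** * Arithmetic of the exponents *)

Section exponents.
Variables (R : realType) (n : nat) (p : R).
Hypothesis p2 : 2 <= p.

Definition dual_exponent := n.+3%:R * p / (n.+3%:R + p - 2).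

(** Here x is N - 2. The second identity makes Hoelder's inequality between |F|^q and |V|^(2N/(N-2))
    produce the power kap of |V|^2; the third gives the power of the integral of |F|^q after
    absorption. *)
Let exponent_identities (x : R) : 0 < x -> let q := (x + 2) * p / (x + 2 + p - 2) in
  [/\ 2 <= q, (x + 2) / x * (1 - 2 / q) = 1 - 2 / p &
      2 / q * (1 - (1 - 2 / p))^-1 = (x + 2 + p - 2) / (x + 2)].
Proof.
move=> x0 q; have p0 : 0 < p by exact: lt_le_trans p2.
have d0 : 0 < x + 2 + p - 2 by lra.
have y0 : 0 < x + 2 by lra.
have xp : 0 < x + p by lra.
have Hx : 0 <= x * (p - 2) by rewrite mulr_ge0 ?(ltW x0)// subr_ge0.
split; rewrite /q.
- by rewrite ler_pdivlMr//; lra.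
- by field; rewrite !gt_eqF.
- have pp : p - (p - 2) != 0 by rewrite subKr.
  by field; rewrite pp !gt_eqF.
Qed.

Let n3 : n.+3%:R = n.+1%:R + 2 :> R. Proof. by rewrite -natrD addn2. Qed.
Let n1 : 0 < n.+1%:R :> R. Proof. by rewrite ltr0n. Qed.

Lemma dual_exponent_ge2 : 2 <= dual_exponent.
Proof. by rewrite /dual_exponent n3; have [] := exponent_identities n1. Qed.

Lemma dual_exponent_conj : n.+3%:R / n.+1%:R * (1 - 2 / dual_exponent) = 1 - 2 / p.
Proof. by rewrite /dual_exponent n3; have [] := exponent_identities n1. Qed.

Lemma dual_exponent_final :
  2 / dual_exponent * (1 - (1 - 2 / p))^-1 = (n.+3%:R + p - 2) / n.+3%:R.
Proof. by rewrite /dual_exponent n3; have [] := exponent_identities n1. Qed.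

End exponents.

(** * Absorption and passage to the limit *)

Section main_estimate.
Variables (R : realType) (n : nat) (Omega : set 'rV[R]_n.+3).
Hypotheses (mO : measurable Omega).
Variables (lam mu p K : R).
Hypotheses (mu0 : 0 < mu) (p2 : 2 <= p) (gap0 : 0 < elastic_gap lam mu p) (K0 : 0 <= K).
Hypothesis HK : forall (V : 'rV[R]_n.+3 -> 'rV[R]_n.+3) (M : 'rV[R]_n.+3 -> 'M[R]_n.+3),
  in_H10_vec Omega V M ->
  (\int[leb R n.+3]_(x in Omega) (sqn (V x) `^ (n.+3%:R / n.+1%:R))%:E <=
   (K * (\sum_i \sum_j nrm2 (leb R n.+3) Omega (fun x => M x i j)) `^ (n.+3%:R / n.+1%:R))%:E)%E.

Local Notation lebN := (leb R n.+3).
Let q := dual_exponent n p.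
Let k : R := n.+3%:R / n.+1%:R.
Let kap := 1 - 2 / p.

(** The term (2b)^(1/(1-k)) of [le_absorb] with the power of the integral of |F|^q taken out. It
    involves neither nu nor F nor [u]. *)
Definition estimate_constant :=
  (2 * (4 / elastic_gap lam mu p ^+ 2 * (2 * K `^ (1 - 2 / q)))) `^ (1 - kap)^-1.

Variables (F : 'rV[R]_n.+3 -> 'M[R]_n.+3) (u : 'rV[R]_n.+3 -> 'rV[R]_n.+3)
  (Du : 'rV[R]_n.+3 -> 'M[R]_n.+3).
Hypothesis LF : forall i j, L2 lebN Omega (fun x => F x i j).
Hypothesis sol : dirichlet_solution Omega lam mu F u Du.

Let A := fine (\int[lebN]_(x in Omega) (fsq (F x) `^ (q / 2))%:E)%E.
Hypothesis AE : (\int[lebN]_(x in Omega) (fsq (F x) `^ (q / 2))%:E = A%:E)%E.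

Let B := \int[lebN]_(x in Omega) fsq (F x).
Let beta := (p - 2) / 2.
Let p0 : 0 < p. Proof. exact: lt_le_trans p2. Qed.
Let beta0 : 0 <= beta. Proof. by rewrite divr_ge0// subr_ge0. Qed.
Let kap0 : 0 <= kap. Proof. by rewrite /kap subr_ge0 ler_pdivrMr// mul1r. Qed.
Let kap1 : kap < 1. Proof. by rewrite /kap ltrBlDr ltrDl divr_gt0. Qed.
Let kapE : kap = beta / (beta + 1).
Proof.
have b1 : 0 < beta + 1 by rewrite ltr_wpDl.
by move: b1 p0; rewrite /kap /beta => b1 pp; field; rewrite !gt_eqF//; lra.
Qed.

Let A0 : 0 <= A.
Proof. by rewrite -lee_fin -AE; apply: integral_ge0 => x _; rewrite lee_fin powR_ge0. Qed.

Let B0 : 0 <= B.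
Proof. by apply: Rintegral_ge0 => x _; exact: fsq_ge0. Qed.

(** The weight in [trunc_energy_le] is bounded by the error plus 2 |V|^(2 kap). Hoelder and Sobolev
    then bound the right-hand side by the energy to the power kap < 1, and [le_absorb] applies. *)
Lemma trunc_energy_bound nu : 1 <= nu ->
  trunc_energy Omega p u Du nu <=
  2 * (4 / elastic_gap lam mu p ^+ 2 * (cutoff_err nu beta * B)) +
  estimate_constant * A `^ ((n.+3%:R + p - 2) / n.+3%:R).
Proof.
move=> nu1; set X := trunc_energy _ _ _ _ _.
have X0 : 0 <= X by exact: trunc_energy_ge0.
set c := 4 / _; have c0 : 0 <= c by rewrite divr_ge0// sqr_ge0.
set d := cutoff_err nu beta; have d0 : 0 <= d by exact: cutoff_err_ge0.
(* The weight on |F|^q that leaves |F|^2; by [ka] the complementary weight turns |V|^(2k) into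
   |V|^(2 kap). *)
pose a := 2 / q.
have q2 : 2 <= q by exact: dual_exponent_ge2.
have q0 : 0 < q by exact: lt_le_trans q2.
have a01 : 0 < a <= 1 by rewrite divr_gt0//= ler_pdivrMr// mul1r.
have ka : k * (1 - a) = kap by exact: dual_exponent_conj.
have b20 : 0 <= beta / 2 by exact: divr_ge0.
have HV := in_H10_vec_trunc nu1 b20 mO sol.1.
pose V := trunc_vec nu (beta / 2) u.
have VE x : sqn (V x) = cutoff_pow nu beta (sqn (u x)) * sqn (u x).
  rewrite -(cutoff_pow_half _ nu1 (sqn_ge0 (u x))) /sqn mulr_sumr.
  by apply: eq_bigr => j _; rewrite mxE exprMn.
have [IF _] := integrable_fsq mO LF.
have mF : measurable_fun Omega (fun x => fsq (F x)).
  by have /integrableP[/measurable_EFinP] := IF.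
have [LV _ _] := in_H10_vec_seq mO HV.
have [Lu _ _] := in_H10_vec_seq mO sol.1.
have mV : measurable_fun Omega (fun x => sqn (V x)).
  by apply: measurable_sum => j; apply: measurable_funX; exact: (LV j).1.
have mth : measurable_fun Omega (fun x => cutoff_pow nu beta (sqn (u x))).
  apply: measurableT_comp (measurable_cutoff_pow _ _) _.
  by apply: measurable_sum => j; apply: measurable_funX; exact: (Lu j).1.
have th0 x : 0 <= cutoff_pow nu beta (sqn (u x)).
  by apply/ltW; rewrite cutoff_pow_gt0// sqn_ge0.
have V0 x : 0 <= sqn (V x) by exact: sqn_ge0.
have H1 : (\int[lebN]_(x in Omega) (fsq (F x) * sqn (V x) `^ kap)%:E <=
    (A `^ a * (K `^ (1 - a) * X `^ kap))%:E)%E.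
  have mf : measurable_fun Omega (fun x => fsq (F x) `^ (q / 2)).
    exact: measurableT_comp (measurable_powR _) mF.
  have mg : measurable_fun Omega (fun x => sqn (V x) `^ k).
    exact: measurableT_comp (measurable_powR _) mV.
  have := hoelder_interpolation (leb R n.+3) mO mf mg (fun x _ => powR_ge0 _ _) (fun x _ => powR_ge0 _ _) a01.
  have qa : q / 2 * a = 1 by rewrite /a mulrA mulfVK ?divff ?gt_eqF.
  have E x : (fsq (F x) `^ (q / 2)) `^ a * (sqn (V x) `^ k) `^ (1 - a) = fsq (F x) * sqn (V x) `^ kap.
    by rewrite -!powRrM ka qa powRr1 ?fsq_ge0.
  under eq_integral do rewrite E.
  move/le_trans; apply; rewrite AE [leRHS]EFinM poweR_EFin.
  apply: lee_wpmul2l; first by rewrite lee_fin powR_ge0.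
  have a1 : 0 <= 1 - a by case/andP : a01 => _ ?; rewrite subr_ge0.
  have := gt0_ler_poweR a1 _ _ (HK HV) => /(_ _ _)/wrap[].
  - by rewrite in_itv/= leey andbT; apply: integral_ge0 => x _; rewrite lee_fin powR_ge0.
  - by rewrite in_itv/= leey lee_fin mulr_ge0// powR_ge0.
  move/le_trans; apply; rewrite poweR_EFin lee_fin powRM ?powR_ge0//.
  by rewrite -powRrM ka.
have H2 : \int[lebN]_(x in Omega) (cutoff_pow nu beta (sqn (u x)) * fsq (F x)) <=
    d * B + 2 * (A `^ a * (K `^ (1 - a) * X `^ kap)).
  rewrite -lee_fin fineK; last first.
    have nub : forall x, Omega x -> cutoff_pow nu beta (sqn (u x)) <= nu `^ beta.
      by move=> x _; rewrite cutoff_pow_le// sqn_ge0.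
    apply: integrable_fin_num => //.
    have := integrable_scale mO (nu `^ beta) IF; apply: le_integrable => //.
      by apply/measurable_EFinP/measurable_funM.
    move=> x Ox /=; rewrite lee_fin !ger0_norm ?mulr_ge0 ?powR_ge0 ?fsq_ge0//.
    by rewrite ler_wpM2r ?fsq_ge0// nub.
  have mP : measurable_fun Omega (fun x => fsq (F x) * sqn (V x) `^ kap).
    by apply: measurable_funM => //; exact: measurableT_comp (measurable_powR _) mV.
  apply: (@le_trans _ _ (\int[lebN]_(x in Omega) (d%:E * (fsq (F x))%:E +
     2%:E * (fsq (F x) * sqn (V x) `^ kap)%:E))%E).
    apply: ge0_le_integral => //.
    - by move=> x _; rewrite lee_fin mulr_ge0// fsq_ge0.
    - exact/measurable_EFinP/measurable_funM.
    - apply: emeasurable_funD; apply: emeasurable_funM => //; exact/measurable_EFinP.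
    - move=> x _; rewrite -!EFinM -EFinD lee_fin VE kapE.
      have aux (y f : R) : d * f + 2 * (f * y) = (d + 2 * y) * f by ring.
      by rewrite aux; exact: (ler_wpM2r (fsq_ge0 (F x)) (cutoff_pow_le_err nu1 beta0 (sqn_ge0 (u x)))).
  rewrite ge0_integralD//; last 4 first.
  - by move=> x _; rewrite mule_ge0// lee_fin fsq_ge0.
  - by apply: emeasurable_funM => //; exact/measurable_EFinP.
  - by move=> x _; rewrite mule_ge0// lee_fin mulr_ge0 ?fsq_ge0// powR_ge0.
  - by apply: emeasurable_funM => //; exact/measurable_EFinP.
  rewrite !ge0_integralZl//; try (by exact/measurable_EFinP);
    try (by move=> x _; rewrite lee_fin ?mulr_ge0 ?fsq_ge0 ?powR_ge0).
  rewrite [leRHS]EFinD; apply: leeD.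
    by rewrite EFinM /B fineK//; exact: integrable_fin_num.
  by rewrite [leRHS]EFinM; apply: lee_wpmul2l.
have H3 : X <= c * (d * B) + (c * (2 * K `^ (1 - a)) * A `^ a) * X `^ kap.
  apply: (le_trans (trunc_energy_le mO mu0 p2 gap0 LF sol nu1)); rewrite -/c.
  apply: (le_trans (ler_wpM2l c0 H2)); rewrite mulrDr lerD2l.
  have aux (x y z : R) : c * (2 * (x * (y * z))) = c * (2 * y) * x * z by ring.
  by rewrite aux.
have K2 : 0 <= c * (2 * K `^ (1 - a)) by apply: mulr_ge0 c0 _; rewrite mulr_ge0// powR_ge0.
have kap01 : 0 <= kap < 1 by rewrite kap0.
have := le_absorb X0 (mulr_ge0 c0 (mulr_ge0 d0 B0)) (mulr_ge0 K2 (powR_ge0 A a)) kap01 H3.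
move/le_trans; apply; rewrite lerD2l mulrA powRM ?powR_ge0//; last exact: mulr_ge0.
rewrite /estimate_constant -/c -/a -powRrM.
by rewrite /a dual_exponent_final.
Qed.

(** Fatou along nu = m + 1: the weights converge pointwise to |u|^(p-2), and the error term vanishes
    because B does not depend on nu. *)
Lemma weighted_gradient_bound :
  (\int[lebN]_(x in Omega) (fsq (Du x) * sqn (u x) `^ beta)%:E <=
   (estimate_constant * A `^ ((n.+3%:R + p - 2) / n.+3%:R))%:E)%E.
Proof.
set C := estimate_constant * _.
have [Lu LD _] := in_H10_vec_seq mO sol.1.
have mD : measurable_fun Omega (fun x => fsq (Du x)).
  by have /integrableP[/measurable_EFinP] := (integrable_fsq mO LD).1.
have mu' : measurable_fun Omega (fun x => sqn (u x)).
  by apply: measurable_sum => j; apply: measurable_funX; exact: (Lu j).1.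
apply/lee_addgt0Pr => e e0.
have cE : 2 * (4 / elastic_gap lam mu p ^+ 2 * (cutoff_err m.+1%:R beta * B)) @[m --> \oo] --> (0 : R).
  have -> : 0 = 2 * (4 / elastic_gap lam mu p ^+ 2 * (0 * B)) by rewrite mul0r !mulr0.
  apply: cvgn_mull; apply: cvgn_mull; apply: cvgn_mul; last exact: cvg_cst.
  exact: cutoff_err_cvg.
rewrite -EFinD.
apply: (fatou_le mO (f_ := fun m x => fsq (Du x) * cutoff_pow m.+1%:R beta (sqn (u x)))).
- move=> m; apply: measurable_funM => //.
  exact: measurableT_comp (measurable_cutoff_pow _ _) mu'.
- by apply: measurable_funM => //; exact: measurableT_comp (measurable_powR _) mu'.
- by move=> m x _; rewrite mulr_ge0 ?fsq_ge0// powR_ge0.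
- by move=> x _; rewrite mulr_ge0 ?fsq_ge0// powR_ge0.
- apply: nearW => x _; apply: cvgn_mull; apply: cutoff_pow_cvg => //.
  exact: sqn_ge0.
- move/cvgrPdist_lt : cE => /(_ _ e0); apply: filterS => m.
  rewrite sub0r normrN => /(le_lt_trans (ler_norm _)) Hm.
  under eq_integral do rewrite mulrC.
  apply: le_trans (le_trunc_energy mO p2 sol _) _; first by rewrite ler1n.
  rewrite lee_fin; apply: le_trans (trunc_energy_bound _) _; first by rewrite ler1n.
  by rewrite addrC lerD2l ltW.
Qed.

(** Sobolev's inequality for V together with the uniform energy bound. As nu grows, |V|^2 = X^beta
    |u|^2 tends to |u|^p since beta + 1 = p/2, and Fatou transfers the bound to [u]. *)
Lemma solution_integrability :
  (\int[lebN]_(x in Omega) (sqn (u x) `^ (p / 2 * k))%:E < +oo)%E.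
Proof.
set C := estimate_constant * A `^ ((n.+3%:R + p - 2) / n.+3%:R).
have C0 : 0 <= C by rewrite mulr_ge0 ?powR_ge0.
have [Lu LD _] := in_H10_vec_seq mO sol.1.
have k0 : 0 <= k by rewrite divr_ge0.
have mu' : measurable_fun Omega (fun x => sqn (u x)).
  by apply: measurable_sum => j; apply: measurable_funX; exact: (Lu j).1.
have b20 : 0 <= beta / 2 by exact: divr_ge0.
have cE : 2 * (4 / elastic_gap lam mu p ^+ 2 * (cutoff_err m.+1%:R beta * B)) @[m --> \oo] --> (0 : R).
  have -> : 0 = 2 * (4 / elastic_gap lam mu p ^+ 2 * (0 * B)) by rewrite mul0r !mulr0.
  apply: cvgn_mull; apply: cvgn_mull; apply: cvgn_mul; last exact: cvg_cst.
  exact: cutoff_err_cvg.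
apply: (@le_lt_trans _ _ (K * (1 + C) `^ k)%:E); last by rewrite ltry.
have n1 m : 1 <= m.+1%:R :> R by rewrite ler1n.
have VE m x : sqn (trunc_vec m.+1%:R (beta / 2) u x) = cutoff_pow m.+1%:R beta (sqn (u x)) * sqn (u x).
  rewrite -(cutoff_pow_half _ (n1 m) (sqn_ge0 (u x))) /sqn mulr_sumr.
  by apply: eq_bigr => j _; rewrite mxE exprMn.
apply: (fatou_le mO (f_ := fun m x => sqn (trunc_vec m.+1%:R (beta / 2) u x) `^ k)).
- move=> m; apply: measurableT_comp (measurable_powR _) _.
  under eq_fun do rewrite VE; apply: measurable_funM => //.
  exact: measurableT_comp (measurable_cutoff_pow _ _) mu'.
- exact: measurableT_comp (measurable_powR _) mu'.
- by move=> m x _; exact: powR_ge0.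
- by move=> x _; exact: powR_ge0.
- apply: nearW => x _; rewrite powRrM; apply: cvgn_powR_ge0 => //; [by move=> m; exact: sqn_ge0|exact: powR_ge0|].
  under eq_fun do rewrite VE.
  have -> : sqn (u x) `^ (p / 2) = sqn (u x) `^ beta * sqn (u x).
    rewrite -{3}(powRr1 (sqn_ge0 (u x))) -powRD; last first.
      by rewrite gt_eqF// ltr_wpDl.
    by congr powR; rewrite /beta; field.
  apply: cvgn_mul; last exact: cvg_cst.
  by apply: cutoff_pow_cvg => //; exact: sqn_ge0.
(* Only finiteness is claimed, so it suffices that the error is eventually below 1 and the energy
   below 1 + C. *)
- move/cvgrPdist_lt : cE => /(_ 1 ltr01); apply: filterS => m.
  rewrite sub0r normrN => /(le_lt_trans (ler_norm _)) Hm.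
  apply: le_trans (HK (in_H10_vec_trunc (n1 m) b20 mO sol.1)) _.
  rewrite lee_fin ler_wpM2l// ge0_ler_powR ?nnegrE//.
  + by apply: sumr_ge0 => i _; apply: sumr_ge0 => j _; exact: nrm2_ge0.
  + by rewrite addr_ge0.
  + apply: le_trans (trunc_energy_bound (n1 m)) _.
    by rewrite lerD2r ltW.
Qed.

End main_estimate.

(** * Euclidean norms and the conclusion *)

Lemma fsq_enorm (R : realType) m n (A : 'M[R]_(m, n)) (r : R) :
  enorm A `^ r = fsq A `^ (r / 2).
Proof.
rewrite /enorm (_ : \sum_i _ = fsq A); last first.
  by apply: eq_bigr => i _; apply: eq_bigr => j _; rewrite real_normK// num_real.
by rewrite -powR12_sqrt ?fsq_ge0// -powRrM mulrC.
Qed.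

Lemma enorm_sqr (R : realType) m n (A : 'M[R]_(m, n)) : enorm A ^+ 2 = fsq A.
Proof.
by rewrite -powR_mulrn ?sqrtr_ge0// fsq_enorm divff ?pnatr_eq0// powRr1// fsq_ge0.
Qed.

Lemma fsq_rV (R : realType) n (v : 'rV[R]_n) : fsq v = sqn v.
Proof. by rewrite /fsq big_ord1. Qed.

Lemma integral_fsq_lty (R : realType) n (Omega : set 'rV[R]_n.+1) (q : R)
    (F : 'rV[R]_n.+1 -> 'M[R]_n.+1) : measurable Omega -> 0 < q ->
  (forall i j, in_Lp Omega q (fun x => F x i j)) ->
  (\int[leb R n.+1]_(x in Omega) (fsq (F x) `^ (q / 2))%:E < +oo)%E.
Proof.
move=> mO q0 HF; have {}HF i j := (in_LpP mO _ q0).1 (HF i j).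
have q20 : 0 <= q / 2 by rewrite divr_ge0// ltW.
set c : R := n.+1%:R `^ (q / 2).
have mFq i j : measurable_fun Omega (fun x => `|F x i j| `^ q).
  by apply: measurableT_comp (measurable_powR _) _; apply: measurableT_comp => //; exact: (HF i j).1.
have mS : measurable_fun Omega (fun x => \sum_i \sum_j (`|F x i j| `^ q)%:E)%E.
  by apply: emeasurable_sum => i; apply: emeasurable_sum => j; exact/measurable_EFinP.
have S0 x : (0 <= \sum_i \sum_j (`|F x i j| `^ q)%:E)%E.
  by apply: sume_ge0 => i _; apply: sume_ge0 => j _; rewrite lee_fin powR_ge0.
apply: (@le_lt_trans _ _ (\int[leb R n.+1]_(x in Omega)
    ((c * c)%:E * \sum_i \sum_j (`|F x i j| `^ q)%:E))%E).
  apply: ge0_le_integral => //.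
  - by move=> x _; rewrite lee_fin powR_ge0.
  - apply/measurable_EFinP; apply: measurableT_comp (measurable_powR _) _.
    apply: measurable_sum => i; apply: measurable_sum => j; apply: measurable_funX.
    exact: (HF i j).1.
  - exact: emeasurable_funM.
  - move=> x _; under eq_bigr do rewrite sumEFin.
    rewrite sumEFin -EFinM lee_fin.
    apply: le_trans (powR_sum_le q20 _) _ => [i|]; first by apply: sumr_ge0 => j _; exact: sqr_ge0.
    rewrite -mulrA ler_wpM2l ?powR_ge0// mulr_sumr; apply: ler_sum => i _.
    apply: le_trans (powR_sum_le q20 _) _ => [j|]; first exact: sqr_ge0.
    rewrite ler_wpM2l ?powR_ge0//; apply: ler_sum => j _.
    rewrite -(real_normK (num_real (F x i j))) -powR_mulrn// -powRrM.
    by rewrite mulrC mulfVK// lexx.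
rewrite ge0_integralZl//; last by rewrite lee_fin mulr_ge0// powR_ge0.
apply: lte_mul_pinfty => //; first by rewrite lee_fin mulr_ge0// powR_ge0.
rewrite ge0_integral_sum//;
  try (by move=> i; apply: emeasurable_sum => j; exact/measurable_EFinP);
  try (by move=> i x _; apply: sume_ge0 => j _; rewrite lee_fin powR_ge0).
apply: lte_sum_pinfty => i _.
rewrite ge0_integral_sum//; try (by move=> j; exact/measurable_EFinP);
  try (by move=> j x _; rewrite lee_fin powR_ge0).
by apply: lte_sum_pinfty => j _; exact: (HF i j).2.
Qed.

Unset Implicit Arguments.
Set Strict Implicit.

Theorem theorem8 (R : realType) (N : nat) (hN : (3 <= N)%N)
  (Omega : set 'rV[R]_N) (hOmega : domain Omega) (hbnd : bounded_set Omega)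
  (lam mu : R) (hmu : 0 < mu) (hlm : 0 < lam + 2 * mu)
  (p : R) (hp : 2 <= p)
  (hcond : (1 - 2 / p) ^+ 2 <
     (if 0 < lam + mu then mu / (lam + 2 * mu) else (lam + 2 * mu) / mu)) :
  let q := N%:R * p / (N%:R + p - 2) in
  exists C : R,
  forall (F : 'rV[R]_N -> 'M[R]_N)
    (u : 'rV[R]_N -> 'rV[R]_N) (Du : 'rV[R]_N -> 'M[R]_N),
  (forall i j, in_Lp Omega q (fun x => F x i j)) ->
  dirichlet_solution Omega lam mu F u Du ->
  [/\ (\int[leb R N]_(x in Omega)
         (enorm (Du x) ^+ 2 * (enorm (u x) `^ (p - 2) + 1))%:E < +oo)%E,
      (\int[leb R N]_(x in Omega)
         (enorm (Du x) ^+ 2 * enorm (u x) `^ (p - 2))%:E <=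
       C%:E * (\int[leb R N]_(x in Omega) (enorm (F x) `^ q)%:E)
                `^ ((N%:R + p - 2) / N%:R))%E
    & forall j, in_Lp Omega (N%:R * p / (N%:R - 2)) (fun x => u x ord0 j)].
Proof.
case: N hN Omega hOmega hbnd => [|[|[|n]]]// _ Omega [oO _ _] hbnd q.
have mO : measurable Omega by exact: open_measurable_rV.
have fO := bounded_leb_lty hbnd mO.
have gap0 : 0 < elastic_gap lam mu p.
  (* The hypothesis on p multiplied by its denominator, which is positive in either case. *)
  rewrite /elastic_gap; move: hcond; case: ifP => _.
    by rewrite ltr_pdivlMr// subr_gt0.
  by rewrite ltr_pdivlMr// subr_gt0.
have [K K0 HK] := sobolev_H10_vec R n.
exists (estimate_constant n lam mu p K) => F u Du HF sol.
have q2 : 2 <= q by exact: dual_exponent_ge2.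
have q0 : 0 < q by exact: lt_le_trans q2.
have LF i j : L2 (leb R n.+3) Omega (fun x => F x i j) by exact: L2_of_in_Lp q2 mO fO (HF i j).
have AE : (\int[leb R n.+3]_(x in Omega) (fsq (F x) `^ (q / 2))%:E =
    (fine (\int[leb R n.+3]_(x in Omega) (fsq (F x) `^ (q / 2))%:E))%:E)%E.
  rewrite fineK// ge0_fin_numE ?integral_fsq_lty// integral_ge0// => x _.
  by rewrite lee_fin powR_ge0.
have [Lu LD _] := in_H10_vec_seq mO sol.1.
have mD : measurable_fun Omega (fun x => fsq (Du x)).
  by have /integrableP[/measurable_EFinP] := (integrable_fsq mO LD).1.
have mu' : measurable_fun Omega (fun x => sqn (u x)).
  by apply: measurable_sum => j; apply: measurable_funX; exact: (Lu j).1.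
have uE x : enorm (u x) `^ (p - 2) = sqn (u x) `^ ((p - 2) / 2) by rewrite fsq_enorm fsq_rV.
have DE x : (enorm (Du x) ^+ 2 * enorm (u x) `^ (p - 2))%:E =
    (fsq (Du x) * sqn (u x) `^ ((p - 2) / 2))%:E by rewrite enorm_sqr uE.
have H2 := weighted_gradient_bound mO hmu hp gap0 K0 (fun V M => HK Omega V M mO) LF sol AE.
split.
- under eq_integral do rewrite mulrDr mulr1 EFinD DE enorm_sqr.
  rewrite ge0_integralD//; last 4 first.
  + by move=> x _; rewrite lee_fin mulr_ge0 ?fsq_ge0 ?powR_ge0.
  + apply/measurable_EFinP/measurable_funM => //.
    exact: measurableT_comp (measurable_powR _) mu'.
  + by move=> x _; rewrite lee_fin fsq_ge0.
  + exact/measurable_EFinP.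
  rewrite lte_add_pinfty//; first by rewrite (le_lt_trans H2)// ltry.
  have /integrableP[_] := (integrable_fsq mO LD).1.
  by under eq_integral do rewrite gee0_abs ?lee_fin ?fsq_ge0//.
- under eq_integral do rewrite DE.
  under [in leRHS]eq_integral do rewrite fsq_enorm.
  by rewrite AE poweR_EFin -EFinM.
(* The exponent is written as 2r so that |u_j|^(2r) is the r-th power of u_j^2, which is at most
   |u|^2. *)
- move=> j; have -> : n.+3%:R * p / (n.+3%:R - 2) = p / 2 * (n.+3%:R / n.+1%:R) * 2.
    have -> : n.+3%:R - 2 = n.+1%:R :> R by rewrite -natrB.
    have : n.+1%:R != 0 :> R by rewrite pnatr_eq0.
    by move: (n.+3%:R : R) (n.+1%:R : R) => y x x0; field.
  set r := p / 2 * _.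
  have r0 : 0 < r by rewrite mulr_gt0// divr_gt0// (lt_le_trans _ hp).
  apply/(in_LpP mO); first by rewrite mulr_gt0.
  split; first exact: (Lu j).1.
  apply: le_lt_trans (solution_integrability mO hmu hp gap0 K0 (fun V M => HK Omega V M mO) LF sol AE).
  apply: ge0_le_integral => //.
  + apply/measurable_EFinP; apply: measurableT_comp (measurable_powR _) _.
    by apply: measurableT_comp => //; exact: (Lu j).1.
  + by apply/measurable_EFinP; exact: measurableT_comp (measurable_powR _) mu'.
  + move=> x _; rewrite lee_fin (mulrC r) (powRrM _ 2 r) powR_mulrn// real_normK ?num_real//.
    by rewrite ge0_ler_powR ?nnegrE ?sqr_ge0 ?sqn_ge0 ?(ltW r0)// sqr_le_sqn.
Qed.
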